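(* Let $\lambda_0\in(0,\pi)$. Let $\{U_t,t\in\mathbb{Z}\}$ be a zero-mean weakly stationary process with spectral density $f_U$ continuous on $[0,\pi]$ with $\inf_{\lambda\in[0,\pi]}f_U(\lambda)>0$, whose autocovariance $\gamma_U$ and fourth-order cumulants satisfy $$\sum_{h\in\mathbb{Z}}|h||\gamma_U(h)|<\infty,\qquad \sum_{h_1,h_2,h_3\in\mathbb{Z}}(1+|h_1|+|h_2|+|h_3|)\,|\mathrm{cum}(U_0,U_{h_1},U_{h_2},U_{h_3})|<\infty.$$ Let $(\delta_n)\subset(0,1)$ satisfy $\delta_n\sim n^{-\alpha}$ for some $\alpha\in(0,1/3)$, and for each $n$ let $X_{t,\delta_n}=A_{\delta_n}(L)^{-1}U_t$ with $A_\delta(z)=1-2(1-\delta)\cos(\lambda_0)z+(1-\delta)^2z^2$. Let $\rho_{\delta_n}(h)$ be the autocorrelation function of $\{X_{t,\delta_n}\}$ and $$a_{1,\delta_n}=\frac{\rho_{\delta_n}(1)(1-\rho_{\delta_n}(2))}{1-\rho^2_{\delta_n}(1)},\quad a_{2,\delta_n}=\frac{\rho_{\delta_n}(2)-\rho^2_{\delta_n}(1)}{1-\rho^2_{\delta_n}(1)},\quad \lambda_{0,\delta_n}=\arccos\Big(\frac{a_{1,\delta_n}(1-a_{2,\delta_n})}{-4a_{2,\delta_n}}\Big)$$ (the latter when $a_{2,\delta_n}<0$). Based on $X_{1,\delta_n},\dots,X_{n,\delta_n}$, let $I_{n}(\lambda)=(2\pi n)^{-1}|\sum_{t=1}^nX_{t,\delta_n}e^{-i\lambda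 t}|^2$, $\widehat\gamma(h)=\frac{2\pi}{n}\sum_{j\in\mathcal{G}(n)}I_n(\lambda_{j,n})\cos(\lambda_{j,n}h)$ with $\lambda_{j,n}=2\pi j/n$, $\mathcal{G}(n)=\{-N,\dots,-1,1,\dots,N\}$, $N=\lfloor n/2\rfloor$, $\widehat\rho(h)=\widehat\gamma(h)/\widehat\gamma(0)$, and let $\widehat a_{1,\delta_n},\widehat a_{2,\delta_n},\widehat\lambda_{0,\delta_n}$ be defined by the same formulas as $a_{1,\delta_n},a_{2,\delta_n},\lambda_{0,\delta_n}$ with $\rho_{\delta_n}(h)$ replaced by $\widehat\rho(h)$ (the last when $\widehat a_{2,\delta_n}<0$). Then, as $n\to\infty$, (i) $\widehat a_{1,\delta_n}-a_{1,\delta_n}=\mathcal{O}_P(n^{-(1+\alpha)/2})$ and $\widehat a_{2,\delta_n}-a_{2,\delta_n}=\mathcal{O}_P(n^{-(1+\alpha)/2})$; (ii) $\widehat\lambda_{0,\delta_n}=\lambda_{0,\delta_n}+\mathcal{O}_P(n^{-(1+\alpha)/2})$.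
   Context: $L$ is the lag operator and $A_\delta(L)^{-1}$ the causal inverse filter: $X_{t,\delta}=\sum_{j\ge0}b_{j,\delta}U_{t-j}$ with $1/A_\delta(z)=\sum_{j\ge0}b_{j,\delta}z^j$; its spectral density is $f_\delta(\lambda)=|1-(1-\delta)e^{-i(\lambda-\lambda_0)}|^{-2}|1-(1-\delta)e^{-i(\lambda+\lambda_0)}|^{-2}f_U(\lambda)$. $(a_{1,\delta},a_{2,\delta})$ coincide with the coefficients of the mean-square best AR(2) approximation of $X_{t,\delta}$ by $X_{t-1,\delta},X_{t-2,\delta}$. $\delta_n\sim n^{-\alpha}$ means $\delta_n$ is of exact order $n^{-\alpha}$.
   Formalization: The process U_t is also assumed to have finite fourth moments and fourth-order cumulants depending only on the lags, cum(U_t,U_{t+h1},U_{t+h2},U_{t+h3}) = cum(U_0,U_{h1},U_{h2},U_{h3}); with weak stationarity alone the claim is false. *)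

(* Defs.v *)
From HB Require Import structures.
From mathcomp Require Import all_boot all_order all_algebra.
From mathcomp Require Import all_classical all_reals all_analysis.
Set Implicit Arguments. Unset Strict Implicit. Unset Printing Implicit Defensive.
Import Order.TTheory GRing.Theory Num.Theory.
Import numFieldNormedType.Exports.
Local Open Scope classical_set_scope.
Local Open Scope ring_scope.

Section Defs.
Context {d : measure_display} {T : measurableType d} {R : realType}.
Variable P : probability T R.

Definition Ex (X : T -> R) : R := fine ('E_P[X])%E.

Definition cum4 (A B C D : T -> R) : R :=
  let m1 := Ex in
  let m2 X Y := Ex (fun w => X w * Y w) in
  let m3 X Y Z := Ex (fun w => X w * Y w * Z w) in
  Ex (fun w => A w * B w * C w * D w)
  - (m3 A B C * m1 D + m3 A B D * m1 C + m3 A C D * m1 B + m3 B C D * m1 A)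
  - (m2 A B * m2 C D + m2 A C * m2 B D + m2 A D * m2 B C)
  + 2 * (m2 A B * m1 C * m1 D + m2 A C * m1 B * m1 D + m2 A D * m1 B * m1 C
         + m2 B C * m1 A * m1 D + m2 B D * m1 A * m1 C + m2 C D * m1 A * m1 B)
  - 6 * (m1 A * m1 B * m1 C * m1 D).

Definition cov (X Y : T -> R) : R := Ex (fun w => X w * Y w) - Ex X * Ex Y.

(* U is a zero-mean weakly stationary process with autocovariance gam,
   finite fourth moments (so that fourth-order cumulants exist) *)
Definition zero_mean_weakly_stationary (U : int -> T -> R) (gam : int -> R) :=
  (forall t, measurable_fun setT (U t)) /\
  (forall t, P.-integrable setT (fun w => (U t w ^+ 4)%:E)) /\
  (forall t, Ex (U t) = 0) /\
  (forall t h, cov (U t) (U (t + h)) = gam h).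

Definition fourth_order_stationary (U : int -> T -> R) :=
  forall t h1 h2 h3,
    cum4 (U t) (U (t + h1)) (U (t + h2)) (U (t + h3))
    = cum4 (U 0) (U h1) (U h2) (U h3).

(* f is a spectral density of the autocovariance gam:
   gam h = \int_{-pi}^{pi} e^{i h l} f(l) dl  (real f: cos part = gam h, sin part = 0) *)
Definition is_spectral_density (gam : int -> R) (f : R -> R) :=
  (lebesgue_measure).-integrable `[- pi, pi] (fun l => (f l)%:E) /\
  forall h : int,
    gam h = \int[lebesgue_measure]_(l in `[- pi, pi]) (f l * cos (h%:~R * l)) /\
    0 = \int[lebesgue_measure]_(l in `[- pi, pi]) (f l * sin (h%:~R * l)).

End Defs.

Definition sumZ {R : realType} (N : nat) (F : int -> R) : R :=
  \sum_(i < (2 * N).+1) F (i%:Z - N%:Z).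

(* coefficients b_j of 1/A_delta(z), A_delta(z) = 1 - 2(1-delta)cos(l0) z + (1-delta)^2 z^2:
   b_0 = 1, b_1 = phi1, b_j = phi1 b_{j-1} + phi2 b_{j-2}. bpair j = (b_j, b_{j-1}). *)
Fixpoint bpair {R : realType} (l0 delta : R) (j : nat) : R * R :=
  match j with
  | 0 => (1, 0)
  | j'.+1 => let: (x, y) := bpair l0 delta j' in
             (2 * (1 - delta) * cos l0 * x - (1 - delta) ^+ 2 * y, x)
  end.
Definition bcoef {R : realType} (l0 delta : R) (j : nat) : R := (bpair l0 delta j).1.

(* X_{t,delta} = A_delta(L)^{-1} U_t = sum_{j>=0} b_{j,delta} U_{t-j} (pointwise limit) *)
Definition Xproc {d} {T : measurableType d} {R : realType}
  (U : int -> T -> R) (l0 delta : R) (t : int) (w : T) : R :=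
  limn (fun m => \sum_(0 <= j < m) bcoef l0 delta j * U (t - j%:Z) w).

Definition rhoX {d} {T : measurableType d} {R : realType} (P : probability T R)
  (U : int -> T -> R) (l0 delta : R) (h : int) : R :=
  cov P (Xproc U l0 delta 0) (Xproc U l0 delta h)
  / cov P (Xproc U l0 delta 0) (Xproc U l0 delta 0).

Definition a1f {R : realType} (r1 r2 : R) : R := r1 * (1 - r2) / (1 - r1 ^+ 2).
Definition a2f {R : realType} (r1 r2 : R) : R := (r2 - r1 ^+ 2) / (1 - r1 ^+ 2).
Definition lamf {R : realType} (a1 a2 : R) : R := acos (a1 * (1 - a2) / (- 4 * a2)).

(* periodogram I_n(l) = (2 pi n)^{-1} |sum_{t=1}^n X_t e^{-i l t}|^2 *)
Definition periodogram {d} {T : measurableType d} {R : realType}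
  (U : int -> T -> R) (l0 delta : R) (n : nat) (l : R) (w : T) : R :=
  ((\sum_(1 <= t < n.+1) Xproc U l0 delta t%:Z w * cos (l * t%:R)) ^+ 2
   + (\sum_(1 <= t < n.+1) Xproc U l0 delta t%:Z w * sin (l * t%:R)) ^+ 2)
  / (2 * pi * n%:R).

Definition lamj {R : realType} (n : nat) (j : int) : R := 2 * pi * j%:~R / n%:R.

Definition gamhat {d} {T : measurableType d} {R : realType}
  (U : int -> T -> R) (l0 delta : R) (n : nat) (h : int) (w : T) : R :=
  2 * pi / n%:R *
  \sum_(k < n./2)
     (periodogram U l0 delta n (lamj n (k.+1)%:Z) w * cos (lamj n (k.+1)%:Z * h%:~R)
      + periodogram U l0 delta n (lamj n (- (k.+1)%:Z)) w
          * cos (lamj n (- (k.+1)%:Z) * h%:~R)).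

Definition rhohat {d} {T : measurableType d} {R : realType}
  (U : int -> T -> R) (l0 delta : R) (n : nat) (h : int) (w : T) : R :=
  gamhat U l0 delta n h w / gamhat U l0 delta n 0 w.

Definition bigO_prob {d} {T : measurableType d} {R : realType} (P : probability T R)
  (Y : nat -> T -> R) (r : nat -> R) :=
  forall eps : R, 0 < eps -> exists M : R, 0 < M /\ exists N : nat, forall n, (N <= n)%N ->
    (P [set w | (M * r n < `|Y n w|)%R] <= eps%:E)%E.

(* Main.v *)
(* With r = 1 - delta the process satisfies X_t = 2 r cos(l0) X_(t-1) - r^2 X_(t-2) + U_t,
   so its autocovariances solve the Yule-Walker equations with the bounded right-hand
   sides g_k = E[U_t X_(t-k)].  Up to the periodogram ordinates at 0 and pi, gamma-hat is
   a circular sample autocovariance; it therefore solves the same equations with g_k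
   replaced by G_k = n^(-1) sum_t U_t X_(t-k), up to edge terms of order 1/(n delta).
   The cumulant and covariance bounds give G_k - g_k = O_P((n delta)^(-1/2)).

   The determinant of the system is of order delta, but the variance is of order 1/delta
   (the lower bound follows from a Poisson kernel estimate of the spectral density at
   l0), so an error z in the equations only moves the autocorrelations by O(delta z),
   which is O_P((delta / n)^(1/2)) = O_P(n^(-(1 + alpha) / 2)).  As delta -> 0 the
   autocorrelations tend to (cos l0, cos (2 l0)), near which the maps to (a1, a2) and to
   the estimated frequency are Lipschitz. *)
Require Import Defs.
From HB Require Import structures.
From mathcomp Require Import all_boot all_order all_algebra.
From mathcomp Require Import all_classical all_reals all_analysis.
From mathcomp Require Import measurable_realfun.
From mathcomp Require Import ring lra zify.
Import Order.TTheory GRing.Theory Num.Theory.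
Import numFieldNormedType.Exports.
Local Open Scope classical_set_scope.
Local Open Scope ring_scope.

(** * Impulse response and trigonometric sums *)

(** The extra factor [delta] comes from a cancellation. Each sample autocovariance may err by
    [z / delta], but in [D1 - (y1 / y0) * D0] the variance error enters only through [g1 / y0], of
    order [delta]; this combination is [O(z)], and dividing by [D0], of order [1 / delta], gives
    [delta * z].

    In the variance of [G_k] only one of the two sums over filter coefficients costs their l1 norm,
    of order [1 / delta]. The coefficients are bounded by [1 / sin l0], so the other sum is absorbed
    by summable covariances and cumulants.

    When the equations are solved for the variance, [g1] carries a factor [1 - r^2], so the main
    term is [g0 - r^2 g2]. There the filter coefficients combine into [2 r^j cos(j l0)], which turns
    the term into the integral of the spectral density against the Poisson kernel centred at [l0].

    The filtered process is only an almost sure limit, and no integrable bound for the squares of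
    its lag sums is at hand. Moments are therefore computed for truncated filters, uniformly in the
    truncation, and tail bounds pass to the limit by Fatou. *)

Section Coefficients.
Context {R : realType}.
Implicit Types (delta x : R).

Lemma bcoef0 l0 delta : bcoef l0 delta 0 = 1.
Proof. by []. Qed.

Lemma bcoef1 l0 delta : bcoef l0 delta 1 = 2 * (1 - delta) * cos l0.
Proof. by rewrite /bcoef /= mulr0 subr0 mulr1. Qed.

Lemma bcoefSS l0 delta j : bcoef l0 delta j.+2 =
  2 * (1 - delta) * cos l0 * bcoef l0 delta j.+1
  - (1 - delta) ^+ 2 * bcoef l0 delta j.
Proof. by rewrite /bcoef /=; case: (bpair l0 delta j) => a b. Qed.

(** The recursion has characteristic roots [(1 - delta) e^{i l0}] and its conjugate. Two consecutive
    indices are carried through the induction because it has order two. *)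
Lemma sin_bcoef l0 delta j :
  sin l0 * bcoef l0 delta j = (1 - delta) ^+ j * sin (j.+1%:R * l0).
Proof.
suff [] : sin l0 * bcoef l0 delta j = (1 - delta) ^+ j * sin (j.+1%:R * l0) /\
  sin l0 * bcoef l0 delta j.+1 = (1 - delta) ^+ j.+1 * sin (j.+2%:R * l0) by [].
elim: j => [|j [IH1 IH2]].
  rewrite bcoef0 bcoef1 expr0 expr1 !mul1r mulr1; split => //.
  by rewrite (_ : 2%:R * l0 = l0 *+ 2) ?sin_mulr2n; [ring|rewrite mulr_natl].
split => //; rewrite bcoefSS.
transitivity (2 * (1 - delta) * cos l0 * (sin l0 * bcoef l0 delta j.+1)
   - (1 - delta) ^+ 2 * (sin l0 * bcoef l0 delta j)); first by ring.
rewrite IH2 IH1 !exprS.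
have -> : j.+3%:R * l0 = j.+2%:R * l0 + l0 by rewrite -natr1; ring.
have -> : j.+1%:R * l0 = j.+2%:R * l0 - l0 by rewrite -[j.+2%:R]natr1; ring.
by rewrite sinB sinD; ring.
Qed.

(** This turns [g0 - r^2 g2] into a Poisson sum: a difference of sines two indices apart is a cosine
    times [2 sin l0]. *)
Lemma bcoefB l0 delta j : sin l0 != 0 ->
  bcoef l0 delta j.+2 - (1 - delta) ^+ 2 * bcoef l0 delta j
  = 2 * (1 - delta) ^+ j.+2 * cos (j.+2%:R * l0).
Proof.
move=> s0; apply: (mulfI s0); rewrite mulrBr sin_bcoef mulrCA sin_bcoef.
have -> : j.+3%:R * l0 = j.+2%:R * l0 + l0 by rewrite -natr1; ring.
have -> : j.+1%:R * l0 = j.+2%:R * l0 - l0 by rewrite -[j.+2%:R]natr1; ring.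
by rewrite sinD sinB !exprS; ring.
Qed.

Lemma norm_bcoef_le l0 delta j : 0 < sin l0 -> 0 < delta < 1 ->
  `|bcoef l0 delta j| <= (sin l0)^-1 * (1 - delta) ^+ j.
Proof.
move=> s0 /andP[d0 d1]; rewrite ler_pdivlMl// -{1}(gtr0_norm s0) -normrM.
have r0 : 0 <= (1 - delta) ^+ j by rewrite exprn_ge0// subr_ge0 ltW.
by rewrite sin_bcoef normrM (ger0_norm r0) ler_piMr ?sin_max.
Qed.

Lemma sum_geo_le (r : R) n : 0 <= r < 1 -> \sum_(j < n) r ^+ j <= (1 - r)^-1.
Proof.
move=> /andP[r0 r1]; rewrite -[leRHS]mul1r ler_pdivlMr ?subr_gt0//.
have -> : (\sum_(j < n) r ^+ j) * (1 - r) = 1 - r ^+ n.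
  by rewrite -opprB mulrN mulrC -subrX1 opprB.
by rewrite gerBl exprn_ge0.
Qed.

(** The l1 norm is the source of every factor [1 / delta] in the moment bounds; a single coefficient
    is bounded uniformly in [delta]. *)
Lemma sum_norm_bcoef_le l0 delta n : 0 < sin l0 -> 0 < delta < 1 ->
  \sum_(j < n) `|bcoef l0 delta j| <= (sin l0)^-1 * delta^-1.
Proof.
move=> s0 d01; apply: le_trans (_ : (sin l0)^-1 * \sum_(j < n) (1 - delta) ^+ j <= _).
  by rewrite mulr_sumr ler_sum// => j _; exact: norm_bcoef_le.
case/andP: d01 => d0 d1; apply: ler_wpM2l; first by rewrite invr_ge0 ltW.
apply: le_trans (sum_geo_le _ _ _) _; last by rewrite opprB addrCA subrr addr0.
by apply/andP; split; lra.
Qed.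

End Coefficients.

Section TrigonometricSums.
Context {R : realType}.
Implicit Types (x : R).

(** Real part of [(1 - e^{ix}) sum_(k < n) e^{ikx} = 1 - e^{inx}]; [geom_sin] is the imaginary
    part. *)
Lemma geom_cos x n : (1 - cos x) * \sum_(k < n) cos (k%:R * x)
  + sin x * \sum_(k < n) sin (k%:R * x) = 1 - cos (n%:R * x).
Proof.
elim: n => [|n IH]; first by rewrite !big_ord0 !mulr0 mul0r cos0; ring.
rewrite !big_ord_recr/= !mulrDr addrACA IH.
by rewrite -[n.+1%:R]natr1 [in RHS]mulrDl mul1r cosD; ring.
Qed.

Lemma geom_sin x n : (1 - cos x) * \sum_(k < n) sin (k%:R * x)
  - sin x * \sum_(k < n) cos (k%:R * x) = - sin (n%:R * x).
Proof.
elim: n => [|n IH]; first by rewrite !big_ord0 !mulr0 mul0r sin0; ring.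
rewrite !big_ord_recr/= !mulrDr opprD addrACA IH.
by rewrite -[n.+1%:R]natr1 [in RHS]mulrDl mul1r sinD; ring.
Qed.

Lemma cosDnat2pi x k : cos (x + k%:R * (2 * pi)) = cos x.
Proof.
by rewrite (_ : k%:R * (2 * pi) = (pi *+ 2) *+ k) ?(periodicn (@cosD2pi R))// mulr_natl mulr_natl.
Qed.

Lemma sinDnat2pi x k : sin (x + k%:R * (2 * pi)) = sin x.
Proof.
by rewrite (_ : k%:R * (2 * pi) = (pi *+ 2) *+ k) ?(periodicn (@sinD2pi R))// mulr_natl mulr_natl.
Qed.

Lemma cos_nat2pi k : cos (k%:R * (2 * pi)) = 1 :> R.
Proof. by rewrite -[k%:R * _]add0r cosDnat2pi cos0. Qed.

Lemma sin_nat2pi k : sin (k%:R * (2 * pi)) = 0 :> R.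
Proof. by rewrite -[k%:R * _]add0r sinDnat2pi sin0. Qed.

Lemma cos_lt1 x : 0 < x < 2 * pi -> cos x < 1.
Proof.
move=> /andP[x0 x2]; rewrite -[x](mulfVK (_ : 2 != 0 :> R))// mulr_natr.
have : 0 < sin (x / 2) by apply: sin_gt0_pi; apply/andP; split; lra.
rewrite cos_mulr2n cos2sin2 => s0.
have := exprn_gt0 2 s0; lra.
Qed.

(** Orthogonality of the characters of the integers modulo [n]. *)
Lemma sum_cos_dvd n m : (0 < n)%N ->
  \sum_(k < n) cos (k%:R * (2 * pi * m%:R / n%:R)) =
  (if (n %| m)%N then n%:R else 0) :> R.
Proof.
move=> n0; have nR : n%:R != 0 :> R by rewrite pnatr_eq0 -lt0n.
have pi0 : 0 < pi :> R := pi_gt0 R.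
have red k : cos (k%:R * (2 * pi * m%:R / n%:R)) =
             cos (k%:R * (2 * pi * (m %% n)%N%:R / n%:R)) :> R.
  rewrite [in LHS](divn_eq m n) natrD natrM.
  rewrite (_ : _ * _ = k%:R * (2 * pi * (m %% n)%:R / n%:R) + (k * (m %/ n))%N%:R * (2 * pi)).
    by rewrite cosDnat2pi.
  by rewrite natrM; field.
under eq_bigr do rewrite red.
case: ifPn => [/eqP ->|ndm].
  rewrite (eq_bigr (fun=> 1)) ?sumr_const ?card_ord// => k _.
  by rewrite mulr0 mul0r mulr0 cos0.
set x := 2 * pi * (m %% n)%:R / n%:R.
have x0 : 0 < x < 2 * pi.
  have mR : 0 < (m %% n)%:R :> R by rewrite ltr0n lt0n.
  have mnR : (m %% n)%:R < n%:R :> R by rewrite ltr_nat ltn_mod.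
  rewrite /x; apply/andP; split; first by rewrite divr_gt0 ?ltr0n// !mulr_gt0.
  by rewrite ltr_pdivrMr ?ltr0n// ltr_pM2l ?mulr_gt0.
have nx : n%:R * x = (m %% n)%:R * (2 * pi) by rewrite /x; field.
have := geom_cos x n; have := geom_sin x n.
rewrite nx cos_nat2pi sin_nat2pi oppr0 subrr.
set C := \sum_(k < n) cos _; set S := \sum_(k < n) sin _ => e1 e2.
(* Eliminating the sine sum leaves the factor [|1 - e^{ix}|^2 = 2 - 2 cos x], which is nonzero for
   [0 < x < 2 pi]. *)
have h : (2 - 2 * cos x) * C = 0.
  transitivity ((1 - cos x) * ((1 - cos x) * C + sin x * S)
     - sin x * ((1 - cos x) * S - sin x * C)); last by rewrite e1 e2; ring.
  have := cos2Dsin2 x => e; rewrite (_ : 2 - 2 * cos x =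
    1 - 2 * cos x + (cos x ^+ 2 + sin x ^+ 2)); last by rewrite e; ring.
  ring.
by move/eqP: h; rewrite mulf_eq0 => /orP[|/eqP//]; have := cos_lt1 x x0; lra.
Qed.

(** Reflecting [k] to [n - k] gives a second copy of the half sum. For even [n] the two copies
    overlap in the middle index, which is then counted twice. *)
Lemma sum_half_sym (c : nat -> R) n : (0 < n)%N ->
  (forall k, (k <= n)%N -> c (n - k)%N = c k) ->
  2 * \sum_(k < n./2) c k.+1 =
  \sum_(k < n) c k - c 0%N + (if odd n then 0 else c n./2).
Proof.
move=> n0 sym; set N := n./2.
have NE := odd_double_half n; rewrite -/N in NE.
have Nn : (N <= n)%N by lia.
have E1 : \sum_(k < N) c k.+1 = \sum_(1 <= k < N.+1) c k.
  by rewrite big_add1 big_mkord.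
have E2 : \sum_(k < N) c k.+1 = \sum_((n - N)%N <= k < n) c k.
  rewrite -(big_mkord xpredT (fun k => c k.+1)) big_nat_rev /=.
  rewrite -{1}[(n - N)%N]add0n big_addn subKn// !big_mkord.
  apply: eq_bigr => k _; rewrite -sym; last by have := ltn_ord k; lia.
  by congr c; have := ltn_ord k; lia.
rewrite mulrDl !mul1r {1}E1 E2 -(big_mkord xpredT c) (big_ltn n0).
rewrite [c 0%N + _]addrC addrK.
case: ifPn => od.
  rewrite addr0 (_ : (n - N)%N = N.+1); last by lia.
  by rewrite -big_cat_nat//; lia.
have N0 : (0 < N)%N by lia.
rewrite (_ : (n - N)%N = N); last by lia.
rewrite (@big_cat_nat _ _ _ N 1 n) //=.
by rewrite (@big_nat_recr _ _ _ N 1) //= addrAC.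
Qed.

End TrigonometricSums.

(** * Yule-Walker equations of a sample *)

Section SampleAutocovariance.
Context {R : realType}.
Implicit Types (x u : int -> R) (n h : nat).

(** [pgram] and [ghat] are [periodogram] and [gamhat] for one deterministic path, so that the
    algebra below can be done pathwise. *)
Definition pgram x n (l : R) : R :=
  ((\sum_(1 <= t < n.+1) x t%:Z * cos (l * t%:R)) ^+ 2
   + (\sum_(1 <= t < n.+1) x t%:Z * sin (l * t%:R)) ^+ 2) / (2 * pi * n%:R).

Definition ghat x n (h : int) : R :=
  2 * pi / n%:R *
  \sum_(k < n./2) (pgram x n (lamj n (k.+1)%:Z) * cos (lamj n (k.+1)%:Z * h%:~R)
    + pgram x n (lamj n (- (k.+1)%:Z)) * cos (lamj n (- (k.+1)%:Z) * h%:~R)).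

(** For [h > 0] the sum reaches back to times before the sample. These unobserved values make the
    recursion exact and are accounted for as edge terms. *)
Definition lagsum x y n h : R :=
  \sum_(i < n) x i.+1%:Z * y (i.+1%:Z - h%:Z).

Lemma pgramN x n l : pgram x n (- l) = pgram x n l.
Proof.
rewrite /pgram; congr (_ / _); congr (_ + _).
  by congr (_ ^+ 2); apply: eq_bigr => t _; rewrite mulNr cosN.
rewrite -[RHS]sqrrN -sumrN; congr (_ ^+ 2); apply: eq_bigr => t _.
by rewrite mulNr sinN mulrN.
Qed.

Lemma pgramE x n l : 2 * pi * n%:R * pgram x n l =
  (n != 0%N)%:R * \sum_(i < n) \sum_(j < n) x i.+1%:Z * x j.+1%:Z * cos (l * (i%:R - j%:R)).
Proof.
case: n => [|n]; first by rewrite mulr0 !mul0r.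
rewrite mul1r /pgram mulrC divfK; last first.
  by rewrite mulf_neq0// ?mulf_neq0// ?gt_eqF ?pi_gt0.
rewrite !big_add1 /= !big_mkord !expr2 !mulr_suml -big_split; apply: eq_bigr => i _.
rewrite /= !mulr_sumr -big_split; apply: eq_bigr => j _ /=.
have -> : l * (i%:R - j%:R) = l * i.+1%:R - l * j.+1%:R.
  by rewrite -[i.+1%:R]natr1 -[j.+1%:R]natr1; ring.
by rewrite cosB; ring.
Qed.

Lemma lamjN n j : @lamj R n (- j) = - lamj n j.
Proof. by rewrite /lamj intrN mulrN mulNr. Qed.

(** Adding [n] keeps the natural subtraction from truncating. The left side lies strictly between
    [0] and [3 n], so divisibility means that it is [n] or [2 n]. *)
Lemma circular_partner n h (i j : 'I_n) : (h < n)%N ->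
  (n %| j + h + n - i)%N = (j == (if (h <= i) then i - h else i + n - h)%N :> nat).
Proof.
move=> hn; have := ltn_ord i; have := ltn_ord j => jn iN.
apply/idP/eqP => [/dvdnP[q]|->].
  case: q => [|[|[|q]]]; rewrite ?mulSn ?mul0n; case: ifP => // hi; lia.
case: ifP => hi.
  by rewrite (_ : (_ + _ + _ - _)%N = n) //; lia.
by rewrite (_ : (_ + _ + _ - _)%N = (2 * n)%N) ?dvdn_mull//; lia.
Qed.

Lemma cos_lamj_shift n k (a b : nat) : (0 < n)%N -> (b <= a + n)%N ->
  cos (lamj n k%:Z * (a%:R - b%:R)) = cos (k%:R * (2 * pi * (a + n - b)%:R / n%:R)) :> R.
Proof.
move=> n0 ab; have nR : n%:R != 0 :> R by rewrite pnatr_eq0 -lt0n.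
rewrite -[LHS](cosDnat2pi _ k); congr cos; rewrite /lamj natrB// natrD.
by rewrite -pmulrn; field.
Qed.

(** Discrete Parseval identity: over the full grid of Fourier frequencies the periodogram is the
    transform of the circular autocovariance. *)
Lemma circular_sum x n h : (h < n)%N ->
  2 * pi / n%:R * \sum_(k < n) pgram x n (lamj n k%:Z) * cos (lamj n k%:Z * h%:R) =
  n%:R^-1 * \sum_(i < n) x i.+1%:Z * x (if (h <= i)%N then i.+1%:Z - h%:Z else i.+1%:Z - h%:Z + n%:Z).
Proof.
move=> hn; have n0 : (0 < n)%N by apply: leq_ltn_trans hn.
have nR : n%:R != 0 :> R by rewrite pnatr_eq0 -lt0n.
have pi0 : pi != 0 :> R by rewrite gt_eqF ?pi_gt0.
pose D (m : nat) : R := \sum_(k < n) cos (k%:R * (2 * pi * m%:R / n%:R)).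
have E : \sum_(k < n) 2 * pi * n%:R * pgram x n (lamj n k%:Z) * cos (lamj n k%:Z * h%:R) =
   \sum_(i < n) \sum_(j < n) x i.+1%:Z * x j.+1%:Z * D (j + h + n - i)%N.
  (* The product of two cosines splits into two halves, which agree after exchanging [i] and [j]. *)
  transitivity (\sum_(i < n) \sum_(j < n) x i.+1%:Z * x j.+1%:Z *
     (2^-1 * D (i + h + n - j)%N + 2^-1 * D (j + h + n - i)%N)); last first.
    transitivity (2^-1 * (\sum_(i < n) \sum_(j < n) x i.+1%:Z * x j.+1%:Z * D (i + h + n - j)%N)
      + 2^-1 * (\sum_(i < n) \sum_(j < n) x i.+1%:Z * x j.+1%:Z * D (j + h + n - i)%N)).
      rewrite !mulr_sumr -big_split; apply: eq_bigr => i _ /=.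
      rewrite !mulr_sumr -big_split; apply: eq_bigr => j _ /=; ring.
    rewrite [X in 2^-1 * X + _]exchange_big /= -mulrDr.
    set A := (X in 2^-1 * (X + _)); set B := (X in 2^-1 * (_ + X)).
    have -> : A = B by apply: eq_bigr => i _; apply: eq_bigr => j _; rewrite [x _ * x _]mulrC.
    by rewrite -[RHS]/B; field.
  under eq_bigr => k _ do rewrite pgramE -lt0n n0 mul1r mulr_suml.
  rewrite exchange_big; apply: eq_bigr => i _.
  under eq_bigr => k _ do rewrite mulr_suml.
  rewrite exchange_big; apply: eq_bigr => j _ /=.
  rewrite /D !mulr_sumr -big_split mulr_sumr; apply: eq_bigr => k _ /=.
  have hi := ltn_ord i; have hj := ltn_ord j.
  rewrite -(cos_lamj_shift _ _ (i + h) j) //; last lia.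
  rewrite -(cos_lamj_shift _ _ (j + h) i) //; last lia.
  rewrite !natrD -mulrA; congr (_ * _).
  set l := lamj n k%:Z.
  have -> : l * (i%:R + h%:R - j%:R) = l * (i%:R - j%:R) + l * h%:R by ring.
  have -> : l * (j%:R + h%:R - i%:R) = l * h%:R - l * (i%:R - j%:R) by ring.
  by rewrite cosD cosB; field.
transitivity (n%:R^-1 * n%:R^-1 * \sum_(k < n)
   2 * pi * n%:R * pgram x n (lamj n k%:Z) * cos (lamj n k%:Z * h%:R)).
  by rewrite !mulr_sumr; apply: eq_bigr => k _; field.
rewrite E -mulrA mulr_sumr; congr (_ * _); apply: eq_bigr => i _.
have sn : ((if (h <= i)%N then i - h else i + n - h) < n)%N.
  by have := ltn_ord i; case: ifP; lia.
rewrite (bigD1 (Ordinal sn)) //= big1 => [|j jn].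
  rewrite addr0 /D sum_cos_dvd// (circular_partner _ _ i (Ordinal sn) hn) eqxx.
  rewrite mulrC mulfK// ; congr (_ * x _).
  by case: ifP => hi; lia.
rewrite /D sum_cos_dvd// circular_partner// ifN ?mulr0//.
Qed.

Lemma circular_lagsum x n h : (h < n)%N ->
  \sum_(i < n) x i.+1%:Z * x (if (h <= i)%N then i.+1%:Z - h%:Z else i.+1%:Z - h%:Z + n%:Z) =
  lagsum x x n h
  + \sum_(i < h) x i.+1%:Z * (x (i.+1%:Z - h%:Z + n%:Z) - x (i.+1%:Z - h%:Z)).
Proof.
move=> hn; pose F i := x i.+1%:Z * (x (i.+1%:Z - h%:Z + n%:Z) - x (i.+1%:Z - h%:Z)).
rewrite -/(F _) (@big_ord_widen _ _ _ h n F (ltnW hn)).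
rewrite [X in _ + X]big_mkcond -big_split; apply: eq_bigr => i _ /=.
by rewrite ltnNge /F; case: ifP => hi /=; rewrite ?addr0// -mulrDr [x _ + (_ - _)]addrC subrK.
Qed.

(** The grid omits the frequency 0, which subtracts the squared mean. For even [n] it contains both
    [pi] and [- pi], so that one ordinate is counted twice and adds the squared alternating mean. *)
Lemma ghatE x n h : (h < n)%N -> ghat x n h%:Z =
  n%:R^-1 * (lagsum x x n h
     + \sum_(i < h) x i.+1%:Z * (x (i.+1%:Z - h%:Z + n%:Z) - x (i.+1%:Z - h%:Z)))
  - (n%:R^-1 * \sum_(i < n) x i.+1%:Z) ^+ 2
  + (if odd n then 0 else (-1) ^+ h * (n%:R^-1 * \sum_(i < n) (-1) ^+ i * x i.+1%:Z) ^+ 2).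
Proof.
move=> hn; have n0 : (0 < n)%N by apply: leq_ltn_trans hn.
have nR : n%:R != 0 :> R by rewrite pnatr_eq0 -lt0n.
have pi0 : pi != 0 :> R by rewrite gt_eqF ?pi_gt0.
pose c (k : nat) := pgram x n (lamj n k%:Z) * cos (lamj n k%:Z * h%:R).
have -> : ghat x n h%:Z = 2 * pi / n%:R * (2 * \sum_(k < n./2) c k.+1).
  rewrite /ghat; congr (_ * _); rewrite mulr_sumr; apply: eq_bigr => k _.
  by rewrite lamjN pgramN mulNr cosN mulr_natl mulr2n.
(* Both factors are even and [2 pi]-periodic in the frequency at integer times. *)
have csym k : (k <= n)%N -> c (n - k)%N = c k.
  move=> kn; rewrite /c.
  have -> : lamj n (n - k)%N%:Z = - lamj n k%:Z + 1%:R * (2 * pi) :> R.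
    rewrite /lamj -subzn// intrB -!pmulrn; field => //.
  rewrite -(pgramN _ _ (lamj n k%:Z)) -[cos (lamj _ _ * _)]cosN -(mulNr (lamj _ _)).
  move: (- lamj n k%:Z) => l; congr (_ * _); last first.
    rewrite -[RHS](cosDnat2pi _ h); congr cos; ring.
  rewrite /pgram; congr ((_ ^+ 2 + _ ^+ 2) / _); apply: eq_bigr => t _; congr (_ * _).
    rewrite -[RHS](cosDnat2pi _ t); congr cos; ring.
  rewrite -[RHS](sinDnat2pi _ t); congr sin; ring.
rewrite (sum_half_sym _ _ n0 csym) mulrDr mulrBr circular_sum// circular_lagsum//.
congr (_ - _ + _).
  rewrite /c /lamj mulr0 mul0r mul0r cos0 mulr1 /pgram.
  rewrite [X in (_ + X ^+ 2)]big1 => [|t _]; last by rewrite mul0r sin0 mulr0.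
  under eq_bigr do rewrite mul0r cos0 mulr1.
  rewrite expr0n addr0 big_add1 big_mkord /=.
  by move: pi0; move: (pi : R) => p p0; field; rewrite nR p0.
case: ifPn => [_|od]; first by rewrite mulr0.
have -> : c n./2 = pgram x n pi * cos (h%:R * pi).
  rewrite /c; suff -> : lamj n n./2%:Z = pi :> R by rewrite [h%:R * _]mulrC.
  have NE := odd_double_half n; rewrite (negbTE od) add0n in NE.
  rewrite /lamj -pmulrn -{2}NE -muln2 natrM; field.
  by rewrite pnatr_eq0; lia.
have cospin (t : nat) : cos (t%:R * pi) = (-1) ^+ t :> R /\ sin (t%:R * pi) = 0 :> R.
  elim: t => [|t [IH1 IH2]]; first by rewrite mul0r cos0 sin0.
  by rewrite -natr1 mulrDl mul1r (cosD (t%:R * pi)) (sinD (t%:R * pi)) IH1 IH2 cospi sinpi exprS; split; ring.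
rewrite (cospin h).1 /pgram.
rewrite [X in (_ + X ^+ 2)]big1 => [|t _]; last by rewrite mulrC [pi * _]mulrC (cospin t).2 mul0r.
under eq_bigr do rewrite [pi * _]mulrC (cospin _).1.
rewrite expr0n addr0 big_add1 big_mkord /=.
have -> : \sum_(i < n) x i.+1%:Z * (-1) ^+ i.+1 = - \sum_(i < n) (-1) ^+ i * x i.+1%:Z.
  by rewrite -sumrN; apply: eq_bigr => i _; rewrite exprS; ring.
by move: pi0; move: (pi : R) => p p0; field; rewrite nR p0.
Qed.

End SampleAutocovariance.

Section SampleYuleWalker.
Context {R : realType}.
Implicit Types (x u F : int -> R) (n h : nat).

Lemma sum_shift F n : \sum_(i < n) F (i.+1%:Z - 1) =
  \sum_(i < n) F i.+1%:Z + F 0 - F n%:Z.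
Proof.
elim: n => [|n IH]; first by rewrite !big_ord0; ring.
rewrite !big_ord_recr/= IH (_ : n.+1%:Z - 1 = n%:Z); [ring|lia].
Qed.

Lemma twisted_sum_shift F (sg : R) n : \sum_(i < n) sg ^+ i * F (i.+1%:Z - 1) =
  sg * \sum_(i < n) sg ^+ i * F i.+1%:Z + F 0 - sg ^+ n * F n%:Z.
Proof.
elim: n => [|n IH]; first by rewrite !big_ord0; ring.
rewrite !big_ord_recr/= IH (_ : n.+1%:Z - 1 = n%:Z); [rewrite exprS; ring|lia].
Qed.

Let subz11 (t : int) : t - 1 - 1 = t - 2.
Proof. by rewrite -addrA. Qed.

Lemma norm_le1_sqrD (a b : R) : a ^+ 2 + b ^+ 2 = 1 -> `|a| <= 1.
Proof.
move=> ab; rewrite -(@expr_le1 _ 2)// real_normK ?num_real//.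
by have := sqr_ge0 b; lra.
Qed.

Variables (x u : int -> R) (r c s : R).
Hypothesis rec : forall t, x t = 2 * r * c * x (t - 1) - r ^+ 2 * x (t - 2) + u t.

Lemma lagsum_yw0 n : lagsum x x n 0 =
  2 * r * c * lagsum x x n 1 - r ^+ 2 * lagsum x x n 2 + lagsum u x n 0.
Proof.
rewrite /lagsum !mulr_sumr -sumrN -!big_split; apply: eq_bigr => i _ /=.
by rewrite subr0 {1}rec; ring.
Qed.

(** The recursion is multiplied by [x (t - 1)] and summed. Unlike at lag 0, sums over shifted
    windows appear, and each shift leaves boundary values at both ends of the sample. *)
Lemma lagsum_yw1 n : lagsum x x n 1 =
  2 * r * c * (lagsum x x n 0 + x 0 ^+ 2 - x n%:Z ^+ 2)
  - r ^+ 2 * (lagsum x x n 1 + x 0 * x (- 1) - x n%:Z * x (n%:Z - 1))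
  + lagsum u x n 1.
Proof.
rewrite (_ : lagsum x x n 0 + x 0 ^+ 2 - x n%:Z ^+ 2
  = \sum_(i < n) x (i.+1%:Z - 1) ^+ 2); last first.
  rewrite (sum_shift (fun t => x t ^+ 2)); congr (_ + _ - _).
  by apply: eq_bigr => i _; rewrite subr0 expr2.
rewrite (_ : lagsum x x n 1 + x 0 * x (- 1) - x n%:Z * x (n%:Z - 1)
  = \sum_(i < n) x (i.+1%:Z - 1) * x (i.+1%:Z - 1 - 1)); last first.
  by rewrite (sum_shift (fun t => x t * x (t - 1))).
rewrite /lagsum !mulr_sumr -sumrN -!big_split; apply: eq_bigr => i _ /=.
by rewrite {1}rec subz11; ring.
Qed.

Lemma lagsum_yw2 n : lagsum x x n 2 =
  2 * r * c * (lagsum x x n 1 + x 0 * x (- 1) - x n%:Z * x (n%:Z - 1))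
  - r ^+ 2 * (lagsum x x n 0 + x 0 ^+ 2 - x n%:Z ^+ 2
              + x (- 1) ^+ 2 - x (n%:Z - 1) ^+ 2)
  + lagsum u x n 2.
Proof.
rewrite (_ : lagsum x x n 0 + x 0 ^+ 2 - x n%:Z ^+ 2 + x (- 1) ^+ 2 - x (n%:Z - 1) ^+ 2
  = \sum_(i < n) x (i.+1%:Z - 1 - 1) ^+ 2); last first.
  rewrite (sum_shift (fun t => x (t - 1) ^+ 2)) (sum_shift (fun t => x t ^+ 2)).
  rewrite sub0r; congr (_ + _ - _ + _ - _).
  by apply: eq_bigr => i _; rewrite subr0 expr2.
rewrite (_ : lagsum x x n 1 + x 0 * x (- 1) - x n%:Z * x (n%:Z - 1)
  = \sum_(i < n) x (i.+1%:Z - 1) * x (i.+1%:Z - 1 - 1)); last first.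
  by rewrite (sum_shift (fun t => x t * x (t - 1))).
rewrite /lagsum !mulr_sumr -sumrN -!big_split; apply: eq_bigr => i _ /=.
by rewrite {1}rec subz11; ring.
Qed.

Hypotheses (r01 : 0 < r < 1) (s0 : 0 < s) (cs : c ^+ 2 + s ^+ 2 = 1).



(* At the frequencies 0 and pi the filter [1 - 2 r c sg + r^2] stays away from
   zero, so these ordinates of the periodogram remain bounded as r -> 1. *)
Lemma twisted_sum_le (sg K L : R) n : sg = 1 \/ sg = -1 ->
  `|x 0| <= K -> `|x (- 1)| <= K -> `|x n%:Z| <= K -> `|x (n%:Z - 1)| <= K ->
  `|\sum_(i < n) sg ^+ i * u i.+1%:Z| <= L ->
  `|\sum_(i < n) sg ^+ i * x i.+1%:Z| <= (L + 8 * K) / s ^+ 2.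
Proof.
move=> sg1 x0K x1K xnK xn1K.
set V := (X in `|X| <= L); set T := (X in `|X| <= _ / _) => VL.
have c1 := norm_le1_sqrD _ _ cs.
have sgn1 : `|sg| = 1 by case: sg1 => ->; rewrite ?normrN normr1.
have sgn k : `|sg ^+ k| = 1 by rewrite normrX sgn1 expr1n.
set e1 := x 0 - sg ^+ n * x n%:Z; set e2 := x (- 1) - sg ^+ n * x (n%:Z - 1).
have e1K : `|e1| <= 2 * K.
  by apply: le_trans (ler_normB _ _) _; rewrite normrM sgn mul1r mulr_natl lerD.
have e2K : `|e2| <= 2 * K.
  by apply: le_trans (ler_normB _ _) _; rewrite normrM sgn mul1r mulr_natl lerD.
have ET : T = 2 * r * c * (sg * T + e1) - r ^+ 2 * (sg * (sg * T + e1) + e2) + V.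
  rewrite /e1 /e2.
  have t1 : sg * T + (x 0 - sg ^+ n * x n%:Z) = \sum_(i < n) sg ^+ i * x (i.+1%:Z - 1).
    by rewrite (twisted_sum_shift x) addrA.
  rewrite t1.
  have -> : sg * \sum_(i < n) sg ^+ i * x (i.+1%:Z - 1) + (x (- 1) - sg ^+ n * x (n%:Z - 1))
     = \sum_(i < n) sg ^+ i * x (i.+1%:Z - 1 - 1).
    by rewrite (twisted_sum_shift (fun t => x (t - 1))) addrA.
  rewrite /T /V !mulr_sumr -sumrN -!big_split; apply: eq_bigr => i _ /=.
  by rewrite {1}rec subz11; ring.
have sg2 : sg * sg = 1 by case: sg1 => ->; ring.
have EA : T * (1 - 2 * r * c * sg + r ^+ 2) = V + 2 * r * c * e1 - r ^+ 2 * (sg * e1 + e2).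
  have -> : T * (1 - 2 * r * c * sg + r ^+ 2) =
    T - 2 * r * c * sg * T + r ^+ 2 * (sg * sg) * T by rewrite sg2; ring.
  by rewrite {1}ET; ring.
(* Completing the square, the right side is [(r - c sg)^2 + s^2]. *)
have A0 : s ^+ 2 <= 1 - 2 * r * c * sg + r ^+ 2.
  have -> : s ^+ 2 = 1 - (c * sg) ^+ 2 by rewrite exprMn (expr2 sg) sg2 mulr1 -cs; ring.
  by have := sqr_ge0 (r - c * sg); rewrite !expr2; lra.
have s20 : 0 < s ^+ 2 by rewrite exprn_gt0.
case/andP: r01 => r0 r1.
rewrite ler_pdivlMr//; apply: le_trans (_ : `|T| * (1 - 2 * r * c * sg + r ^+ 2) <= _).
  by rewrite ler_wpM2l.
rewrite -{1}[1 - _ + _]gtr0_norm ?(lt_le_trans s20)// -normrM EA.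
have n1 : `|2 * r * c * e1| <= 4 * K.
  have h : `|2 * r * c| <= 2.
    rewrite !normrM (gtr0_norm r0) (gtr0_norm (ltr0Sn R 1)) -mulrA ler_piMr//.
    by rewrite mulr_ile1// ltW.
  rewrite normrM; apply: le_trans (ler_pM (normr_ge0 _) (normr_ge0 _) h e1K) _; lra.
have n2 : `|r ^+ 2 * (sg * e1 + e2)| <= 4 * K.
  rewrite normrM; have h : `|sg * e1 + e2| <= 4 * K.
    by apply: le_trans (ler_normD _ _) _; rewrite normrM sgn1; lra.
  apply: le_trans h; rewrite ler_piMl// normrX gtr0_norm// exprn_ile1// ltW//.
apply: le_trans (ler_normB _ _) _; apply: le_trans (lerD (ler_normD _ _) (lexx _)) _.
lra.
Qed.

End SampleYuleWalker.

Section SampleYuleWalkerError.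
Context {R : realType}.
Variables (x u : int -> R) (r c s K L : R) (n : nat).
Hypothesis rec : forall t, x t = 2 * r * c * x (t - 1) - r ^+ 2 * x (t - 2) + u t.
Hypotheses (r01 : 0 < r < 1) (s0 : 0 < s) (cs : c ^+ 2 + s ^+ 2 = 1) (n2 : (2 < n)%N).
Hypotheses (x0K : `|x 0| <= K) (xm1K : `|x (- 1)| <= K) (x1K : `|x 1| <= K) (x2K : `|x 2| <= K)
  (xnK : `|x n%:Z| <= K) (xn1K : `|x (n%:Z - 1)| <= K)
  (uL : `|\sum_(i < n) u i.+1%:Z| <= L) (uaL : `|\sum_(i < n) (-1) ^+ i * u i.+1%:Z| <= L).

Let nu := n%:R^-1 : R.
Let D h := ghat x n h%:Z.
Let G k := nu * lagsum u x n k.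
(** A common bound for the three equations. The coefficients [1], [2 r c], [r^2] are at most 1, 2, 1
    in absolute value and each [dl h] is at most twice the bound on a squared mean, hence 8; 24
    dominates the edge products in all three cases. *)
Let E := 24 * K ^+ 2 * nu + 8 * ((L + 8 * K) / s ^+ 2) ^+ 2 * nu ^+ 2.

Let nu0 : 0 <= nu.
Proof. by rewrite invr_ge0 ler0n. Qed.

Let prodK (a b : R) : `|a| <= K -> `|b| <= K -> `|a * b| <= K ^+ 2.
Proof. by move=> aK bK; rewrite normrM expr2 ler_pM. Qed.

Let sqrK (a B : R) : `|a| <= B -> a ^+ 2 <= B ^+ 2.
Proof.
move=> aB; rewrite -real_normK ?num_real// lerXn2r// ?nnegrE//.
exact: le_trans (normr_ge0 _) aB.
Qed.

Let J := (nu * \sum_(i < n) x i.+1%:Z) ^+ 2.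
Let A := (nu * \sum_(i < n) (-1) ^+ i * x i.+1%:Z) ^+ 2.

Let JE : `|J| <= ((L + 8 * K) / s ^+ 2) ^+ 2 * nu ^+ 2.
Proof.
rewrite ger0_norm ?sqr_ge0// /J exprMn mulrC ler_wpM2r ?sqr_ge0//; apply: sqrK.
have := @twisted_sum_le _ x u r c s rec r01 s0 cs 1 K L n (or_introl erefl) x0K xm1K xnK xn1K.
under eq_bigr do rewrite expr1n mul1r; move=> /(_ uL).
by under eq_bigr do rewrite expr1n mul1r.
Qed.

Let AE : `|A| <= ((L + 8 * K) / s ^+ 2) ^+ 2 * nu ^+ 2.
Proof.
rewrite ger0_norm ?sqr_ge0// /A exprMn mulrC ler_wpM2r ?sqr_ge0//; apply: sqrK.
exact: (@twisted_sum_le _ x u r c s rec r01 s0 cs (-1) K L n (or_intror erefl)).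
Qed.

Let dl (h : nat) : R := if odd n then - J else - J + (-1) ^+ h * A.

Let dlE h : `|dl h| <= 2 * (((L + 8 * K) / s ^+ 2) ^+ 2 * nu ^+ 2).
Proof.
rewrite /dl; case: ifP => _.
  by rewrite normrN; apply: le_trans JE _; rewrite ler_peMl ?ler1n// mulr_ge0 ?sqr_ge0.
apply: le_trans (ler_normD _ _) _.
by rewrite normrN normrMsign mulr_natl mulr2n lerD.
Qed.

Let DE0 : D 0 = nu * lagsum x x n 0 + dl 0.
Proof.
rewrite /D (ghatE _ _ _ (ltn_trans (isT : 0 < 2)%N n2)).
by rewrite big_ord0 addr0 /dl -/J -/A; case: ifP => _; rewrite ?addr0 ?addrA.
Qed.

Let w1 := x 1 * (x n%:Z - x 0).
Let w2 := x 1 * (x (n%:Z - 1) - x (- 1)) + x 2 * (x n%:Z - x 0).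

Let DE1 : D 1 = nu * (lagsum x x n 1 + w1) + dl 1.
Proof.
rewrite /D (ghatE _ _ _ (ltn_trans (isT : 1 < 2)%N n2)).
rewrite big_ord1 subrr add0r -/w1 /dl -/J -/A.
by case: ifP => _; rewrite ?addr0 ?addrA.
Qed.

Let DE2 : D 2 = nu * (lagsum x x n 2 + w2) + dl 2.
Proof.
rewrite /D (ghatE _ _ _ n2).
rewrite !big_ord_recr big_ord0 add0r /= (_ : 1 - 2 = - 1)// subrr add0r.
rewrite [(-1) + n%:Z]addrC -/w2 /dl -/J -/A.
by case: ifP => _; rewrite ?addr0 ?addrA.
Qed.

Let r0 : 0 <= r. Proof. by case/andP: r01 => /ltW. Qed.
Let r1 : r <= 1. Proof. by case/andP: r01 => _ /ltW. Qed.

Let n2rc : `|2 * r * c| <= 2.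
Proof.
have c1 := norm_le1_sqrD _ _ cs.
rewrite !normrM (ger0_norm r0) (gtr0_norm (ltr0Sn R 1)) -mulrA ler_piMr//.
by rewrite mulr_ile1.
Qed.

Let nr2 : `|r ^+ 2| <= 1.
Proof. by rewrite normrX (ger0_norm r0) exprn_ile1. Qed.

Let bnd (a b B : R) : `|a| <= B -> `|b| <= 1 -> `|b * a| <= B.
Proof. by move=> aB b1; rewrite normrM; apply: le_trans aB; rewrite ler_piMl. Qed.

Let bnd2 (a b B : R) : `|a| <= B -> `|b| <= 2 -> `|b * a| <= 2 * B.
Proof. by move=> aB b1; rewrite normrM ler_pM. Qed.

Let nnu (a B : R) : `|a| <= B -> `|nu * a| <= B * nu.
Proof. by move=> aB; rewrite normrM (ger0_norm nu0) mulrC ler_wpM2r. Qed.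

Let w1K : `|w1| <= 2 * K ^+ 2.
Proof.
rewrite /w1 mulrBr; apply: le_trans (ler_normB _ _) _.
by rewrite mulr_natl mulr2n lerD// prodK.
Qed.

Let w2K : `|w2| <= 4 * K ^+ 2.
Proof.
rewrite /w2 !mulrBr; apply: le_trans (ler_normD _ _) _.
have := ler_normB (x 1 * x (n%:Z - 1)) (x 1 * x (- 1)).
have := ler_normB (x 2 * x n%:Z) (x 2 * x 0).
have := prodK _ _ x1K xn1K; have := prodK _ _ x1K xm1K.
have := prodK _ _ x2K xnK; have := prodK _ _ x2K x0K; lra.
Qed.

Lemma sample_yw0 :
  `|D 0 - (2 * r * c * D 1 - r ^+ 2 * D 2 + G 0)| <= E.
Proof.
have -> : D 0 - (2 * r * c * D 1 - r ^+ 2 * D 2 + G 0) =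
  dl 0 - 2 * r * c * (nu * w1) - 2 * r * c * dl 1 + r ^+ 2 * (nu * w2) + r ^+ 2 * dl 2.
  by rewrite DE0 DE1 DE2 (lagsum_yw0 _ _ _ _ rec) /G; ring.
have H1 := bnd2 _ _ _ (nnu _ _ w1K) n2rc; have H2 := bnd _ _ _ (nnu _ _ w2K) nr2.
have H3 := bnd2 _ _ _ (dlE 1) n2rc; have H4 := bnd _ _ _ (dlE 2) nr2.
have H5 := dlE 0.
set B := ((L + 8 * K) / s ^+ 2) ^+ 2 * nu ^+ 2 in H3 H4 H5.
have EB : E = 24 * K ^+ 2 * nu + 8 * B by rewrite /E /B; ring.
have KN : 0 <= K ^+ 2 * nu by rewrite mulr_ge0 ?sqr_ge0.
rewrite EB; move: H1 H2 H3 H4 H5 KN; rewrite -!mulrA.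
set a1 := nu * w1; set a2 := nu * w2; rewrite !ler_norml.
move=> /andP[? ?] /andP[? ?] /andP[? ?] /andP[? ?] /andP[? ?] ?.
by apply/andP; split; lra.
Qed.

Lemma sample_yw1 :
  `|D 1 - (2 * r * c * D 0 - r ^+ 2 * D 1 + G 1)| <= E.
Proof.
pose e0 := x 0 ^+ 2 - x n%:Z ^+ 2; pose e1 := x 0 * x (- 1) - x n%:Z * x (n%:Z - 1).
have -> : D 1 - (2 * r * c * D 0 - r ^+ 2 * D 1 + G 1) =
  nu * w1 + dl 1 + 2 * r * c * (nu * e0) - r ^+ 2 * (nu * e1)
  - 2 * r * c * dl 0 + r ^+ 2 * (nu * w1) + r ^+ 2 * dl 1.
  by rewrite DE0 DE1 {1}(lagsum_yw1 _ _ _ _ rec) /G /e0 /e1; ring.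
have e0K : `|e0| <= 2 * K ^+ 2.
  by apply: le_trans (ler_normB _ _) _; rewrite mulr_natl mulr2n lerD// expr2 prodK.
have e1K : `|e1| <= 2 * K ^+ 2.
  by apply: le_trans (ler_normB _ _) _; rewrite mulr_natl mulr2n lerD// prodK.
have H0 := nnu _ _ w1K; have H1 := bnd _ _ _ (nnu _ _ w1K) nr2.
have H2 := bnd2 _ _ _ (nnu _ _ e0K) n2rc; have H3 := bnd _ _ _ (nnu _ _ e1K) nr2.
have H4 := bnd2 _ _ _ (dlE 0) n2rc; have H5 := bnd _ _ _ (dlE 1) nr2.
have H6 := dlE 1.
set B := ((L + 8 * K) / s ^+ 2) ^+ 2 * nu ^+ 2 in H4 H5 H6.
have EB : E = 24 * K ^+ 2 * nu + 8 * B by rewrite /E /B; ring.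
have KN : 0 <= K ^+ 2 * nu by rewrite mulr_ge0 ?sqr_ge0.
rewrite EB; move: H0 H1 H2 H3 H4 H5 H6 KN; rewrite -!mulrA.
rewrite !ler_norml.
move=> /andP[? ?] /andP[? ?] /andP[? ?] /andP[? ?] /andP[? ?] /andP[? ?] /andP[? ?] ?.
by apply/andP; split; lra.
Qed.

Lemma sample_yw2 :
  `|D 2 - (2 * r * c * D 1 - r ^+ 2 * D 0 + G 2)| <= E.
Proof.
pose e1 := x 0 * x (- 1) - x n%:Z * x (n%:Z - 1).
pose e2 := x 0 ^+ 2 - x n%:Z ^+ 2 + (x (- 1) ^+ 2 - x (n%:Z - 1) ^+ 2).
have -> : D 2 - (2 * r * c * D 1 - r ^+ 2 * D 0 + G 2) =
  nu * w2 + dl 2 + 2 * r * c * (nu * e1) - r ^+ 2 * (nu * e2)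
  - 2 * r * c * (nu * w1) - 2 * r * c * dl 1 + r ^+ 2 * dl 0.
  by rewrite DE0 DE1 DE2 {1}(lagsum_yw2 _ _ _ _ rec) /G /e2 /e1; ring.
have e1K : `|e1| <= 2 * K ^+ 2.
  by apply: le_trans (ler_normB _ _) _; rewrite mulr_natl mulr2n lerD// prodK.
have e2K : `|e2| <= 4 * K ^+ 2.
  have h a b : `|a| <= K -> `|b| <= K -> `|a ^+ 2 - b ^+ 2| <= 2 * K ^+ 2.
    by move=> ? ?; apply: le_trans (ler_normB _ _) _; rewrite mulr_natl mulr2n lerD// expr2 prodK.
  apply: le_trans (ler_normD _ _) _.
  have := h _ _ x0K xnK; have := h _ _ xm1K xn1K; lra.
have H0 := nnu _ _ w2K; have H1 := bnd2 _ _ _ (nnu _ _ w1K) n2rc.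
have H2 := bnd2 _ _ _ (nnu _ _ e1K) n2rc; have H3 := bnd _ _ _ (nnu _ _ e2K) nr2.
have H4 := bnd2 _ _ _ (dlE 1) n2rc; have H5 := bnd _ _ _ (dlE 0) nr2.
have H6 := dlE 2.
set B := ((L + 8 * K) / s ^+ 2) ^+ 2 * nu ^+ 2 in H4 H5 H6.
have EB : E = 24 * K ^+ 2 * nu + 8 * B by rewrite /E /B; ring.
have KN : 0 <= K ^+ 2 * nu by rewrite mulr_ge0 ?sqr_ge0.
rewrite EB; move: H0 H1 H2 H3 H4 H5 H6 KN; rewrite -!mulrA.
rewrite !ler_norml.
move=> /andP[? ?] /andP[? ?] /andP[? ?] /andP[? ?] /andP[? ?] /andP[? ?] /andP[? ?] ?.
by apply/andP; split; lra.
Qed.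

End SampleYuleWalkerError.

(** * Explicit solution of the Yule-Walker equations for the variance *)

Section YuleWalkerPerturbation.
Context {R : realType}.
Variables (r c s g0 g1 g2 y0 y1 y2 : R).
Hypotheses (r01 : 0 < r < 1) (s0 : 0 < s) (cs : c ^+ 2 + s ^+ 2 = 1).

(** Cramer's rule. Since [g1] carries the factor [1 - r^2], the size of the variance is governed by
    [g0 - r^2 g2]. Substituting for the [g]'s reduces the claim to a polynomial identity. *)
Lemma yw_solve : y0 = 2 * r * c * y1 - r ^+ 2 * y2 + g0 ->
  y1 = 2 * r * c * y0 - r ^+ 2 * y1 + g1 ->
  y2 = 2 * r * c * y1 - r ^+ 2 * y0 + g2 ->
  y0 * ((1 - r ^+ 2) * ((1 + r ^+ 2) ^+ 2 - 4 * r ^+ 2 * c ^+ 2)) =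
  2 * r * c * (1 - r ^+ 2) * g1 + (1 + r ^+ 2) * (g0 - r ^+ 2 * g2).
Proof.
move=> e0 e1 e2.
have -> : g0 = y0 - (2 * r * c * y1 - r ^+ 2 * y2) by rewrite {1}e0; ring.
have -> : g1 = y1 - (2 * r * c * y0 - r ^+ 2 * y1) by rewrite {1}e1; ring.
have -> : g2 = y2 - (2 * r * c * y1 - r ^+ 2 * y0) by rewrite {1}e2; ring.
ring.
Qed.

Lemma yw_det_bounds : (1 - r) * s ^+ 2 <=
   (1 - r ^+ 2) * ((1 + r ^+ 2) ^+ 2 - 4 * r ^+ 2 * c ^+ 2) <= 8 * (1 - r).
Proof.
case/andP: r01 => r0 r1.
have r20 : 0 <= r ^+ 2 by exact: sqr_ge0.
have r21 : r ^+ 2 <= 1 by rewrite exprn_ile1// ltW.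
have c20 : 0 <= c ^+ 2 by exact: sqr_ge0.
have A0 : s ^+ 2 <= (1 + r ^+ 2) ^+ 2 - 4 * r ^+ 2 * c ^+ 2.
  have -> : (1 + r ^+ 2) ^+ 2 - 4 * r ^+ 2 * c ^+ 2 =
    (1 + r ^+ 2) ^+ 2 * (c ^+ 2 + s ^+ 2) - 4 * r ^+ 2 * c ^+ 2 by rewrite cs mulr1.
  (* Weighting by [c^2 + s^2 = 1] exhibits the surplus over [s^2] as a sum of nonnegative terms. *)
  have -> : (1 + r ^+ 2) ^+ 2 * (c ^+ 2 + s ^+ 2) - 4 * r ^+ 2 * c ^+ 2 =
    s ^+ 2 + (c * (1 - r ^+ 2)) ^+ 2 + s ^+ 2 * (r ^+ 2 * (2 + r ^+ 2)) by ring.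
  rewrite -addrA lerDl; apply: addr_ge0; first exact: sqr_ge0.
  apply: mulr_ge0; first exact: sqr_ge0.
  by apply: mulr_ge0 => //; lra.
have A1 : (1 + r ^+ 2) ^+ 2 - 4 * r ^+ 2 * c ^+ 2 <= 4.
  have : 0 <= r ^+ 2 * c ^+ 2 by rewrite mulr_ge0.
  have : r ^+ 2 * r ^+ 2 <= 1 by rewrite mulr_ile1.
  rewrite sqrrD expr1n mul1r [(r ^+ 2) ^+ 2]expr2; lra.
have B0 : 1 - r ^+ 2 = (1 - r) * (1 + r) by ring.
have d0 : 0 <= 1 - r by lra.
have h3 := le_trans (sqr_ge0 s) A0.
rewrite B0; apply/andP; split.
  rewrite -mulrA ler_wpM2l//; apply: le_trans A0 _.
  by apply: ler_peMl => //; lra.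
rewrite -mulrA mulrC ler_wpM2r//.
have h2 : 1 + r <= 2 by lra.
have h4 : 0 <= 1 + r by lra.
by apply: le_trans (ler_pM h4 h3 h2 A1) _; lra.
Qed.

End YuleWalkerPerturbation.

(** * Perturbation of the Yule-Walker equations *)

Section AutocorrelationError.
Context {R : realType}.
Variables (r c s g0 g1 g2 y0 y1 y2 : R).
Hypotheses (r01 : 0 < r < 1) (s0 : 0 < s) (cs : c ^+ 2 + s ^+ 2 = 1).
Hypotheses (Y0 : y0 = 2 * r * c * y1 - r ^+ 2 * y2 + g0)
  (Y1 : y1 = 2 * r * c * y0 - r ^+ 2 * y1 + g1)
  (Y2 : y2 = 2 * r * c * y1 - r ^+ 2 * y0 + g2).

Let n2rc : `|2 * r * c| <= 2.
Proof.
have c1 := norm_le1_sqrD _ _ cs; case/andP: r01 => r0 r1.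
rewrite !normrM (gtr0_norm r0) (gtr0_norm (ltr0Sn R 1)) -mulrA ler_piMr//.
by rewrite mulr_ile1// ltW.
Qed.

Let r2b : 0 <= r ^+ 2 <= 1.
Proof. by case/andP: r01 => r0 r1; rewrite sqr_ge0 exprn_ile1// ltW. Qed.

(** The [g1] term takes away at most half of [k], and the determinant is at most [8 (1 - r)]; this
    is where 16 comes from. *)
Lemma yw_variance_ge (G k : R) : `|g1| <= G -> 0 < k -> k <= g0 - r ^+ 2 * g2 ->
  8 * (1 - r) * G <= k -> k / 16 / (1 - r) <= y0.
Proof.
move=> g1G k0 kg Gk; have := yw_solve r c g0 g1 g2 y0 y1 y2 Y0 Y1 Y2.
have /andP[Al Au] := yw_det_bounds r c s r01 cs.
case/andP: r01 => r0 r1; case/andP: r2b => r20 r21.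
have d0 : 0 < 1 - r by lra.
have s20 : 0 < s ^+ 2 by rewrite exprn_gt0.
have A0 := lt_le_trans (mulr_gt0 d0 s20) Al.
set A := (1 - r ^+ 2) * _ in Al Au A0 *.
set B := 2 * r * c * (1 - r ^+ 2) * g1 + _ => e.
have Bk : k / 2 <= B.
  have h : `|2 * r * c * (1 - r ^+ 2) * g1| <= 4 * (1 - r) * G.
    have h1 : `|2 * r * c * (1 - r ^+ 2)| <= 4 * (1 - r).
      have h2 : `|1 - r ^+ 2| <= 2 * (1 - r).
        rewrite ger0_norm ?subr_ge0// (_ : 1 - r ^+ 2 = (1 + r) * (1 - r)); last ring.
        by rewrite ler_pM2r//; lra.
      by rewrite normrM; apply: le_trans (ler_pM _ _ n2rc h2) _ => //; lra.
    by rewrite normrM ler_pM.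
  have h3 : k <= (1 + r ^+ 2) * (g0 - r ^+ 2 * g2).
    apply: le_trans (kg) _; apply: ler_peMl; [lra|by rewrite lerDl].
  by move: h; rewrite ler_norml => /andP[? ?]; rewrite /B; lra.
rewrite ler_pdivrMr//; have y0p : 0 < y0.
  by rewrite -(pmulr_lgt0 _ A0) e; apply: lt_le_trans Bk; lra.
have : y0 * A <= y0 * (8 * (1 - r)) by rewrite ler_pM2l.
rewrite e; lra.
Qed.

Variables (G k z : R).
Hypotheses (g1G : `|g1| <= G) (g2G : `|g2| <= G) (k0 : 0 < k) (yk : k / (1 - r) <= y0).

Let d := 1 - r.
Let d0 : 0 < d. Proof. by case/andP: r01 => _; rewrite subr_gt0. Qed.
Let y00 : 0 < y0. Proof. by apply: lt_le_trans yk; rewrite divr_gt0. Qed.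
Let G0 : 0 <= G. Proof. exact: le_trans (normr_ge0 _) g1G. Qed.

Let quot g : `|g| <= G -> `|g / y0| <= G * d / k.
Proof.
move=> gG; rewrite normrM normfV (gtr0_norm y00) -mulrA ler_pM//.
  by rewrite invr_ge0 ltW.
by rewrite -(invf_div k d) lef_pV2// posrE// divr_gt0.
Qed.

(** The second equation reads [(1 + r^2) (y1 / y0 - c) = g1 / y0 - c (1 - r)^2], and [g1 / y0] is of
    order [d] because the variance is of order [1 / d]. *)
Lemma autocorr1_limit : `|y1 / y0 - c| <= (1 + G / k) * d.
Proof.
have e : (1 + r ^+ 2) * (y1 / y0 - c) = g1 / y0 - c * (d ^+ 2).
  apply: (mulIf (lt0r_neq0 y00)).
  have -> : (1 + r ^+ 2) * (y1 / y0 - c) * y0 = y1 + r ^+ 2 * y1 - (1 + r ^+ 2) * c * y0.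
    by field; rewrite gt_eqF.
  have -> : (g1 / y0 - c * d ^+ 2) * y0 = g1 - c * d ^+ 2 * y0 by field; rewrite gt_eqF.
  by rewrite {1}Y1 /d; ring.
have c1 := norm_le1_sqrD _ _ cs.
case/andP: r2b => r20 _.
apply: le_trans (_ : `|(1 + r ^+ 2) * (y1 / y0 - c)| <= _).
  by rewrite normrM ler_peMl// ger0_norm ?lerDl// addr_ge0.
rewrite e; apply: le_trans (ler_normB _ _) _; rewrite mulrDl mul1r addrC lerD//.
  rewrite normrM (ger0_norm (sqr_ge0 _)).
  have dd : d ^+ 2 <= d.
    rewrite expr2 ler_piMl// ?ltW// /d; case/andP: r01 => r0 _; lra.
  by apply: le_trans dd; rewrite ler_piMl// sqr_ge0.
by rewrite mulrAC quot.
Qed.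

Lemma autocorr2_limit : `|y2 / y0 - (2 * c ^+ 2 - 1)| <= (6 + 3 * G / k) * d.
Proof.
have e : y2 / y0 - (2 * c ^+ 2 - 1) =
  2 * r * c * (y1 / y0 - c) - 2 * c ^+ 2 * d + (1 + r) * d + g2 / y0.
  apply: (mulIf (lt0r_neq0 y00)).
  have -> : (y2 / y0 - (2 * c ^+ 2 - 1)) * y0 = y2 - (2 * c ^+ 2 - 1) * y0.
    by field; rewrite gt_eqF.
  rewrite {1}Y2 /d; field; rewrite gt_eqF//.
have := autocorr1_limit; have := quot _ g2G; rewrite e => h1 h2.
have h3 : `|2 * r * c * (y1 / y0 - c)| <= 2 * ((1 + G / k) * d).
  by rewrite normrM ler_pM.
have c2 : c ^+ 2 <= 1 by have := cs; have := sqr_ge0 s; lra.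
have h4 : 0 <= c ^+ 2 * d <= d.
  by apply/andP; split; [apply: mulr_ge0; [exact: sqr_ge0|exact: ltW]|apply: ler_piMl => //; exact: ltW].
have h5 : 0 <= (1 + r) * d <= 2 * d.
  case/andP: r01 => r0 r1; rewrite mulr_ge0 ?(ltW d0)//=; last lra.
  by rewrite ler_pM2r//; lra.
move: h1 h3 h4 h5; rewrite [G * d / k]mulrAC !ler_norml.
have -> : 3 * G / k = 3 * (G / k) by rewrite mulrA.
move: (G / k) => q.
move: (y1 / y0 - c) (g2 / y0) => a b /andP[? ?] /andP[? ?] /andP[? ?] /andP[? ?].
by have := d0; move=> ?; apply/andP; split; lra.
Qed.

Variables (w0 w1 w2 D0 D1 D2 : R).
Hypotheses (E0 : `|D0 - (2 * r * c * D1 - r ^+ 2 * D2 + w0)| <= z)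
  (E1 : `|D1 - (2 * r * c * D0 - r ^+ 2 * D1 + w1)| <= z)
  (E2 : `|D2 - (2 * r * c * D1 - r ^+ 2 * D0 + w2)| <= z)
  (W0 : `|w0 - g0| <= z) (W1 : `|w1 - g1| <= z) (W2 : `|w2 - g2| <= z).
Hypothesis zk : 24 * z <= s ^+ 2 * k.

(** The differences [D - y] solve the same equations with right-hand sides [z0], [z1], [z2]. Each is
    an equation error plus a fluctuation, hence at most [2 z]. *)
Let z0 := D0 - y0 - (2 * r * c * (D1 - y1) - r ^+ 2 * (D2 - y2)).
Let z1 := D1 - y1 - (2 * r * c * (D0 - y0) - r ^+ 2 * (D1 - y1)).
Let z2 := D2 - y2 - (2 * r * c * (D1 - y1) - r ^+ 2 * (D0 - y0)).

Let z0z : `|z0| <= 2 * z.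
Proof.
have -> : z0 = D0 - (2 * r * c * D1 - r ^+ 2 * D2 + w0) + (w0 - g0).
  by rewrite /z0 {1}Y0; ring.
by apply: le_trans (ler_normD _ _) _; have := E0; have := W0; lra.
Qed.

Let z1z : `|z1| <= 2 * z.
Proof.
have -> : z1 = D1 - (2 * r * c * D0 - r ^+ 2 * D1 + w1) + (w1 - g1).
  by rewrite /z1 {1}Y1; ring.
by apply: le_trans (ler_normD _ _) _; have := E1; have := W1; lra.
Qed.

Let z2z : `|z2| <= 2 * z.
Proof.
have -> : z2 = D2 - (2 * r * c * D1 - r ^+ 2 * D0 + w2) + (w2 - g2).
  by rewrite /z2 {1}Y2; ring.
by apply: le_trans (ler_normD _ _) _; have := E2; have := W2; lra.
Qed.

Let zge0 : 0 <= z. Proof. exact: le_trans (normr_ge0 _) E0. Qed.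
Let s20 : 0 < s ^+ 2. Proof. by rewrite exprn_gt0. Qed.

(** [yw_solve] for the differences: the right side is at most [2 (2 z) + 2 (4 z)] and the
    determinant at least [d s^2]. The factor [1 / d] is removed only in the autocorrelations. *)
Let D0y0 : `|D0 - y0| <= 12 * z / s ^+ 2 / d.
Proof.
have := yw_solve r c z0 z1 z2 (D0 - y0) (D1 - y1) (D2 - y2).
move=> /(_ ltac:(rewrite /z0; ring) ltac:(rewrite /z1; ring) ltac:(rewrite /z2; ring)).
move=> e.
have /andP[Al _] := yw_det_bounds r c s r01 cs; set A := (1 - r ^+ 2) * _ in Al e.
have A0 : 0 < A by apply: lt_le_trans Al; rewrite mulr_gt0.
case/andP: r2b => r20 r21.
have B : `|(D0 - y0) * A| <= 12 * z.
  rewrite e; apply: le_trans (ler_normD _ _) _.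
  have h1 : `|2 * r * c * (1 - r ^+ 2) * z1| <= 2 * (2 * z).
    have h : `|2 * r * c * (1 - r ^+ 2)| <= 2.
      rewrite normrM; apply: le_trans n2rc; rewrite ler_piMr//.
      by rewrite ger0_norm ?subr_ge0// gerBl.
    by rewrite normrM ler_pM//; exact: z1z.
  have h2 : `|(1 + r ^+ 2) * (z0 - r ^+ 2 * z2)| <= 2 * (4 * z).
    rewrite normrM ler_pM//; first by rewrite ger0_norm ?addr_ge0//; lra.
    apply: le_trans (ler_normB _ _) _; rewrite normrM (ger0_norm r20).
    have : r ^+ 2 * `|z2| <= `|z2| by rewrite ler_piMl.
    have := z0z; have := z2z; lra.
  lra.
move: B; rewrite normrM (gtr0_norm A0) => B.
rewrite -mulrA -invfM ler_pdivlMr ?mulr_gt0//; apply: le_trans B.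
by rewrite ler_wpM2l// mulrC.
Qed.

(** Chosen so that [(G d / k) (12 z / (s^2 d))], the variance error weighted by [g / y0], equals
    [2 z (q - 1)]. *)
Let q := 1 + G * 6 / (s ^+ 2 * k).

Let corr g : `|g| <= G -> `|g / y0 * (D0 - y0)| <= 2 * z * (q - 1).
Proof.
move=> gG; rewrite normrM; apply: le_trans (ler_pM _ _ (quot _ gG) D0y0) _ => //.
rewrite /q le_eqVlt; apply/orP; left; apply/eqP; field.
by rewrite !gt_eqF.
Qed.

Let q1 : 0 <= q - 1.
Proof. by rewrite /q addrC addKr divr_ge0 ?mulr_ge0// ltW. Qed.

(** The decisive cancellation: errors of [(D0, D1)] along [(y0, y1)] drop out, and the remaining
    variance error is weighted by [g1 / y0], whose factor [d] offsets the [1 / d] of [D0y0]. *)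
Let V1 : `|D1 - y1 / y0 * D0| <= 2 * z * q.
Proof.
have e : (1 + r ^+ 2) * (D1 - y1 / y0 * D0) = z1 - g1 / y0 * (D0 - y0).
  apply: (mulIf (lt0r_neq0 y00)).
  have -> : (1 + r ^+ 2) * (D1 - y1 / y0 * D0) * y0 = (1 + r ^+ 2) * D1 * y0 - (y1 + r ^+ 2 * y1) * D0.
    by field; rewrite gt_eqF.
  have -> : (z1 - g1 / y0 * (D0 - y0)) * y0 = z1 * y0 - g1 * (D0 - y0) by field; rewrite gt_eqF.
  have -> : g1 = y1 - (2 * r * c * y0 - r ^+ 2 * y1) by rewrite {1}Y1; ring.
  by rewrite /z1; ring.
case/andP: r2b => r20 _.
apply: le_trans (_ : `|(1 + r ^+ 2) * (D1 - y1 / y0 * D0)| <= _).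
  by rewrite normrM ler_peMl// ger0_norm ?lerDl// addr_ge0.
rewrite e; apply: le_trans (ler_normB _ _) _.
have := corr _ g1G; have := z1z; lra.
Qed.

Let V2 : `|D2 - y2 / y0 * D0| <= 6 * z * q.
Proof.
have e : D2 - y2 / y0 * D0 = 2 * r * c * (D1 - y1 / y0 * D0) + z2 - g2 / y0 * (D0 - y0).
  apply: (mulIf (lt0r_neq0 y00)).
  have -> : (D2 - y2 / y0 * D0) * y0 = D2 * y0 - y2 * D0.
    by field; rewrite gt_eqF.
  have -> : (2 * r * c * (D1 - y1 / y0 * D0) + z2 - g2 / y0 * (D0 - y0)) * y0 =
    2 * r * c * (D1 * y0 - y1 * D0) + z2 * y0 - g2 * (D0 - y0) by field; rewrite gt_eqF.
  have -> : g2 = y2 - (2 * r * c * y1 - r ^+ 2 * y0) by rewrite {1}Y2; ring.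
  by rewrite /z2; ring.
rewrite e; apply: le_trans (ler_normB _ _) _.
apply: le_trans (lerD (ler_normD _ _) (lexx _)) _.
have h1 : `|2 * r * c * (D1 - y1 / y0 * D0)| <= 2 * (2 * z * q) by rewrite normrM ler_pM.
have := corr _ g2G; have := z2z; lra.
Qed.

(** [zk] keeps the error of the sample variance below half of the lower bound [k / d] for [y0], so
    that division by [D0] is safe and gains a factor [d]. *)
Let D0k : k / 2 / d <= D0.
Proof.
have h : 12 * z / s ^+ 2 <= k / 2.
  by rewrite ler_pdivrMr//; move: zk; lra.
have : 12 * z / s ^+ 2 / d <= k / 2 / d by rewrite ler_pM2r ?invr_gt0.
have e : k / d = k / 2 / d + k / 2 / d by field; rewrite gt_eqF.
by have := D0y0; rewrite ler_norml => /andP[]; move: yk; rewrite -/d e; lra.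
Qed.

Let fin (a y B : R) : `|a - y * D0| <= B * z * q -> `|a / D0 - y| <= 2 * B * q / k * (d * z).
Proof.
move=> h; have kd : 0 < k / 2 / d by rewrite !divr_gt0.
have D00 : 0 < D0 by apply: lt_le_trans D0k.
have -> : a / D0 - y = (a - y * D0) / D0 by field; rewrite gt_eqF.
have -> : 2 * B * q / k * (d * z) = B * z * q / (k / 2 / d) by field; rewrite !gt_eqF.
rewrite normrM normfV (gtr0_norm D00) ler_pM ?invr_ge0 ?(ltW D00)//.
by rewrite lef_pV2 ?posrE.
Qed.

Lemma autocorr_error :
  `|D1 / D0 - y1 / y0| <= 12 * q / k * (d * z) /\
  `|D2 / D0 - y2 / y0| <= 12 * q / k * (d * z).
Proof.
have q0 : 0 <= q by move: q1; lra.
split.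
  apply: le_trans (fin _ _ 2 V1) _.
  rewrite ler_wpM2r ?mulr_ge0 ?(ltW d0)// ler_wpM2r ?invr_ge0 ?(ltW k0)//.
  by rewrite ler_wpM2r//; lra.
by apply: le_trans (fin _ _ 6 V2) _; rewrite (_ : 2 * 6 = 12)//; lra.
Qed.

End AutocorrelationError.

(** * Lipschitz estimates for the AR(2) parameters *)

Section DeltaMethod.
Context {R : realType}.
Implicit Types (p q e k : R).

(** The constants 6, 8 and 4 are large enough to serve the three quotients at once: [a1f], [a2f] and
    the argument of [acos] in [lamf]. *)
Lemma quotient_error (Np Nq Dp Dq k e : R) : 0 < k -> k <= Dp -> k <= Dq ->
  `|Np - Nq| <= 6 * e -> `|Nq| <= 8 -> `|Dp - Dq| <= 4 * e ->
  `|Np / Dp - Nq / Dq| <= (6 / k + 32 / k ^+ 2) * e.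
Proof.
move=> k0 kp kq dN N8 dD.
have Dp0 : 0 < Dp by exact: lt_le_trans kp.
have Dq0 : 0 < Dq by exact: lt_le_trans kq.
have -> : Np / Dp - Nq / Dq = (Np - Nq) / Dp + Nq * (Dq - Dp) / (Dp * Dq).
  by field; rewrite !gt_eqF.
apply: le_trans (ler_normD _ _) _; rewrite [leRHS]mulrDl; apply: lerD.
  have -> : 6 / k * e = 6 * e / k by ring.
  rewrite normrM normfV (gtr0_norm Dp0) ler_pM ?invr_ge0 ?(ltW Dp0)//.
  by rewrite lef_pV2.
have -> : 32 / k ^+ 2 * e = 8 * (4 * e) / k ^+ 2 by ring.
have DD : 0 < Dp * Dq by rewrite mulr_gt0.
rewrite normrM normfV (gtr0_norm DD) ler_pM ?invr_ge0 ?(ltW DD)//.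
  by rewrite normrM ler_pM// distrC.
by rewrite lef_pV2 ?posrE ?exprn_gt0// expr2 ler_pM// ltW.
Qed.

(** With [v = p - c], both [|c v|] and [v^2] are at most [s^2 / 8], so [1 - p^2] falls short of
    [1 - c^2 = s^2] by at most three eighths of it. *)
Lemma one_sub_sqr_ge (c s p : R) : c ^+ 2 + s ^+ 2 = 1 -> `|p - c| <= s ^+ 2 / 8 ->
  s ^+ 2 / 2 <= 1 - p ^+ 2 /\ `|p| <= 2.
Proof.
move=> cs pc; have c1 := norm_le1_sqrD _ _ cs; have s20 := sqr_ge0 s.
have c20 := sqr_ge0 c.
set t := s ^+ 2 in cs pc s20 *; have t1 : t <= 1 by lra.
have -> : p = c + (p - c) by ring.
move: (p - c) pc => v vt; split; last first.
  by apply: le_trans (ler_normD _ _) _; lra.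
have h1 : `|c * v| <= t / 8.
  by rewrite normrM; apply: le_trans vt; rewrite ler_piMl.
have h2 : v ^+ 2 <= t / 8.
  rewrite -real_normK ?num_real// expr2; apply: le_trans (vt); rewrite ler_piMl//; lra.
have -> : 1 - (c + v) ^+ 2 = 1 - c ^+ 2 - 2 * (c * v) - v ^+ 2 by ring.
move: h1; rewrite ler_norml => /andP[? ?]; lra.
Qed.

Lemma norm_le_near (a b B e : R) : `|a - b| <= e -> `|b| + e <= B -> `|a| <= B.
Proof.
move=> h hB; have -> : a = a - b + b by ring.
by apply: le_trans (ler_normD _ _) _; lra.
Qed.

Lemma a12f_error (c s : R) : 0 < s -> c ^+ 2 + s ^+ 2 = 1 ->
  exists L : R, 0 < L /\ forall (p1 p2 q1 q2 e : R),
  `|p1 - c| <= s ^+ 2 / 8 -> `|q1 - c| <= s ^+ 2 / 8 -> `|p2| <= 2 -> `|q2| <= 2 ->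
  `|p1 - q1| <= e -> `|p2 - q2| <= e ->
  `|a1f p1 p2 - a1f q1 q2| <= L * e /\ `|a2f p1 p2 - a2f q1 q2| <= L * e.
Proof.
move=> s0 cs; set k := s ^+ 2 / 2; have k0 : 0 < k by rewrite divr_gt0 ?exprn_gt0.
exists (6 / k + 32 / k ^+ 2); split; first by rewrite addr_gt0 ?divr_gt0 ?exprn_gt0.
move=> p1 p2 q1 q2 e p1c q1c p22 q22 e1 e2.
have [kp p12] := one_sub_sqr_ge _ _ _ cs p1c; have [kq q12] := one_sub_sqr_ge _ _ _ cs q1c.
have dD : `|(1 - p1 ^+ 2) - (1 - q1 ^+ 2)| <= 4 * e.
  have -> : 1 - p1 ^+ 2 - (1 - q1 ^+ 2) = - ((p1 + q1) * (p1 - q1)) by ring.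
  rewrite normrN normrM ler_pM//; apply: le_trans (ler_normD _ _) _; lra.
have q1q2 : `|q1 ^+ 2| <= 4.
  by rewrite normrX expr2 (_ : 4 = 2 * 2) ?ler_pM//; ring.
have e0 : 0 <= e by exact: le_trans (normr_ge0 _) e1.
split; apply: quotient_error => //.
- have -> : p1 * (1 - p2) - q1 * (1 - q2) = (p1 - q1) - (p1 - q1) * p2 - q1 * (p2 - q2) by ring.
  apply: le_trans (ler_normB _ _) _; apply: le_trans (lerD (ler_normB _ _) (lexx _)) _.
  have h1 : `|(p1 - q1) * p2| <= e * 2 by rewrite normrM ler_pM.
  have h2 : `|q1 * (p2 - q2)| <= 2 * e by rewrite normrM ler_pM.
  lra.
- have h : `|1 - q2| <= 3.
    by apply: le_trans (ler_normB _ _) _; rewrite normr1; lra.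
  by rewrite normrM; apply: le_trans (ler_pM _ _ q12 h) _ => //; lra.
- have -> : p2 - p1 ^+ 2 - (q2 - q1 ^+ 2) = (p2 - q2) + ((1 - p1 ^+ 2) - (1 - q1 ^+ 2)) by ring.
  by apply: le_trans (ler_normD _ _) _; lra.
- by apply: le_trans (ler_normB _ _) _; lra.
Qed.

(** The limiting autoregressive polynomial [1 - 2 c z + z^2] has its roots on the unit circle. *)
Lemma a12f_limit (c s : R) : 0 < s -> c ^+ 2 + s ^+ 2 = 1 ->
  a1f c (2 * c ^+ 2 - 1) = 2 * c /\ a2f c (2 * c ^+ 2 - 1) = -1.
Proof.
move=> s0 cs; have s20 : s ^+ 2 != 0 by rewrite gt_eqF ?exprn_gt0.
have c2 : 1 - c ^+ 2 = s ^+ 2 by rewrite -cs; ring.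
have c3 : 1 - (2 * c ^+ 2 - 1) = 2 * s ^+ 2 by rewrite -c2; ring.
have c4 : 2 * c ^+ 2 - 1 - c ^+ 2 = - s ^+ 2 by rewrite -c2; ring.
rewrite /a1f /a2f c3 c4 c2; split; last by rewrite mulNr divff.
by field; rewrite gt_eqF.
Qed.

(** The derivative of [acos] blows up at the ends of [[-1, 1]]; [s > 0] keeps a neighbourhood of [c]
    away from them, and the mean value theorem applies there. *)
Lemma acos_error (c s : R) : 0 < s -> c ^+ 2 + s ^+ 2 = 1 ->
  exists eta L : R, [/\ 0 < eta, 0 < L & forall x y : R, `|x - c| <= eta -> `|y - c| <= eta ->
    `|acos x - acos y| <= L * `|x - y| ].
Proof.
move=> s0 cs; set k := s ^+ 2 / 2; have k0 : 0 < k by rewrite divr_gt0 ?exprn_gt0.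
exists (s ^+ 2 / 8), (Num.sqrt k)^-1; split; [by rewrite divr_gt0 ?exprn_gt0|by rewrite invr_gt0 sqrtr_gt0|].
suff H x y : x < y -> `|x - c| <= s ^+ 2 / 8 -> `|y - c| <= s ^+ 2 / 8 ->
    `|acos y - acos x| <= (Num.sqrt k)^-1 * `|y - x|.
  move=> x y xc yc; have [xy|yx|->] := ltgtP x y.
  - by rewrite distrC [`|x - y|]distrC; apply: H.
  - exact: H.
  - by rewrite !subrr normr0 mulr0.
move=> xy xc yc.
have near z : x <= z <= y -> `|z - c| <= s ^+ 2 / 8.
  move: xc yc; rewrite !ler_norml => /andP[? ?] /andP[? ?] /andP[? ?].
  by apply/andP; split; lra.
have in11 (z : R) : x <= z <= y -> -1 < z < 1.
  move=> /near /(one_sub_sqr_ge _ _ _ cs)[h _].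
  have : z ^+ 2 < 1 by move: h k0; rewrite /k; lra.
  by rewrite -real_normK ?num_real// expr_lt1// ltr_norml.
have [z zxy ->] : exists2 z, z \in `]x, y[ & acos y - acos x = - (Num.sqrt (1 - z ^+ 2))^-1 * (y - x).
  apply: (@MVT _ (@acos R) (fun z => - (Num.sqrt (1 - z ^+ 2))^-1)) => //.
    move=> z; rewrite in_itv/= => /andP[xz zy]; apply: is_derive1_acos.
    by apply: in11; rewrite !ltW.
  apply: continuous_in_subspaceT => z; rewrite inE/= in_itv/= => zxy.
  by apply: continuous_acos; apply: in11.
rewrite normrM ler_wpM2r// normrN normfV ger0_norm ?sqrtr_ge0//.
have [h _] : s ^+ 2 / 2 <= 1 - z ^+ 2 /\ `|z| <= 2.
  apply: one_sub_sqr_ge cs _; apply: near.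
  by move: zxy; rewrite in_itv/= => /andP[? ?]; rewrite !ltW.
have h0 : 0 < 1 - z ^+ 2 by exact: lt_le_trans h.
by rewrite lef_pV2 ?posrE ?sqrtr_gt0// ler_sqrt// ltW.
Qed.

Lemma lamf_error (c s : R) : 0 < s -> c ^+ 2 + s ^+ 2 = 1 ->
  exists eta L : R, [/\ 0 < eta, 0 < L & forall a1 a2 b1 b2 e : R,
    `|a1 - 2 * c| <= eta -> `|a2 + 1| <= eta -> `|b1 - 2 * c| <= eta -> `|b2 + 1| <= eta ->
    `|a1 - b1| <= e -> `|a2 - b2| <= e ->
    [/\ a2 < 0, b2 < 0 & `|lamf a1 a2 - lamf b1 b2| <= L * e] ].
Proof.
move=> s0 cs; have [eta [L [eta0 L0 H]]] := acos_error _ _ s0 cs.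
(* The constant of [quotient_error] with [k = 2]: within [1/2] of [-1], [a2] satisfies
   [- 4 * a2 >= 2]. The second radius [eta / C] keeps the argument of [acos] within [eta] of [c]. *)
pose C : R := 6 / 2 + 32 / 2 ^+ 2; have C0 : 0 < C by rewrite addr_gt0// divr_gt0// exprn_gt0.
have c1 := norm_le1_sqrD _ _ cs.
exists (Num.min (1/2) (eta / C)), (L * C); split; [|by rewrite mulr_gt0|].
  by rewrite lt_min !divr_gt0.
have lip a1 a2 b1 b2 e : `|a1 - b1| <= e -> `|a2 - b2| <= e ->
   `|a1 - 2 * c| <= 1/2 -> `|a2 + 1| <= 1/2 -> `|b1 - 2 * c| <= 1/2 -> `|b2 + 1| <= 1/2 ->
   `|a1 * (1 - a2) / (- 4 * a2) - b1 * (1 - b2) / (- 4 * b2)| <= C * e.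
  move=> e1 e2 a1c a2c b1c b2c.
  have e0 : 0 <= e by exact: le_trans (normr_ge0 _) e1.
  have b13 : `|b1| <= 3.
    apply: norm_le_near b1c _; rewrite normrM ger0_norm//; lra.
  have n1 : forall x : R, `|x + 1| <= 1/2 -> `|1 - x| <= 5/2.
    by move=> x; rewrite !ler_norml => /andP[? ?]; apply/andP; split; lra.
  apply: quotient_error => //.
  - by move: a2c; rewrite ler_norml => /andP[? ?]; lra.
  - by move: b2c; rewrite ler_norml => /andP[? ?]; lra.
  - have -> : a1 * (1 - a2) - b1 * (1 - b2) = (a1 - b1) * (1 - a2) - b1 * (a2 - b2) by ring.
    apply: le_trans (ler_normB _ _) _.
    have h1 : `|(a1 - b1) * (1 - a2)| <= e * (5/2) by rewrite normrM ler_pM// n1.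
    have h2 : `|b1 * (a2 - b2)| <= 3 * e by rewrite normrM ler_pM.
    lra.
  - have h := n1 _ b2c.
    by rewrite normrM; apply: le_trans (ler_pM _ _ b13 h) _ => //; lra.
  - have -> : - 4 * a2 - - 4 * b2 = - (4 * (a2 - b2)) by ring.
    by rewrite normrN normrM ger0_norm// ler_pM2l.
move=> a1 a2 b1 b2 e; rewrite !le_min.
move=> /andP[a1h a1e] /andP[a2h a2e] /andP[b1h b1e] /andP[b2h b2e] e1 e2.
split; [by move: a2h; rewrite ler_norml => /andP[? ?]; lra
       |by move: b2h; rewrite ler_norml => /andP[? ?]; lra|].
(* At the limit [(2 c, -1)] the argument of [acos] is [c], so [lip] also measures the distance to
   [c]. *)
have cE : c = 2 * c * (1 - (-1)) / (- 4 * (-1)) by field.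
have nearc x1 x2 : `|x1 - 2 * c| <= 1/2 -> `|x1 - 2 * c| <= eta / C ->
   `|x2 + 1| <= 1/2 -> `|x2 + 1| <= eta / C -> `|x1 * (1 - x2) / (- 4 * x2) - c| <= eta.
  move=> h1 h2 h3 h4; rewrite [X in _ - X]cE.
  have -> : eta = C * (eta / C) by field; rewrite gt_eqF.
  apply: lip => //; rewrite ?opprK//; rewrite ?subrr ?addNr ?normr0; lra.
rewrite /lamf; apply: le_trans (H _ _ _ _) _; [exact: nearc|exact: nearc|].
by rewrite -[L * C * e]mulrA ler_pM2l//; apply: lip.
Qed.

End DeltaMethod.

(** * Spectral lower bound for the variance *)

Section RealIntegrable.
Context {d : measure_display} {T : measurableType d} {R : realType}.
Variables (mu : {measure set T -> \bar R}) (D : set T).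
Hypothesis mD : measurable D.
Implicit Types f g h : T -> R.

Let L1 f := mu.-integrable D (EFin \o f).

Lemma rintegrable_measurable f : L1 f -> measurable_fun D f.
Proof. by move=> /integrableP[/measurable_EFinP]. Qed.

Lemma rintegrableD f g : L1 f -> L1 g -> L1 (fun x => f x + g x).
Proof.
move=> If Ig; apply: eq_integrable (integrableD mD If Ig) => // x _ /=.
Qed.

Lemma rintegrableZ k f : L1 f -> L1 (fun x => k * f x).
Proof. by move=> If; apply: eq_integrable (integrableZl mD k If). Qed.

Lemma rintegrableB f g : L1 f -> L1 g -> L1 (fun x => f x - g x).
Proof.
by move=> If Ig; apply: eq_integrable (integrableB mD If Ig) => // x _ /=.
Qed.

Lemma rintegrable_sum I (s : seq I) (F : I -> T -> R) :
  (forall i, L1 (F i)) -> L1 (fun x => \sum_(i <- s) F i x).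
Proof.
move=> IF; apply: eq_integrable (integrable_sum mD s (P := xpredT) (fun i _ => IF i)) => // x _ /=.
by rewrite sumEFin.
Qed.

Lemma rintegrable_le f g : measurable_fun D f ->
  (forall x, D x -> `|f x| <= g x) -> L1 g -> L1 f.
Proof.
move=> mf fg; apply: le_integrable => //; first exact/measurable_EFinP.
by move=> x Dx /=; rewrite lee_fin (le_trans (fg _ Dx))// ler_norm.
Qed.

Lemma rintegrable_mul_bounded f h B : measurable_fun D h ->
  (forall x, D x -> `|h x| <= B) -> L1 f -> L1 (fun x => f x * h x).
Proof.
move=> mh hB If; apply: (@rintegrable_le _ (fun x => B * `|f x|)).
- by apply: measurable_funM => //; exact: rintegrable_measurable.
- by move=> x Dx; rewrite normrM mulrC ler_wpM2r// hB.
- by apply: rintegrableZ; apply: integrable_norm.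
Qed.

Lemma Rintegral_sum I (s : seq I) (F : I -> T -> R) :
  (forall i, L1 (F i)) ->
  \int[mu]_(x in D) (\sum_(i <- s) F i x) = \sum_(i <- s) \int[mu]_(x in D) F i x.
Proof.
move=> IF; elim: s => [|i s IH].
  under eq_Rintegral do rewrite big_nil.
  by rewrite big_nil Rintegral_cst// mul0r.
under eq_Rintegral do rewrite big_cons.
by rewrite RintegralD ?big_cons ?IH//; [exact: IF|exact: rintegrable_sum].
Qed.

End RealIntegrable.

(** * The Poisson kernel and its partial sums *)

Section PoissonKernel.
Context {R : realType}.
Implicit Types (r x : R).

(** Multiplication by [|1 - r e^{ix}|^2] makes the partial sum telescope; the terms beyond [1 - r^2]
    vanish geometrically in [J] when [0 < r < 1]. *)
Lemma poisson_sum r x J :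
  (1 - 2 * r * cos x + r ^+ 2) * (1 + 2 * \sum_(j < J) r ^+ j.+1 * cos (j.+1%:R * x)) =
  1 - r ^+ 2 - 2 * r ^+ J.+1 * cos (J.+1%:R * x) + 2 * r ^+ J.+2 * cos (J%:R * x).
Proof.
elim: J => [|J IH]; first by rewrite big_ord0 mul1r mul0r cos0; ring.
rewrite big_ord_recr /= [2 * (_ + _)]mulrDr addrA mulrDr IH.
have e1 : J.+2%:R * x = J.+1%:R * x + x by rewrite -natr1; ring.
have e2 : J%:R * x = J.+1%:R * x - x by rewrite -natr1; ring.
by rewrite e1 e2 cosB cosD !exprS; ring.
Qed.

Lemma sin_le_norm x : `|sin x| <= `|x|.
Proof.
suff H (y : R) : 0 < y -> `|sin y| <= y.
  have [x0|x0|<-] := ltgtP 0 x; last by rewrite sin0.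
    by rewrite [leRHS]gtr0_norm// H.
  by rewrite -normrN -sinN [leRHS]ltr0_norm// H// oppr_gt0.
move=> y0; have [z _] : exists2 z, z \in `]0, y[ & sin y - sin 0 = cos z * (y - 0).
  apply: (@MVT _ (@sin R) (@cos R)) => //.
  by apply: continuous_subspaceT => z; exact: continuous_sin.
rewrite sin0 !subr0 => ->; rewrite normrM (gtr0_norm y0) ler_piMl ?cos_max// ltW//.
Qed.

Lemma cos_ge_sqr x : 1 - x ^+ 2 / 2 <= cos x.
Proof.
have -> : cos x = cos ((x / 2) *+ 2) by congr cos; rewrite -mulr_natr; field.
rewrite cos_mulr2n cos2sin2 [X in _ <= X - _]mulr2n.
have h : sin (x / 2) ^+ 2 <= (x / 2) ^+ 2.
  by rewrite -real_normK ?num_real// -[leRHS]real_normK ?num_real// lerXn2r ?nnegrE ?sin_le_norm.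
have e : (x / 2) ^+ 2 = x ^+ 2 / 4 by field.
by move: h; rewrite e; lra.
Qed.

(** Partial sum of the Poisson kernel [(1 - r^2) / |1 - r e^{ix}|^2]. Being finite, it integrates
    against a spectral density to a finite combination of autocovariances. *)
Definition pkernel r x J : R := 1 + 2 * \sum_(j < J) r ^+ j.+1 * cos (j.+1%:R * x).

Variables (r : R).
Hypothesis r01 : 0 < r < 1.
Let d := 1 - r.
Let P x := 1 - 2 * r * cos x + r ^+ 2.

Let Pge x : d ^+ 2 <= P x.
Proof.
have := r01 => /andP[r0 r1]; have : r * cos x <= r by rewrite ler_piMr ?cos_le1// ltW.
by rewrite /P /d !expr2; lra.
Qed.

Let d0 : 0 < d. Proof. by have := r01; rewrite /d; lra. Qed.
Let P0 x : 0 < P x. Proof. by apply: lt_le_trans (Pge x); rewrite exprn_gt0. Qed.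

Lemma pkernel_error x J :
  `|pkernel r x J - (1 - r ^+ 2) / P x| <= 4 * r ^+ J.+1 / d ^+ 2.
Proof.
have e : pkernel r x J - (1 - r ^+ 2) / P x =
   (- (2 * r ^+ J.+1 * cos (J.+1%:R * x)) + 2 * r ^+ J.+2 * cos (J%:R * x)) / P x.
  apply: (mulIf (lt0r_neq0 (P0 x))); rewrite mulrBl !divfK ?gt_eqF//.
  by rewrite mulrC [P x * _]poisson_sum; ring.
have := r01 => /andP[r0 r1].
have rJ0 : 0 <= r ^+ J.+1 by rewrite exprn_ge0// ltW.
rewrite e normrM normfV (gtr0_norm (P0 x)) ler_pM ?invr_ge0 ?(ltW (P0 x))//; last first.
  by rewrite lef_pV2 ?posrE ?exprn_gt0.
apply: le_trans (ler_normD _ _) _; rewrite normrN.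
have h (a y : R) : 0 <= a -> `|2 * a * cos y| <= 2 * a.
  by move=> a0; rewrite normrM ger0_norm ?mulr_ge0// ler_piMr ?cos_max// mulr_ge0.
have h2 : r ^+ J.+2 <= r ^+ J.+1 by rewrite exprS ler_piMl// ltW.
apply: le_trans (lerD (h _ _ rJ0) (h _ _ _)) _; first by rewrite exprn_ge0// ltW.
lra.
Qed.

(** The denominator is [d^2 + 2 r (1 - cos x)], at most [2 d^2] in this range. *)
Lemma poisson_near x : `|x| <= d -> (2 * d)^-1 <= (1 - r ^+ 2) / P x.
Proof.
move=> xd; have := r01 => /andP[r0 r1]; have dd := d0.
have x2 : x ^+ 2 <= d ^+ 2.
  by rewrite -real_normK ?num_real// lerXn2r ?nnegrE// ltW.
have Pu : P x <= 2 * d ^+ 2.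
  have := cos_ge_sqr x => /(ler_wpM2l (ltW r0)) h.
  have : r * (x ^+ 2 / 2) <= x ^+ 2 / 2 by rewrite ler_piMl ?divr_ge0 ?sqr_ge0// ltW.
  by rewrite mulrBr mulr1 in h; move: x2 h; rewrite /P /d !expr2; lra.
have r2 : d <= 1 - r ^+ 2.
  have : r ^+ 2 <= r by rewrite expr2 ler_piMl// ltW.
  by rewrite /d; lra.
rewrite ler_pdivlMr//; apply: le_trans r2.
apply: le_trans (ler_wpM2l _ Pu) _; first by rewrite invr_ge0 mulr_ge0// ltW.
by rewrite le_eqVlt; apply/orP; left; apply/eqP; field; rewrite gt_eqF.
Qed.

Lemma poisson_ge0 x : 0 <= (1 - r ^+ 2) / P x.
Proof.
have := r01 => /andP[r0 r1].
by rewrite divr_ge0 ?(ltW (P0 x))// subr_ge0 exprn_ile1// ltW.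
Qed.

(** The denominator is at least [(r - |c|)^2 + 1 - c^2]. This serves the negative frequencies, which
    stay away from [l0] modulo [2 pi]. *)
Lemma poisson_far x (c s : R) : 0 < s -> c ^+ 2 + s ^+ 2 = 1 -> cos x <= `|c| ->
  (1 - r ^+ 2) / P x <= 2 * d / s ^+ 2.
Proof.
move=> s0 cs xc; have := r01 => /andP[r0 r1].
have Pl : s ^+ 2 <= P x.
  have c2 : `|c| ^+ 2 = c ^+ 2 by rewrite real_normK ?num_real.
  have h1 : r * cos x <= r * `|c| by rewrite ler_pM2l.
  have := sqr_ge0 (r - `|c|); rewrite sqrrB c2 /P -mulr_natr.
  by move: h1; have := cs; lra.
have s20 : 0 < s ^+ 2 by rewrite exprn_gt0.
rewrite ler_pM ?invr_ge0 ?(ltW (P0 x))//.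
- by rewrite subr_ge0 exprn_ile1// ltW.
- have -> : 1 - r ^+ 2 = (1 + r) * d by rewrite /d; ring.
  by rewrite ler_pM2r//; lra.
- by rewrite lef_pV2 ?posrE.
Qed.

End PoissonKernel.

(** * Poisson sums of the autocovariances *)

Section SpectralLowerBound.
Context {R : realType}.
Variables (gam : int -> R) (f : R -> R) (l0 c0 : R).
Hypotheses (l0pi : 0 < l0 < pi) (sd : is_spectral_density gam f)
  (c00 : 0 < c0) (fc0 : forall l, 0 <= l <= pi -> c0 <= f l).

Local Notation mu := (@lebesgue_measure R).
Let D := `[- pi, pi]%classic : set R.
Let mD : measurable D. Proof. exact: measurable_itv. Qed.
Let fI : mu.-integrable D (EFin \o f). Proof. by case: sd. Qed.

Let fcosI a b : mu.-integrable D (EFin \o (fun l => f l * cos (a * l + b))).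
Proof.
apply: (rintegrable_mul_bounded mu D mD f (fun l => cos (a * l + b)) 1) => //.
- apply: (@measurable_funS _ _ _ _ setT) => //; apply: continuous_measurable_fun.
  move=> l; apply: (@continuous_comp _ _ _ (fun l => a * l + b) (@cos R)); last exact: continuous_cos.
  by apply: continuousD; [apply: continuousM; [exact: cst_continuous|exact: id]|exact: cst_continuous].
- by move=> l _; exact: cos_max.
Qed.

(* The vanishing of the sine coefficients is what allows a one-sided kernel
   [cos (j (l - l0))] instead of its symmetrisation. *)
Lemma spectral_cos (j : nat) :
  gam j%:Z * cos (j%:R * l0) = \int[mu]_(l in D) (f l * cos (j%:R * (l - l0))).
Proof.
have [_ /(_ j%:Z)[gc gs]] := sd.
have Ic : mu.-integrable D (EFin \o (fun l => f l * cos (j%:R * l))).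
  by have := fcosI j%:R 0; under eq_fun do rewrite addr0.
have Is : mu.-integrable D (EFin \o (fun l => f l * sin (j%:R * l))).
  have := fcosI j%:R (- (pi / 2)).
  by under eq_fun do rewrite cosBpihalf.
rewrite -[LHS]addr0 -(mul0r (sin (j%:R * l0))) gc gs -!pmulrn.
rewrite -RintegralZr// -RintegralZr// -RintegralD//.
- by apply: eq_Rintegral => l _; rewrite mulrBr cosB; ring.
- have := rintegrableZ mu D mD (cos (j%:R * l0)) _ Ic.
  by apply: eq_integrable => // l _ /=; rewrite mulrC.
- have := rintegrableZ mu D mD (sin (j%:R * l0)) _ Is.
  by apply: eq_integrable => // l _ /=; rewrite mulrC.
Qed.

Lemma spectral_pkernel r J :
  gam 0 + 2 * \sum_(j < J) r ^+ j.+1 * cos (j.+1%:R * l0) * gam j.+1%:Z =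
  \int[mu]_(l in D) (f l * pkernel r (l - l0) J).
Proof.
have I j : mu.-integrable D (EFin \o (fun l => f l * cos (j%:R * (l - l0)))).
  have := fcosI j%:R (- (j%:R * l0)).
  by under eq_fun do rewrite -mulrBr.
have e0 := spectral_cos 0; rewrite mul0r cos0 mulr1 in e0.
rewrite [gam 0]e0.
have -> : 2 * \sum_(j < J) r ^+ j.+1 * cos (j.+1%:R * l0) * gam j.+1%:Z =
  \sum_(j < J) \int[mu]_(l in D) (2 * r ^+ j.+1 * (f l * cos (j.+1%:R * (l - l0)))).
  rewrite mulr_sumr; apply: eq_bigr => j _.
  by rewrite RintegralZl// -spectral_cos; ring.
rewrite -Rintegral_sum//; last by move=> j; exact: rintegrableZ.
rewrite -RintegralD//; last by apply: rintegrable_sum => // j; exact: rintegrableZ.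
apply: eq_Rintegral => l _; rewrite mul0r cos0 /pkernel mulrDr !mulr_sumr; congr (_ + _).
by apply: eq_bigr => j _; ring.
Qed.

Let sin0' : 0 < sin l0.
Proof. exact: sin_gt0_pi. Qed.

(** The window of length [2 (1 - r)] around [l0], where the kernel is at least [1 / (2 (1 - r))],
    contributes [c0]. The density is bounded below only on [[0, pi]]; negative frequencies are
    estimated by [|f|] and cost [O(1 - r)], and the truncation of the kernel costs the last term. *)
Lemma spectral_sum_ge : exists C : R, 0 <= C /\ forall (r : R) J, 0 < r < 1 ->
  1 - r <= l0 -> 1 - r <= pi - l0 ->
  c0 - C * (1 - r) - C * (r ^+ J.+1 / (1 - r) ^+ 2) <=
  gam 0 + 2 * \sum_(j < J) r ^+ j.+1 * cos (j.+1%:R * l0) * gam j.+1%:Z.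
Proof.
pose nf := \int[mu]_(l in D) `|f l|.
have nf0 : 0 <= nf by apply: Rintegral_ge0 => l _.
have s0 := sin0'; set s := sin l0 in s0; have cs : cos l0 ^+ 2 + s ^+ 2 = 1 by exact: cos2Dsin2.
exists (2 / s ^+ 2 * nf + 4 * nf); split.
  by rewrite addr_ge0 ?mulr_ge0// invr_ge0 sqr_ge0.
move=> r J r01 dl dl'; rewrite spectral_pkernel.
set d := 1 - r in dl dl' *; have d0 : 0 < d by rewrite /d; lra.
set e := r ^+ J.+1 / d ^+ 2.
have e0 : 0 <= e by rewrite divr_ge0 ?exprn_ge0// ltW//; case/andP: r01.
pose E : set R := `[l0 - d, l0 + d]%classic.
have mE : measurable E by exact: measurable_itv.
have EI : mu.-integrable D (EFin \o \1_E).
  apply: (@integrableS _ _ _ mu setT) => //; exact: integrable_indic_itv.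
have nI : mu.-integrable D (EFin \o (fun l => `|f l|)) by exact: integrable_norm.
have KI : mu.-integrable D (EFin \o (fun l => f l * pkernel r (l - l0) J)).
  rewrite /pkernel.
  have I0 : mu.-integrable D (EFin \o (fun l => f l + \sum_(j < J) (2 * r ^+ j.+1) * (f l * cos (j.+1%:R * (l - l0))))).
    apply: rintegrableD => //; apply: rintegrable_sum => // j; apply: rintegrableZ => //.
    have := fcosI j.+1%:R (- (j.+1%:R * l0)).
    by under eq_fun do rewrite -mulrBr.
  apply: eq_integrable I0 => // l _ /=.
  rewrite mulrDr mulr1 !mulr_sumr; congr (_ + _)%:E.
  by apply: eq_bigr => j _; ring.
have LI : mu.-integrable D (EFin \o (fun l => c0 / (2 * d) * \1_E l - (2 * d / s ^+ 2 + 4 * e) * `|f l|)).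
  by apply: rintegrableB => //; apply: rintegrableZ.
(* Pointwise minorant: the window, less the far part of the kernel and the truncation error, both
   weighted by [|f|]. *)
have main l : D l -> c0 / (2 * d) * \1_E l - (2 * d / s ^+ 2 + 4 * e) * `|f l| <=
   f l * pkernel r (l - l0) J.
  rewrite /D /= in_itv /= => /andP[lpi lpi'].
  have := pkernel_error r r01 (l - l0) J; rewrite -/d -[4 * _ / _]mulrA -/e.
  have := poisson_ge0 r r01 (l - l0); have := poisson_near r r01 (l - l0).
  set Q := (1 - r ^+ 2) / _ => near Q0 err.
  have err' : `|f l * pkernel r (l - l0) J - f l * Q| <= 4 * e * `|f l|.
    by rewrite -mulrBr normrM mulrC ler_wpM2r.
  suff low : c0 / (2 * d) * \1_E l - 2 * d / s ^+ 2 * `|f l| <= f l * Q.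
    move: err'; rewrite ler_norml mulrDl => /andP[? _]; lra.
  have h0 : 0 <= 2 * d / s ^+ 2 * `|f l|.
    by rewrite mulr_ge0// divr_ge0 ?sqr_ge0// mulr_ge0// ltW.
  have [l00|l00] := leP 0 l.
    have fl : c0 <= f l by apply: fc0; rewrite l00 lpi'.
    have fQ : 0 <= f l * Q by rewrite mulr_ge0// (le_trans (ltW c00)).
    rewrite indicE; case: (boolP (l \in E)) => lE; last by rewrite mulr0; lra.
    have := near; rewrite -/d => /(_ _)nr.
    have {}nr : (2 * d)^-1 <= Q.
      apply: nr; move: lE; rewrite inE /E /= in_itv /= => /andP[? ?].
      by rewrite ler_norml; apply/andP; split; lra.
    have : c0 / (2 * d) <= f l * Q.
      by apply: ler_pM => //; [exact: ltW|rewrite invr_ge0 mulr_ge0// ltW].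
    by rewrite mulr1; lra.
  have -> : \1_E l = 0 :> R.
    rewrite indicE memNset// /E /= in_itv /= => /andP[? ?]; lra.
  rewrite mulr0 sub0r.
  (* For [l] in [[- pi, 0)] the product [sin l * sin l0] is nonpositive, so only the cosine product
     remains. *)
  have cl : cos (l - l0) <= `|cos l0|.
    rewrite cosB.
    have sl : sin l <= 0.
      by rewrite -[l]opprK sinN oppr_le0; apply: sin_ge0_pi; apply/andP; split; lra.
    have h1 : sin l * sin l0 <= 0 by rewrite mulr_le0_ge0// ltW.
    have h2 : cos l * cos l0 <= `|cos l0|.
      by apply: le_trans (ler_norm _) _; rewrite normrM ler_piMl// cos_max.
    lra.
  have far := poisson_far r r01 (l - l0) _ _ s0 cs cl; rewrite -/Q -/d in far.
  apply: le_trans (_ : - `|f l * Q| <= _); last by rewrite lerNl -normrN ler_norm.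
  by rewrite lerN2 normrM (ger0_norm Q0) mulrC ler_wpM2r.
apply: le_trans (_ : \int[mu]_(l in D) (c0 / (2 * d) * \1_E l - (2 * d / s ^+ 2 + 4 * e) * `|f l|) <= _); last by apply: le_Rintegral.
rewrite RintegralB//; [|exact: rintegrableZ|exact: rintegrableZ].
rewrite !RintegralZl// -/nf.
have -> : \int[mu]_(x in D) \1_E x = 2 * d.
  rewrite /Rintegral integral_indic//.
  rewrite (_ : E `&` D = E); last first.
    apply/setIidPl => l; rewrite /E /D /= !in_itv /= => /andP[? ?].
    have := pi_gt0 R; case/andP: l0pi => ? ? ?; apply/andP; split; lra.
  have := lebesgue_measure_itv `[l0 - d, l0 + d]; rewrite /= lte_fin ifT; last lra.
  by rewrite -EFinB => ->; rewrite /=; ring.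
have -> : c0 / (2 * d) * (2 * d) = c0 by field; rewrite gt_eqF.
have q0 : 0 <= 2 / s ^+ 2 by rewrite divr_ge0// sqr_ge0.
have -> : 2 * d / s ^+ 2 = 2 / s ^+ 2 * d by ring.
have a1 : 0 <= nf * d by rewrite mulr_ge0// ltW.
have a2 : 0 <= 2 / s ^+ 2 * nf * e by apply: mulr_ge0 => //; apply: mulr_ge0.
move: (2 / s ^+ 2) a1 a2 => q a1 a2; lra.
Qed.

End SpectralLowerBound.

(** * Expectations and tail bounds *)

Section Expectation.
Context {d : measure_display} {T : measurableType d} {R : realType}.
Variable P : probability T R.
Implicit Types f g : T -> R.

Let L1 f := P.-integrable setT (EFin \o f).

Lemma Ex_Rintegral f : Ex P f = \int[P]_w f w.
Proof. by rewrite /Ex unlock. Qed.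

Lemma ExD f g : L1 f -> L1 g -> Ex P (fun w => f w + g w) = Ex P f + Ex P g.
Proof. by move=> If Ig; rewrite !Ex_Rintegral RintegralD. Qed.

Lemma ExB f g : L1 f -> L1 g -> Ex P (fun w => f w - g w) = Ex P f - Ex P g.
Proof. by move=> If Ig; rewrite !Ex_Rintegral RintegralB. Qed.

Lemma ExZ k f : L1 f -> Ex P (fun w => k * f w) = k * Ex P f.
Proof. by move=> If; rewrite !Ex_Rintegral RintegralZl. Qed.

Lemma Ex_cst k : Ex P (fun=> k) = k.
Proof. by rewrite /Ex -[fun=> _]/(cst k) expectation_cst. Qed.

Lemma rintegrable_cst k : L1 (fun=> k).
Proof. exact: finite_measure_integrable_cst. Qed.

Lemma Ex_sum I (s : seq I) (F : I -> T -> R) : (forall i, L1 (F i)) ->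
  Ex P (fun w => \sum_(i <- s) F i w) = \sum_(i <- s) Ex P (F i).
Proof.
move=> IF; rewrite Ex_Rintegral Rintegral_sum//.
by apply: eq_bigr => i _; rewrite Ex_Rintegral.
Qed.

Lemma eq_Ex f g : f =1 g -> Ex P f = Ex P g.
Proof. by move=> fg; rewrite (_ : f = g)//; apply/funext. Qed.

Lemma Ex_ge0 f : (forall w, 0 <= f w) -> 0 <= Ex P f.
Proof. by move=> f0; rewrite Ex_Rintegral; apply: Rintegral_ge0. Qed.

Lemma integral_Ex f : L1 f -> (\int[P]_w (f w)%:E = (Ex P f)%:E)%E.
Proof.
by move=> If; rewrite Ex_Rintegral /Rintegral fineK//; exact: integrable_fin_num.
Qed.

Lemma rintegrable_mul f g : measurable_fun setT f -> measurable_fun setT g ->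
  L1 (fun w => f w ^+ 2) -> L1 (fun w => g w ^+ 2) -> L1 (fun w => f w * g w).
Proof.
move=> mf mg If Ig; apply: (@rintegrable_le _ _ _ P setT measurableT _ (fun w => f w ^+ 2 + g w ^+ 2)).
- exact: measurable_funM.
- move=> w _; rewrite normrM.
  have := sqr_ge0 (`|f w| - `|g w|); rewrite sqrrB !real_normK ?num_real//.
  have := mulr_ge0 (normr_ge0 (f w)) (normr_ge0 (g w)).
  by rewrite -mulr_natr; lra.
- exact: rintegrableD.
Qed.

Lemma Ex_cvg (Y : nat -> T -> R) (Z g : T -> R) :
  (forall m, measurable_fun setT (Y m)) -> measurable_fun setT Z -> L1 g ->
  {ae P, forall w, (Y ^~ w @ \oo --> Z w) /\ (forall m, `|Y m w| <= g w)} ->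
  L1 Z /\ (fun m => Ex P (Y m)) @ \oo --> Ex P Z.
Proof.
move=> mY mZ Ig H.
have [] := @dominated_convergence _ _ _ P setT measurableT (fun m => EFin \o Y m) (EFin \o Z) (EFin \o g).
- by move=> m; apply/measurable_EFinP.
- exact/measurable_EFinP.
- apply: filterS H => w [YZ _] _; apply: cvg_EFin => //; exact: nearW.
- exact: Ig.
- by apply: filterS H => w [_ Yg] m _; rewrite lee_fin.
move=> IZ _ cv; split => //.
have IY m : L1 (Y m).
  apply/integrableP; split; first exact/measurable_EFinP.
  have /integrableP[_ glt] := Ig.
  apply: le_lt_trans glt.
  apply: ae_ge0_le_integral => //.
  - by apply: measurableT_comp => //; exact/measurable_EFinP.
  - by apply: measurableT_comp => //; case/integrableP: Ig.
  - apply: filterS H => w [_ /(_ m)Yg] _ /=; rewrite lee_fin.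
    by apply: le_trans Yg (ler_norm _).
have -> : (fun m => Ex P (Y m)) = fine \o (fun m => (\int[P]_w (Y m w)%:E)%E).
  by apply/funext => m /=; rewrite integral_Ex.
apply: fine_cvg; rewrite -integral_Ex//.
Qed.

(** Fatou needs only the uniform second moment bound, so no integrable function dominating the
    squares has to be found. *)
Lemma fatou_chebyshev (Y : nat -> T -> R) (Z : T -> R) C a :
  (forall m, measurable_fun setT (Y m)) -> measurable_fun setT Z ->
  {ae P, forall w, Y ^~ w @ \oo --> Z w} ->
  (forall m, L1 (fun w => Y m w ^+ 2)) -> (forall m, Ex P (fun w => Y m w ^+ 2) <= C) ->
  0 < a -> (P [set w | (a < `|Z w|)%R] <= (C / a ^+ 2)%:E)%E.
Proof.
move=> mY mZ YZ IY EY a0.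
have mZ2 : measurable_fun setT (fun w => (Z w ^+ 2)%:E).
  by apply/measurable_EFinP; exact: measurable_funX.
have mY2 m : measurable_fun setT (fun w => (Y m w ^+ 2)%:E).
  by apply/measurable_EFinP; exact: measurable_funX.
have Z2 : (\int[P]_w (Z w ^+ 2)%:E <= C%:E)%E.
  pose f m w := (Y m w ^+ 2)%:E.
  have f0 m w : (0 <= f m w)%E by rewrite lee_fin sqr_ge0.
  have ef : (\int[P]_w (Z w ^+ 2)%:E = \int[P]_w limn_einf (f ^~ w))%E.
    apply: ge0_ae_eq_integral => //.
    - under eq_fun do rewrite -[limn_einf _]oppeK -limn_esupN.
      apply: measurableT_comp => //; apply: measurable_fun_limn_esup => m.
      by apply: measurableT_comp => //; exact: mY2.
    - by move=> w _; rewrite lee_fin sqr_ge0.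
    - move=> w _; rewrite limn_einf_lim; apply: lime_ge; first exact: is_cvg_einfs.
      by apply: nearW => n; apply: le_ereal_inf_tmp => _ [k _ <-].
    - apply: filterS YZ => w Yw _.
      have fw : (f ^~ w @ \oo --> (Z w ^+ 2)%:E).
        apply: cvg_EFin; first by apply: nearW.
        rewrite expr2 (_ : fine \o _ = (fun m => Y m w * Y m w)); first exact: cvgM.
        by apply/funext => m /=; rewrite expr2.
      rewrite is_cvg_limn_einfE; last by apply/cvg_ex; exists (Z w ^+ 2)%:E.
      by apply/esym/cvg_lim.
  rewrite ef; apply: le_trans (fatou _ _ _ _) _ => //.
  rewrite limn_einf_lim; apply: lime_le; first exact: is_cvg_einfs.
  apply: nearW => n; apply: le_trans (_ : (\int[P]_w f n w <= _)%E).
    by apply: ereal_inf_lbound; exists n => /=.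
  by rewrite integral_Ex// lee_fin.
set A := [set w | _].
have mA : measurable A.
  rewrite /A -[X in measurable X]setTI.
  by apply: measurable_fun_ltr => //; exact: measurableT_comp.
have h : ((a ^+ 2)%:E * P A <= C%:E)%E.
  rewrite -integral_cst//.
  apply: le_trans Z2; apply: le_trans (_ : (\int[P]_(w in A) (Z w ^+ 2)%:E <= _)%E).
    apply: ge0_le_integral => //.
    - by move=> w _; rewrite lee_fin sqr_ge0.
    - by apply: measurable_funS mZ2.
    - move=> w Aw; rewrite lee_fin -[leRHS]real_normK ?num_real// lerXn2r ?nnegrE ?(ltW a0)//.
      exact: ltW.
  by apply: ge0_subset_integral => // w _; rewrite lee_fin sqr_ge0.
have fA : P A \is a fin_num by exact: fin_num_measure.
rewrite -(fineK fA) lee_fin ler_pdivlMr ?exprn_gt0// mulrC.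
by move: h; rewrite -(fineK fA) -EFinM lee_fin.
Qed.

(** By completeness, convergence is the Cauchy property, a countable combination of measurable
    conditions. *)
Lemma measurable_cvgn (F : nat -> T -> R) : (forall n, measurable_fun setT (F n)) ->
  measurable [set w | cvgn (F ^~ w)].
Proof.
move=> mF; rewrite (_ : [set w | _] =
  \bigcap_k \bigcup_N \bigcap_p [set w | `|F (N + p)%N w - F N w| < k.+1%:R^-1]).
  apply: bigcap_measurable => // k _; apply: bigcup_measurable => N _.
  apply: bigcap_measurable => // p _.
  rewrite -[X in measurable X]setTI.
  by apply: measurable_fun_ltr => //; apply: measurableT_comp => //; exact: measurable_funB.
apply/seteqP; split => w /=.
  move=> /cvg_ex[l Fl] k _.
  have e0 : 0 < (k.+1%:R^-1 : R) / 2 by rewrite divr_gt0// invr_gt0.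
  move/cvgrPdist_lt : Fl => /(_ _ e0)[N _ HN]; exists N => // p _ /=.
  have -> : F (N + p)%N w - F N w = (l - F N w) - (l - F (N + p)%N w) by ring.
  apply: le_lt_trans (ler_normB _ _) _; rewrite [ltRHS]splitr ltrD// HN//=.
  exact: leq_addr.
move=> H; apply: cauchy_cvg; apply: cauchy_exP => e e0.
have [k ke] : exists k, k.+1%:R^-1 < e :> R.
  have [k _ /(_ _ (leqnn _))] := near_infty_natSinv_lt (PosNum e0).
  by exists k.
have [N _ HN] := H k I; exists (F N w); exists N => // n /= Nn.
rewrite -ball_normE /= distrC; apply: lt_trans ke.
by have := HN (n - N)%N I; rewrite /= subnKC.
Qed.

(** Where the sequence diverges, [limn] takes the constant default [point], so the function is glued
    from two measurable pieces. *)
Lemma measurable_limn (F : nat -> T -> R) : (forall n, measurable_fun setT (F n)) ->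
  measurable_fun setT (fun w => limn (F ^~ w)).
Proof.
move=> mF; set D := [set w | cvgn (F ^~ w)].
have mD : measurable D by exact: measurable_cvgn.
have mI : measurable_fun setT (\1_D : T -> R) by exact: measurable_indic.
have mG : measurable_fun setT (fun w => limn (F ^~ w) * \1_D w).
  apply: (@measurable_fun_cvg _ _ _ _ (fun n w => F n w * \1_D w)) => [n|w _].
    exact: measurable_funM.
  have [Dw|Dw] := pselect (D w).
    by apply: cvgM; [exact: Dw|exact: cvg_cst].
  by rewrite indicE memNset// mulr0; under eq_fun do rewrite mulr0; exact: cvg_cst.
rewrite (_ : (fun w => _) = (fun w => limn (F ^~ w) * \1_D w + (point : R) * (1 - \1_D w))).
  by apply: measurable_funD => //; apply: measurable_funM => //; exact: measurable_funB.
apply/funext => w; rewrite indicE; have [Dw|Dw] := pselect (D w).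
  by rewrite mem_set// subrr mulr0 addr0 mulr1.
by rewrite memNset// subr0 mulr0 add0r mulr1 dvgP.
Qed.

(** The dominating function is the sum of the series, integrable by monotone convergence. *)
Lemma series_dominated (F : nat -> T -> R) B :
  (forall j, measurable_fun setT (F j)) -> (forall j w, 0 <= F j w) -> (forall j, L1 (F j)) ->
  (forall m, \sum_(j < m) Ex P (F j) <= B) ->
  exists g, L1 g /\ {ae P, forall w, forall m, \sum_(j < m) F j w <= g w}.
Proof.
move=> mF F0 IF FB.
pose Q w := (\sum_(j <oo) (F j w)%:E)%E.
have Q0 w : (0 <= Q w)%E by apply: nneseries_ge0 => j _ _; rewrite lee_fin.
have mQ : measurable_fun setT Q.
  by apply: ge0_emeasurable_sum => //; [move=> k w _ _; rewrite lee_fin|move=> k _; exact/measurable_EFinP].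
have QB : (\int[P]_w Q w <= B%:E)%E.
  rewrite integral_nneseries//; last 2 first.
  - by move=> j; exact/measurable_EFinP.
  - by move=> j w _; rewrite lee_fin.
  apply: lime_le.
    by apply: is_cvg_nneseries => j _ _; apply: integral_ge0 => w _; rewrite lee_fin.
  apply: nearW => m; rewrite big_mkord.
  under eq_bigr do rewrite integral_Ex//.
  by rewrite sumEFin lee_fin.
have IQ : P.-integrable setT Q.
  apply/integrableP; split => //; under eq_integral do rewrite gee0_abs//.
  by apply: le_lt_trans QB _; rewrite ltry.
(* [fine] sends an infinite sum to 0, so this holds everywhere; equality is needed only where [Q] is
   finite, which is almost everywhere. *)
have fQ w : ((fine (Q w))%:E <= Q w)%E.
  by have := Q0 w; case: (Q w) => //= _; rewrite leey.
exists (fine \o Q); split.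
  apply: le_integrable IQ => //.
    by apply/measurable_EFinP; apply: measurableT_comp.
  by move=> w _; rewrite (gee0_abs (Q0 w)) /= ger0_norm ?fine_ge0//; exact: fQ.
apply: filterS (integrable_ae measurableT IQ) => w /(_ I) Qw m /=.
rewrite -lee_fin fineK// -sumEFin -(big_mkord xpredT (fun j => (F j w)%:E)).
by apply: nneseries_lim_ge => j _ _; rewrite lee_fin.
Qed.

End Expectation.

(** * Moments of the innovations *)

Section IntegerSums.
Context {R : realType}.
Implicit Types (F : int -> R) (f : nat -> int).

Lemma ler_sum_uniq (K : eqType) (s1 s2 : seq K) (F : K -> R) : (forall x, 0 <= F x) ->
  uniq s1 -> {subset s1 <= s2} -> \sum_(x <- s1) F x <= \sum_(x <- s2) F x.
Proof.
move=> F0; elim: s1 s2 => [|a s1 IH] s2 /=; first by rewrite big_nil sumr_ge0.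
move=> /andP[as1 us1] sub; have as2 : a \in s2 by rewrite sub// mem_head.
rewrite big_cons (big_rem a as2) /= lerD2l; apply: IH => // x xs1.
have xa : x != a by apply: contraNneq as1 => <-.
have := sub x; rewrite in_cons xs1 orbT => /(_ isT).
by rewrite (perm_mem (perm_to_rem as2)) in_cons (negbTE xa).
Qed.

Lemma sum_le_sumZ F f m N : (forall h, 0 <= F h) -> {in gtn m &, injective f} ->
  (forall i, (i < m)%N -> (`|f i| <= N)%N) -> \sum_(i < m) F (f i) <= sumZ N F.
Proof.
move=> F0 finj fN; rewrite /sumZ.
rewrite -(big_mkord xpredT (fun i => F (f i))) -(big_mkord xpredT (fun i => F (i%:Z - N%:Z))).
rewrite -(big_map f xpredT F) -(big_map (fun i : nat => i%:Z - N%:Z) xpredT F).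
rewrite /index_iota !subn0; apply: ler_sum_uniq => //.
  rewrite map_inj_in_uniq ?iota_uniq// => i j; rewrite !mem_iota !add0n /= => im jm.
  exact: finj.
move=> x /mapP[i]; rewrite mem_iota add0n => /andP[_ /fN fiN] ->.
apply/mapP; exists (absz (f i + N%:Z)); first by rewrite mem_iota add0n /=; lia.
by lia.
Qed.

Lemma sumZ_ge0 F N : (forall h, 0 <= F h) -> 0 <= sumZ N F.
Proof. by move=> F0; apply: sumr_ge0. Qed.

Lemma le_sumZ F G N : (forall h, F h <= G h) -> sumZ N F <= sumZ N G.
Proof. by move=> FG; apply: ler_sum. Qed.

(** The weight [|h|] is at least 1 except at [h = 0], which is added separately. Arbitrary injective
    families cover all translates and reflections of the lags with one bound. *)
Lemma absolutely_summable (g : int -> R) B :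
  (forall N, sumZ N (fun h => `|h%:~R| * `|g h|) <= B) ->
  forall m f, {in gtn m &, injective f} ->
  \sum_(i < m) `|g (f i)| <= `|g 0| + B.
Proof.
move=> gB m f finj; pose N := (\max_(i < m) `|f i|%N)%N.
have fN i : (i < m)%N -> (`|f i| <= N)%N.
  by move=> im; rewrite /N -[i]/(nat_of_ord (Ordinal im)); apply: (@leq_bigmax_cond _ xpredT (fun i : 'I_m => `|f i|%N)).
apply: le_trans (@sum_le_sumZ (fun h => `|g h|) f m N _ finj fN) _ => //.
apply: le_trans (lerD (lexx _) (gB N)).
apply: le_trans (_ : sumZ N (fun h => (if h == 0 then `|g 0| else 0) + `|h%:~R| * `|g h|) <= _).
  apply: le_sumZ => h; case: eqP => [->|/eqP h0]; first by rewrite lerDl mulr_ge0.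
  rewrite add0r ler_peMl// -intr_norm (ler_int _ 1); lia.
rewrite /sumZ big_split lerD2r.
have hN : (N < (2 * N).+1)%N by lia.
rewrite (bigD1 (Ordinal hN)) //= subrr eqxx big1 ?addr0// => i iN.
by case: eqP => // /eqP; rewrite subr_eq0 => /eqP[] e; case/eqP: iN; exact/val_inj.
Qed.

(** The family [e] may depend on [b] because the third lag of the cumulants in [row_sum] depends on
    the second summation index. *)
Lemma triple_summable (k : int -> int -> int -> R) B :
  (forall N, sumZ N (fun h1 => sumZ N (fun h2 => sumZ N (fun h3 =>
     (1 + `|h1%:~R| + `|h2%:~R| + `|h3%:~R|) * `|k h1 h2 h3|))) <= B) ->
  forall m n p (f g : nat -> int) (e : nat -> nat -> int), injective f -> injective g -> (forall b, injective (e b)) ->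
  \sum_(a < m) \sum_(b < n) \sum_(c < p) `|k (f a) (g b) (e b c)| <= B.
Proof.
move=> kB m n p f g e finj ginj einj.
pose N := (\max_(a < m) `|f a|%N + \max_(b < n) `|g b|%N + \max_(b < n) \max_(c < p) `|e b c|%N)%N.
have fN a : (a < m)%N -> (`|f a| <= N)%N.
  move=> am; apply: leq_trans (_ : (\max_(a < m) `|f a| <= _)%N); last by rewrite /N -addnA leq_addr.
  exact: (@leq_bigmax_cond _ xpredT (fun i : 'I_m => `|f i|%N) (Ordinal am)).
have gN b : (b < n)%N -> (`|g b| <= N)%N.
  move=> bn; apply: leq_trans (_ : (\max_(b < n) `|g b| <= _)%N).
    exact: (@leq_bigmax_cond _ xpredT (fun i : 'I_n => `|g i|%N) (Ordinal bn)).
  by rewrite /N addnAC addnC leq_addr.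
have eN b c : (b < n)%N -> (c < p)%N -> (`|e b c| <= N)%N.
  move=> bn cp; apply: leq_trans (_ : (\max_(c < p) `|e b c| <= _)%N).
    exact: (@leq_bigmax_cond _ xpredT (fun i : 'I_p => `|e b i|%N) (Ordinal cp)).
  apply: leq_trans (_ : (\max_(b < n) \max_(c < p) `|e b c| <= _)%N); last by rewrite leq_addl.
  exact: (@leq_bigmax_cond _ xpredT (fun i : 'I_n => \max_(c < p) `|e i c|%N) (Ordinal bn)).
apply: le_trans (kB N).
have w1 h1 h2 h3 : `|k h1 h2 h3| <= (1 + `|h1%:~R| + `|h2%:~R| + `|h3%:~R|) * `|k h1 h2 h3|.
  by rewrite ler_peMl// -!addrA lerDl !addr_ge0.
apply: le_trans (_ : sumZ N (fun h1 => sumZ N (fun h2 => sumZ N (fun h3 => `|k h1 h2 h3|))) <= _); last first.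
  by do 3 (apply: le_sumZ => ?); exact: w1.
apply: le_trans (sum_le_sumZ (fun h1 => sumZ N (fun h2 => sumZ N (fun h3 => `|k h1 h2 h3|))) f m N _ _ fN); last 2 first.
- by move=> h; do 2 (apply: sumZ_ge0 => ?).
- by move=> ? ? _ _; exact: finj.
apply: ler_sum => a _.
apply: le_trans (sum_le_sumZ (fun h2 => sumZ N (fun h3 => `|k (f a) h2 h3|)) g n N _ _ gN); last 2 first.
- by move=> h; apply: sumZ_ge0 => ?.
- by move=> ? ? _ _; exact: ginj.
apply: ler_sum => b _.
apply: (sum_le_sumZ (fun h3 => `|k (f a) (g b) h3|) (e b) p N) => //.
- by move=> ? ? _ _; exact: einj.
- by move=> c; apply: eN.
Qed.

End IntegerSums.

Section Innovations.
Context {d : measure_display} {T : measurableType d} {R : realType}.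
Variables (P : probability T R) (U : int -> T -> R) (gam : int -> R).
Hypothesis zms : zero_mean_weakly_stationary P U gam.

Let L1 (f : T -> R) := P.-integrable setT (EFin \o f).

Lemma innov_measurable t : measurable_fun setT (U t).
Proof. by case: zms. Qed.
Hint Resolve innov_measurable : core.

Lemma innov_L4 t : L1 (fun w => U t w ^+ 4).
Proof. by case: zms => _ [H _]; exact: H. Qed.

Lemma innov_L2 t : L1 (fun w => U t w ^+ 2).
Proof.
apply: (rintegrable_le P setT measurableT _ (fun w => 1 + U t w ^+ 4)).
- exact: measurable_funX.
- move=> w _; rewrite ger0_norm ?sqr_ge0//.
  have -> : U t w ^+ 4 = (U t w ^+ 2) ^+ 2 by rewrite -exprM.
  by have := sqr_ge0 (U t w ^+ 2 - 1/2); rewrite !expr2; lra.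
- by apply: rintegrableD => //; [exact: rintegrable_cst|exact: innov_L4].
Qed.

Lemma innov_prod_L1 s t : L1 (fun w => U s w * U t w).
Proof. by apply: rintegrable_mul => //; exact: innov_L2. Qed.

Lemma innov_prod_L2 s t : L1 (fun w => (U s w * U t w) ^+ 2).
Proof.
have h : L1 (fun w => U s w ^+ 2 * U t w ^+ 2).
  apply: rintegrable_mul; try exact: measurable_funX.
  - by have := innov_L4 s; apply: eq_integrable => // w _ /=; rewrite -exprM.
  - by have := innov_L4 t; apply: eq_integrable => // w _ /=; rewrite -exprM.
by apply: eq_integrable h => // w _ /=; rewrite exprMn.
Qed.

Lemma innov_L1 t : L1 (U t).
Proof.
apply: (rintegrable_le P setT measurableT _ (fun w => 1 + U t w ^+ 2)) => //.
- move=> w _; have := sqr_ge0 (`|U t w| - 1); rewrite sqrrB real_normK ?num_real//.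
  have := normr_ge0 (U t w); rewrite expr1n mulr1 -mulr_natr; have := sqr_ge0 (U t w); lra.
- by apply: rintegrableD => //; [exact: rintegrable_cst|exact: innov_L2].
Qed.

Lemma innov_prod4_L1 a b c e : L1 (fun w => U a w * U b w * U c w * U e w).
Proof.
have h : L1 (fun w => (U a w * U b w) * (U c w * U e w)).
  by apply: rintegrable_mul; [exact: measurable_funM|exact: measurable_funM|exact: innov_prod_L2|exact: innov_prod_L2].
by apply: eq_integrable h => // w _ /=; rewrite mulrA.
Qed.

Lemma innov_mean t : Ex P (U t) = 0.
Proof. by case: zms => _ [_ []]. Qed.

Lemma innov_cov s t : Ex P (fun w => U s w * U t w) = gam (t - s).
Proof.
case: zms => _ [_ [_ /(_ s (t - s))]]; rewrite /cov !innov_mean mul0r subr0 => <-.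
by congr Ex; apply/funext => w; congr (_ * U _ _); ring.
Qed.

Lemma gamN h : gam (- h) = gam h.
Proof.
rewrite -[h in RHS]subr0 -innov_cov -[- h]sub0r -innov_cov.
by apply: eq_Ex => w; rewrite mulrC.
Qed.

Hypothesis fos : fourth_order_stationary P U.

(** Moment-cumulant formula for centred variables: the cumulant, shifted to time 0 by stationarity,
    plus the three pairings. *)
Lemma innov_prod4 a b c e : Ex P (fun w => U a w * U b w * U c w * U e w) =
  cum4 P (U 0) (U (b - a)) (U (c - a)) (U (e - a))
  + gam (b - a) * gam (e - c) + gam (c - a) * gam (e - b) + gam (e - a) * gam (c - b).
Proof.
rewrite -(fos a) (_ : a + (b - a) = b); last ring.
rewrite (_ : a + (c - a) = c); last ring.
rewrite (_ : a + (e - a) = e); last ring.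
by rewrite /cum4 !innov_mean !innov_cov; ring.
Qed.

Lemma Ex_prod_sum (I J : finType) (c : I -> R) (e : J -> R) (V : I -> T -> R) (W : J -> T -> R) :
  (forall p q, L1 (fun w => V p w * W q w)) ->
  L1 (fun w => (\sum_p c p * V p w) * (\sum_q e q * W q w)) /\
  Ex P (fun w => (\sum_p c p * V p w) * (\sum_q e q * W q w)) =
  \sum_p \sum_q c p * e q * Ex P (fun w => V p w * W q w).
Proof.
move=> IV.
have E w : (\sum_p c p * V p w) * (\sum_q e q * W q w) = \sum_p \sum_q c p * e q * (V p w * W q w).
  rewrite mulr_suml; apply: eq_bigr => p _; rewrite mulr_sumr.
  by apply: eq_bigr => q _; ring.
have I2 p q : L1 (fun w => c p * e q * (V p w * W q w)).
  by apply: rintegrableZ => //; exact: IV.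
have I1 p : L1 (fun w => \sum_q c p * e q * (V p w * W q w)).
  by apply: rintegrable_sum => // q; exact: I2.
split.
  have : L1 (fun w => \sum_p \sum_q c p * e q * (V p w * W q w)).
    by apply: rintegrable_sum => // p; exact: I1.
  by apply: eq_integrable => // w _ /=; rewrite E.
rewrite (eq_Ex _ _ _ E) Ex_sum//; apply: eq_bigr => p _.
rewrite Ex_sum; last exact: I2.
by apply: eq_bigr => q _; rewrite ExZ//; exact: IV.
Qed.

End Innovations.

(** * Moments of the truncated filter, uniformly in the truncation *)

Section TruncatedMoments.
Context {d : measure_display} {T : measurableType d} {R : realType}.
Variables (P : probability T R) (U : int -> T -> R) (gam : int -> R).
Hypotheses (zms : zero_mean_weakly_stationary P U gam) (fos : fourth_order_stationary P U).
Variables (l0 delta Gam Kap : R).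
Hypotheses (s0 : 0 < sin l0) (d01 : 0 < delta < 1).
Hypothesis Gam_ge : forall m (f : nat -> int), {in gtn m &, injective f} ->
  \sum_(i < m) `|gam (f i)| <= Gam.
Hypothesis Kap_ge : forall m n p (f g : nat -> int) (e : nat -> nat -> int),
  injective f -> injective g -> (forall b, injective (e b)) ->
  \sum_(a < m) \sum_(b < n) \sum_(c < p) `|cum4 P (U 0) (U (f a)) (U (g b)) (U (e b c))| <= Kap.

Let L1 (f : T -> R) := P.-integrable setT (EFin \o f).
Let b := bcoef l0 delta.
Let s := sin l0.

Definition Xtrunc m (t : int) w : R := \sum_(0 <= j < m) bcoef l0 delta j * U (t - j%:Z) w.

Let XtruncE m t w : Xtrunc m t w = \sum_(j < m) b j * U (t - j%:Z) w.
Proof. by rewrite /Xtrunc big_mkord. Qed.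

Let bs j : `|b j| <= s^-1.
Proof.
apply: le_trans (norm_bcoef_le _ _ j s0 d01) _.
have := d01 => /andP[d0 d1]; rewrite ler_piMr ?invr_ge0 ?(ltW s0)//.
by rewrite exprn_ile1 ?subr_ge0 ?(ltW d1)// gerBl ltW.
Qed.

Let sumb m : \sum_(j < m) `|b j| <= s^-1 * delta^-1.
Proof. exact: sum_norm_bcoef_le. Qed.

Let Gam0 : 0 <= Gam.
Proof.
have := Gam_ge 0 Posz; rewrite big_ord0; apply.
by move=> ? ? _ _ [].
Qed.

Let si0 : 0 <= s^-1. Proof. by rewrite invr_ge0 ltW. Qed.

Lemma measurable_Xtrunc m t : measurable_fun setT (Xtrunc m t).
Proof.
rewrite /Xtrunc; apply: measurable_sum => j; apply: measurable_funM => //.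
exact: innov_measurable zms _.
Qed.

Lemma Xtrunc_prod m s1 t1 : L1 (fun w => Xtrunc m s1 w * Xtrunc m t1 w) /\
  Ex P (fun w => Xtrunc m s1 w * Xtrunc m t1 w) =
  \sum_(i < m) \sum_(j < m) b i * b j * gam (t1 - s1 - j%:Z + i%:Z).
Proof.
have [I E] := Ex_prod_sum P 'I_m 'I_m b b (fun j => U (s1 - j%:Z)) (fun j => U (t1 - j%:Z))
   (fun i j => innov_prod_L1 P U gam zms _ _).
split; first by apply: eq_integrable I => // w _ /=; rewrite !XtruncE.
transitivity (\sum_(p < m) \sum_(q < m) b p * b q * Ex P (fun w => U (s1 - p%:Z) w * U (t1 - q%:Z) w)).
  by rewrite -E; apply: eq_Ex => w; rewrite !XtruncE.
apply: eq_bigr => i _; apply: eq_bigr => j _.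
by rewrite (innov_cov _ _ _ zms); congr (_ * gam _); ring.
Qed.

(** One filter sum is paid by the l1 norm; in the other the coefficients are bounded and the
    covariances summed. *)
Lemma Xtrunc_sqr_le m t : Ex P (fun w => Xtrunc m t w ^+ 2) <= s^-1 * delta^-1 * (s^-1 * Gam).
Proof.
rewrite (eq_Ex _ _ _ (fun w => expr2 (Xtrunc m t w))) (Xtrunc_prod m t t).2.
apply: le_trans (ler_norm _) _; apply: le_trans (ler_norm_sum _ _ _) _.
apply: le_trans (_ : \sum_(i < m) `|b i| * (s^-1 * Gam) <= _); last first.
  by rewrite -mulr_suml ler_wpM2r// mulr_ge0.
apply: ler_sum => i _; apply: le_trans (ler_norm_sum _ _ _) _.
apply: le_trans (_ : \sum_(j < m) `|b i| * (s^-1 * `|gam (t - t - j%:Z + i%:Z)|) <= _).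
  by apply: ler_sum => j _; rewrite !normrM -mulrA ler_wpM2l// ler_wpM2r.
rewrite -mulr_sumr ler_wpM2l// -mulr_sumr ler_wpM2l//.
by apply: (Gam_ge m (fun j => t - t - j%:Z + i%:Z)) => j j' _ _; lia.
Qed.

Lemma innov_Xtrunc m t k : L1 (fun w => U t w * Xtrunc m (t - k%:Z) w) /\
  Ex P (fun w => U t w * Xtrunc m (t - k%:Z) w) = \sum_(j < m) b j * gam (k%:Z + j%:Z).
Proof.
have [I E] := Ex_prod_sum P 'I_1 'I_m (fun=> 1) b (fun=> U t) (fun j => U (t - k%:Z - j%:Z))
   (fun i j => innov_prod_L1 P U gam zms _ _).
split; first by apply: eq_integrable I => // w _ /=; rewrite !XtruncE big_ord1 mul1r.
transitivity (\sum_(p < 1) \sum_(j < m) 1 * b j * Ex P (fun w => U t w * U (t - k%:Z - j%:Z) w)).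
  by rewrite -E; apply: eq_Ex => w; rewrite !XtruncE big_ord1 mul1r.
rewrite big_ord1; apply: eq_bigr => j _; rewrite mul1r (innov_cov _ _ _ zms).
by rewrite -(gamN _ _ _ zms); congr (_ * gam _); ring.
Qed.

Lemma innov_Xtrunc_le m k : `|\sum_(j < m) b j * gam (k%:Z + j%:Z)| <= s^-1 * Gam.
Proof.
apply: le_trans (ler_norm_sum _ _ _) _.
apply: le_trans (_ : \sum_(j < m) s^-1 * `|gam (k%:Z + j%:Z)| <= _).
  by apply: ler_sum => j _; rewrite normrM ler_wpM2r.
rewrite -mulr_sumr ler_wpM2l//.
by apply: (Gam_ge m (fun j => k%:Z + j%:Z)) => j j' _ _; lia.
Qed.

Lemma innov_sum_sqr (sg : R) n : sg = 1 \/ sg = -1 ->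
  L1 (fun w => (\sum_(i < n) sg ^+ i * U i.+1%:Z w) ^+ 2) /\
  Ex P (fun w => (\sum_(i < n) sg ^+ i * U i.+1%:Z w) ^+ 2) <= n%:R * Gam.
Proof.
move=> sg1.
have [I E] := Ex_prod_sum P 'I_n 'I_n (fun i => sg ^+ i) (fun i => sg ^+ i)
   (fun i => U i.+1%:Z) (fun i => U i.+1%:Z) (fun i j => innov_prod_L1 P U gam zms _ _).
rewrite (eq_Ex _ _ _ (fun w => expr2 _)) E; split.
  by apply: eq_integrable I => // w _ /=; rewrite expr2.
have sgn k : `|sg ^+ k| = 1.
  by rewrite normrX; case: sg1 => ->; rewrite ?normrN normr1 expr1n.
apply: le_trans (ler_norm _) _; apply: le_trans (ler_norm_sum _ _ _) _.
apply: le_trans (_ : \sum_(i < n) Gam <= _); last by rewrite sumr_const card_ord mulr_natl.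
apply: ler_sum => i _; apply: le_trans (ler_norm_sum _ _ _) _.
apply: le_trans (_ : \sum_(j < n) `|gam (j.+1%:Z - i.+1%:Z)| <= _).
  by apply: ler_sum => j _; rewrite !normrM !sgn !mul1r (innov_cov _ _ _ zms).
by apply: (Gam_ge n (fun j => j.+1%:Z - i.+1%:Z)) => j j' _ _ /addIr[].
Qed.

(** Centred products: for the truncated filter, [G_k - g_k] is the average over [t] of the sums of
    [b j * W k t j]. *)
Let W k (t : int) (j : nat) w := U t w * U (t - k%:Z - j%:Z) w - gam (k%:Z + j%:Z).

Let WW_L1 k t j t' j' : L1 (fun w => W k t j w * W k t' j' w).
Proof.
have h : L1 (fun w => U t w * U (t - k%:Z - j%:Z) w * U t' w * U (t' - k%:Z - j'%:Z) w
  - gam (k%:Z + j'%:Z) * (U t w * U (t - k%:Z - j%:Z) w)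
  - gam (k%:Z + j%:Z) * (U t' w * U (t' - k%:Z - j'%:Z) w) + gam (k%:Z + j%:Z) * gam (k%:Z + j'%:Z)).
  apply: rintegrableD => //; last exact: rintegrable_cst.
  apply: rintegrableB => //; last by apply: rintegrableZ => //; exact: innov_prod_L1 zms _ _.
  apply: rintegrableB => //; last by apply: rintegrableZ => //; exact: innov_prod_L1 zms _ _.
  exact: innov_prod4_L1 zms _ _ _ _.
by apply: eq_integrable h => // w _ /=; rewrite /W; congr EFin; ring.
Qed.

(** Centring removes the pairing within each product; the cumulant and the two cross pairings
    remain. *)
Let WW k t j t' j' : Ex P (fun w => W k t j w * W k t' j' w) =
  cum4 P (U 0) (U (t - k%:Z - j%:Z - t)) (U (t' - t)) (U (t' - k%:Z - j'%:Z - t))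
  + gam (t' - t) * gam (t' - k%:Z - j'%:Z - (t - k%:Z - j%:Z))
  + gam (t' - k%:Z - j'%:Z - t) * gam (t' - (t - k%:Z - j%:Z)).
Proof.
have I1 := innov_prod_L1 _ _ _ zms; have I4 := innov_prod4_L1 _ _ _ zms.
have cvk (r : int) (i : nat) : Ex P (fun w => U r w * U (r - k%:Z - i%:Z) w) = gam (k%:Z + i%:Z).
  by rewrite (innov_cov _ _ _ zms) -(gamN _ _ _ zms); congr gam; ring.
pose A := gam (k%:Z + j%:Z); pose A' := gam (k%:Z + j'%:Z).
transitivity (Ex P (fun w => U t w * U (t - k%:Z - j%:Z) w * U t' w * U (t' - k%:Z - j'%:Z) w
  - A' * (U t w * U (t - k%:Z - j%:Z) w)
  - A * (U t' w * U (t' - k%:Z - j'%:Z) w) + A * A')).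
  by apply: eq_Ex => w; rewrite /W /A /A'; ring.
have IA : L1 (fun w => A' * (U t w * U (t - k%:Z - j%:Z) w)) by apply: rintegrableZ => //; exact: I1.
have IA' : L1 (fun w => A * (U t' w * U (t' - k%:Z - j'%:Z) w)) by apply: rintegrableZ => //; exact: I1.
have IB : L1 (fun w => U t w * U (t - k%:Z - j%:Z) w * U t' w * U (t' - k%:Z - j'%:Z) w
  - A' * (U t w * U (t - k%:Z - j%:Z) w)) by apply: rintegrableB => //; exact: I4.
rewrite ExD; [|by apply: rintegrableB|exact: rintegrable_cst].
rewrite (ExB P _ _ IB IA') (ExB P _ _ (I4 _ _ _ _) IA).
rewrite (ExZ P _ _ (I1 _ _)) (ExZ P _ _ (I1 _ _)) Ex_cst.
rewrite !cvk (innov_prod4 _ _ _ zms fos).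
have -> : t - k%:Z - j%:Z - t = - (k%:Z + j%:Z) by ring.
have -> : t' - k%:Z - j'%:Z - t' = - (k%:Z + j'%:Z) by ring.
by rewrite ![gam (- (k%:Z + _))](gamN _ _ _ zms) /A /A'; ring.
Qed.

(** The cumulant part is summable over all three indices, so both coefficients are merely bounded.
    In each pairing the two covariances absorb the sums over [i] and [j'], and only the sum over [j]
    costs [1 / delta]. *)
Let row_sum k (t : int) m n :
  \sum_(j < m) \sum_(i < n) \sum_(j' < m)
    `|b j * b j' * Ex P (fun w => W k t j w * W k i.+1%:Z j' w)| <=
  s^-1 * s^-1 * Kap + 2 * (s^-1 * delta^-1 * (s^-1 * (Gam * Gam))).
Proof.
pose k4 (j i j' : nat) := `|cum4 P (U 0) (U (t - k%:Z - j%:Z - t)) (U (i.+1%:Z - t)) (U (i.+1%:Z - k%:Z - j'%:Z - t))|.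
pose gA (j i j' : nat) := `|gam (i.+1%:Z - k%:Z - j'%:Z - (t - k%:Z - j%:Z))|.
pose gT (i : nat) := `|gam (i.+1%:Z - t)|.
pose gB (i j' : nat) := `|gam (i.+1%:Z - k%:Z - j'%:Z - t)|.
pose gD (j i : nat) := `|gam (i.+1%:Z - (t - k%:Z - j%:Z))|.
apply: le_trans (_ : \sum_(j < m) \sum_(i < n) \sum_(j' < m)
   (s^-1 * s^-1 * k4 j i j' + (`|b j| * (s^-1 * (gT i * gA j i j')) + `|b j| * (s^-1 * (gD j i * gB i j')))) <= _).
  apply: ler_sum => j _; apply: ler_sum => i _; apply: ler_sum => j' _.
  rewrite WW normrM [`|b j * b j'|]normrM -addrA.
  apply: le_trans (ler_wpM2l _ (ler_normD _ _)) _; first by rewrite mulr_ge0.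
  rewrite mulrDr lerD//; first by rewrite ler_wpM2r// ler_pM.
  apply: le_trans (ler_wpM2l _ (ler_normD _ _)) _; first by rewrite mulr_ge0.
  rewrite mulrDr !normrM lerD//.
    by rewrite -mulrA ler_wpM2l// ler_wpM2r ?mulr_ge0.
  rewrite -mulrA ler_wpM2l// [X in _ * X]mulrC ler_wpM2r ?mulr_ge0//.
under eq_bigr do under eq_bigr do rewrite big_split.
under eq_bigr do rewrite big_split.
rewrite big_split lerD//.
  under eq_bigr do under eq_bigr do rewrite -mulr_sumr.
  under eq_bigr do rewrite -mulr_sumr.
  rewrite -mulr_sumr ler_wpM2l ?mulr_ge0//.
  apply: (Kap_ge m n m (fun j => t - k%:Z - j%:Z - t) (fun i => i.+1%:Z - t)
    (fun i j' => i.+1%:Z - k%:Z - j'%:Z - t)) => [j j'|i i'|i j j']; lia.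
under eq_bigr do under eq_bigr do rewrite big_split.
under eq_bigr do rewrite big_split.
have rowle (F : nat -> nat -> R) : (forall j, \sum_(i < n) F j i <= Gam * Gam) ->
  \sum_(j < m) \sum_(i < n) `|b j| * (s^-1 * F j i) <= s^-1 * delta^-1 * (s^-1 * (Gam * Gam)).
  move=> FG; under eq_bigr do rewrite -mulr_sumr -mulr_sumr.
  apply: le_trans (_ : \sum_(j < m) `|b j| * (s^-1 * (Gam * Gam)) <= _).
    by apply: ler_sum => j _; rewrite ler_wpM2l// ler_wpM2l.
  by rewrite -mulr_suml ler_wpM2r// !mulr_ge0.
rewrite big_split mulr_natl mulr2n lerD//.
- under eq_bigr do under eq_bigr do rewrite -mulr_sumr -mulr_sumr.
  apply: (rowle (fun j i => \sum_(j' < m) gT i * gA j i j')) => j.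
  under eq_bigr do rewrite -mulr_sumr.
  apply: le_trans (_ : \sum_(i < n) gT i * Gam <= _).
    apply: ler_sum => i _; rewrite ler_wpM2l// ?normr_ge0//.
    by apply: (Gam_ge m (fun j' => i.+1%:Z - k%:Z - j'%:Z - (t - k%:Z - j%:Z))) => a c _ _; lia.
  rewrite -mulr_suml ler_wpM2r//.
  by apply: (Gam_ge n (fun i => i.+1%:Z - t)) => a c _ _; lia.
- under eq_bigr do under eq_bigr do rewrite -mulr_sumr -mulr_sumr.
  apply: (rowle (fun j i => \sum_(j' < m) gD j i * gB i j')) => j.
  under eq_bigr do rewrite -mulr_sumr.
  apply: le_trans (_ : \sum_(i < n) gD j i * Gam <= _).
    apply: ler_sum => i _; rewrite ler_wpM2l// ?normr_ge0//.
    by apply: (Gam_ge m (fun j' => i.+1%:Z - k%:Z - j'%:Z - t)) => a c _ _; lia.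
  rewrite -mulr_suml ler_wpM2r//.
  by apply: (Gam_ge n (fun i => i.+1%:Z - (t - k%:Z - j%:Z))) => a c _ _; lia.
Qed.

Lemma lagsum_variance m n k : (0 < n)%N ->
  let Y w := n%:R^-1 * lagsum (fun t => U t w) (fun t => Xtrunc m t w) n k
     - \sum_(j < m) b j * gam (k%:Z + j%:Z) in
  L1 (fun w => Y w ^+ 2) /\
  Ex P (fun w => Y w ^+ 2) <=
    n%:R^-1 * (s^-1 * s^-1 * Kap + 2 * (s^-1 * delta^-1 * (s^-1 * (Gam * Gam)))).
Proof.
move=> n0 Y; set nu := n%:R^-1.
have nR : n%:R != 0 :> R by rewrite pnatr_eq0 -lt0n.
have YE w : Y w = \sum_(p : 'I_n * 'I_m) (nu * b p.2) * W k p.1.+1%:Z p.2 w.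
  rewrite -(pair_bigA _ (fun (i : 'I_n) (j : 'I_m) => nu * b j * W k i.+1%:Z j w)) /=.
  rewrite /Y; have -> : \sum_(j < m) b j * gam (k%:Z + j%:Z) = \sum_(i < n) \sum_(j < m) nu * (b j * gam (k%:Z + j%:Z)).
    by rewrite sumr_const card_ord -[RHS]mulr_natl -mulr_sumr mulrA mulfV// mul1r.
  rewrite /lagsum mulr_sumr -sumrB; apply: eq_bigr => i _.
  rewrite XtruncE !mulr_sumr -sumrB; apply: eq_bigr => j _.
  by rewrite -/nu /W; move: nu => v; ring.
have [I E] := Ex_prod_sum P ('I_n * 'I_m)%type ('I_n * 'I_m)%type (fun p => nu * b p.2) (fun p => nu * b p.2)
   (fun p => W k p.1.+1%:Z p.2) (fun p => W k p.1.+1%:Z p.2) (fun p q => WW_L1 _ _ _ _ _).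
split; first by apply: eq_integrable I => // w _ /=; rewrite YE expr2.
have -> : Ex P (fun w => Y w ^+ 2) = \sum_(p : 'I_n * 'I_m) \sum_(q : 'I_n * 'I_m) nu * b p.2 * (nu * b q.2) *
   Ex P (fun w => W k p.1.+1%:Z p.2 w * W k q.1.+1%:Z q.2 w).
  by rewrite -E; apply: eq_Ex => w; rewrite YE expr2.
set K := (X in _ * X).
rewrite -(pair_bigA _ (fun (i : 'I_n) (j : 'I_m) => \sum_(q : 'I_n * 'I_m) nu * b j * (nu * b q.2) *
   Ex P (fun w => W k i.+1%:Z j w * W k q.1.+1%:Z q.2 w))) /=.
apply: le_trans (_ : \sum_(i < n) nu * nu * K <= _); last first.
  by rewrite sumr_const card_ord -mulr_natl !mulrA mulfV// mul1r.
apply: ler_sum => i _.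
apply: le_trans (ler_wpM2l _ (row_sum k i.+1%:Z m n)); last by rewrite mulr_ge0// invr_ge0.
rewrite mulr_sumr; apply: ler_sum => j _.
rewrite -(pair_bigA _ (fun (i' : 'I_n) (j' : 'I_m) => nu * b j * (nu * b j') *
   Ex P (fun w => W k i.+1%:Z j w * W k i'.+1%:Z j' w))) /= mulr_sumr.
apply: ler_sum => i' _; rewrite mulr_sumr; apply: ler_sum => j' _.
have -> : nu * b j * (nu * b j') = nu * nu * (b j * b j') by ring.
by rewrite -mulrA ler_wpM2l ?mulr_ge0 ?invr_ge0// ler_norm.
Qed.

End TruncatedMoments.

(** Used with weights [|b_j|] to dominate the squared filter output by a series in [U^2]. *)
Lemma weighted_cauchy_schwarz {R : realType} (a x : nat -> R) m : (forall i, 0 <= a i) ->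
  (\sum_(i < m) a i * x i) ^+ 2 <= (\sum_(i < m) a i) * \sum_(i < m) a i * x i ^+ 2.
Proof.
move=> a0; elim: m => [|m IH]; first by rewrite !big_ord0 mul0r expr0n.
rewrite !big_ord_recr /=; set A := \sum_(i < m) a i in IH *.
set S := \sum_(i < m) a i * x i in IH *; set Q := \sum_(i < m) a i * x i ^+ 2 in IH *.
have A0 : 0 <= A by apply: sumr_ge0.
have Q0 : 0 <= Q by apply: sumr_ge0 => i _; rewrite mulr_ge0 ?sqr_ge0.
suff h : 0 <= A * x m ^+ 2 - 2 * S * x m + Q.
  rewrite -subr_ge0; have -> : (A + a m) * (Q + a m * x m ^+ 2) - (S + a m * x m) ^+ 2 =
     (A * Q - S ^+ 2) + a m * (A * x m ^+ 2 - 2 * S * x m + Q) by ring.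
  by rewrite addr_ge0 ?subr_ge0// mulr_ge0.
move: A0; rewrite le_eqVlt => /predU1P[A0|A0].
  move: IH; rewrite -A0 !mul0r => S2.
  have -> : S = 0 by apply/eqP; rewrite -sqrf_eq0 eq_le S2 sqr_ge0.
  by rewrite mulr0 mul0r subr0 add0r.
rewrite -(pmulr_rge0 _ A0).
have -> : A * (A * x m ^+ 2 - 2 * S * x m + Q) = (A * x m - S) ^+ 2 + (A * Q - S ^+ 2) by ring.
by rewrite addr_ge0 ?sqr_ge0// subr_ge0.
Qed.

(** * The filtered process *)

Section LimitProcess.
Context {d : measure_display} {T : measurableType d} {R : realType}.
Variables (P : probability T R) (U : int -> T -> R) (gam : int -> R).
Hypotheses (zms : zero_mean_weakly_stationary P U gam) (fos : fourth_order_stationary P U).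
Variables (l0 delta Gam Kap : R).
Hypotheses (s0 : 0 < sin l0) (d01 : 0 < delta < 1).
Hypothesis Gam_ge : forall m (f : nat -> int), {in gtn m &, injective f} ->
  \sum_(i < m) `|gam (f i)| <= Gam.
Hypothesis Kap_ge : forall m n p (f g : nat -> int) (e : nat -> nat -> int),
  injective f -> injective g -> (forall b, injective (e b)) ->
  \sum_(a < m) \sum_(b < n) \sum_(c < p) `|cum4 P (U 0) (U (f a)) (U (g b)) (U (e b c))| <= Kap.

Let L1 (f : T -> R) := P.-integrable setT (EFin \o f).
Let b := bcoef l0 delta.
Let s := sin l0.
Let r := 1 - delta.
Let X := Xproc U l0 delta.
Let Xm := Xtrunc U l0 delta.

Let mU t : measurable_fun setT (U t). Proof. exact: innov_measurable zms t. Qed.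
Let mXm m t : measurable_fun setT (Xm m t). Proof. exact: measurable_Xtrunc zms _ _ _ _. Qed.

Lemma measurable_Xproc t : measurable_fun setT (X t).
Proof. by apply: (measurable_limn (fun m => Xm m t)). Qed.

Let r01 : 0 < r < 1. Proof. by move: d01; rewrite /r => /andP[? ?]; apply/andP; split; lra. Qed.
Let r0 j : 0 <= r ^+ j. Proof. by rewrite exprn_ge0// ltW//; case/andP: r01. Qed.
Let si0 : 0 <= s^-1. Proof. by rewrite invr_ge0 ltW. Qed.
Let di0 : 0 <= delta^-1. Proof. by case/andP: d01 => /ltW; rewrite invr_ge0. Qed.
Let br j : `|b j| <= s^-1 * r ^+ j. Proof. exact: norm_bcoef_le. Qed.

(** The functions [r^j (1 + U^2)] have summable expectations. They dominate [|b_j U|] up to a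
    constant and, through the weighted Cauchy-Schwarz inequality, the squares of the partial
    sums. *)
Let Xtrunc_dominated t : exists g, L1 g /\ {ae P, forall w, forall m,
  [/\ \sum_(j < m) `|b j * U (t - j%:Z) w| <= g w & Xm m t w ^+ 2 <= g w]}.
Proof.
pose F j w := r ^+ j * (1 + U (t - j%:Z) w ^+ 2).
have IU j : L1 (fun w => 1 + U (t - j%:Z) w ^+ 2).
  by apply: rintegrableD => //; [exact: rintegrable_cst|exact: innov_L2 zms _].
have EU j : Ex P (F j) = r ^+ j * (1 + gam 0).
  rewrite /F ExZ; last exact: IU.
  have -> : Ex P (fun w => 1 + U (t - j%:Z) w ^+ 2) = Ex P (fun=> 1) + Ex P (fun w => U (t - j%:Z) w ^+ 2).
    by apply: ExD; [exact: rintegrable_cst|exact: innov_L2 zms _].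
  rewrite Ex_cst.
  by rewrite (eq_Ex _ _ _ (fun w => expr2 _)) (innov_cov _ _ _ zms) subrr.
have g00 : 0 <= gam 0.
  have := innov_cov _ _ _ zms 0 0; rewrite subrr => <-; apply: Ex_ge0 => w.
  by rewrite -expr2 sqr_ge0.
have [| | | |g [Ig Hg]] := @series_dominated _ _ _ P F (delta^-1 * (1 + gam 0)).
- move=> j; apply: measurable_funM => //; apply: measurable_funD => //.
  exact: measurable_funX.
- by move=> j w; rewrite mulr_ge0// addr_ge0// sqr_ge0.
- by move=> j; apply: rintegrableZ => //; exact: IU.
- move=> m; under eq_bigr do rewrite EU.
  rewrite -mulr_suml ler_wpM2r ?addr_ge0//.
  have [r0' r1'] := andP r01.
  by apply: le_trans (sum_geo_le r m _) _; rewrite ?(ltW r0') ?r1'// /r opprB addrC subrK.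
exists (fun w => (s^-1 + s^-1 * delta^-1 * s^-1) * g w); split; first by apply: rintegrableZ => //; exact: Ig.
apply: filterS Hg => w Hg m.
have g0 : 0 <= g w by apply: le_trans (Hg 0%N); rewrite big_ord0.
have h1 : \sum_(j < m) `|b j * U (t - j%:Z) w| <= s^-1 * g w.
  apply: le_trans (ler_wpM2l si0 (Hg m)); rewrite mulr_sumr; apply: ler_sum => j _.
  rewrite normrM /F mulrA ler_pM//.
  have := sqr_ge0 (`|U (t - j%:Z) w| - 1); rewrite sqrrB real_normK ?num_real// expr1n mulr1 -mulr_natr.
  by have := normr_ge0 (U (t - j%:Z) w); have := sqr_ge0 (U (t - j%:Z) w); lra.
split.
  by apply: le_trans h1 _; rewrite mulrDl lerDl !mulr_ge0.
have h2 : Xm m t w ^+ 2 <= (\sum_(j < m) `|b j| * `|U (t - j%:Z) w|) ^+ 2.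
  have h0 : 0 <= \sum_(j < m) `|b j| * `|U (t - j%:Z) w|.
    by apply: sumr_ge0 => j _; rewrite mulr_ge0.
  rewrite -real_normK ?num_real// lerXn2r ?nnegrE//.
  rewrite /Xm /Xtrunc big_mkord; apply: le_trans (ler_norm_sum _ _ _) _.
  by apply: ler_sum => j _; rewrite normrM.
apply: le_trans h2 _; apply: le_trans (weighted_cauchy_schwarz (fun j => `|b j|) (fun j => `|U (t - j%:Z) w|) m (fun j => normr_ge0 _)) _.
rewrite mulrDl; apply: le_trans (_ : s^-1 * delta^-1 * (s^-1 * g w) <= _); last first.
  by rewrite mulrA lerDr mulr_ge0.
apply: ler_pM; [exact: sumr_ge0|by apply: sumr_ge0 => j _; rewrite mulr_ge0 ?sqr_ge0|exact: sum_norm_bcoef_le|].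
apply: le_trans (ler_wpM2l si0 (Hg m)); rewrite mulr_sumr; apply: ler_sum => j _.
rewrite real_normK ?num_real// /F [leRHS]mulrA; apply: ler_pM => //; first exact: sqr_ge0.
by rewrite lerDr.
Qed.

Let cvg_ae t : {ae P, forall w, Xm ^~ t ^~ w @ \oo --> X t w}.
Proof.
have [g [_ Hg]] := Xtrunc_dominated t; apply: filterS Hg => w Hg.
have h : cvgn (series (fun j => b j * U (t - j%:Z) w)).
  apply: normed_cvg; apply: nondecreasing_is_cvgn.
    by apply/nondecreasing_seqP => n; rewrite [leRHS]seriesSr lerDl normr_ge0.
  by exists (g w) => _ [m _ <-]; rewrite /normed_series_of seriesEord; case: (Hg m).
exact: h.
Qed.

(** All times are required at once, so that off a single null set the recursion holds along the
    whole path. *)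
Definition converges w := forall t, Xtrunc U l0 delta ^~ t ^~ w @ \oo --> Xproc U l0 delta t w.

Lemma converges_ae : {ae P, forall w, converges w}.
Proof.
have H1 : {ae P, forall w, forall n : nat, Xm ^~ (Posz n) ^~ w @ \oo --> X (Posz n) w}.
  by apply: ae_foralln => n; exact: cvg_ae.
have H2 : {ae P, forall w, forall n : nat, Xm ^~ (Negz n) ^~ w @ \oo --> X (Negz n) w}.
  by apply: ae_foralln => n; exact: cvg_ae.
by apply: filterS2 H1 H2 => w H1 H2 [n|n]; [exact: H1|exact: H2].
Qed.

Lemma Xproc_rec w t : converges w ->
  X t w = 2 * r * cos l0 * X (t - 1) w - r ^+ 2 * X (t - 2) w + U t w.
Proof.
(* The recursion is exact for truncations whose orders are staggered by one at each lag. *)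
move=> cw; have e m : Xm m.+2 t w =
   2 * r * cos l0 * Xm m.+1 (t - 1) w - r ^+ 2 * Xm m (t - 2) w + U t w.
  rewrite /Xm /Xtrunc big_nat_recl// big_nat_recl// [in X in _ = X]big_nat_recl//.
  rewrite bcoef0 bcoef1 mul1r subr0.
  have -> : \sum_(0 <= i < m) bcoef l0 delta i.+2 * U (t - i.+2%:Z) w =
    2 * r * cos l0 * (\sum_(0 <= i < m) bcoef l0 delta i.+1 * U (t - 1 - i.+1%:Z) w)
    - r ^+ 2 * \sum_(0 <= i < m) bcoef l0 delta i * U (t - 2 - i%:Z) w.
    rewrite !mulr_sumr -sumrB; apply: eq_bigr => i _; rewrite bcoefSS.
    have -> : t - 1 - i.+1%:Z = t - i.+2%:Z by lia.
    have -> : t - 2 - i%:Z = t - i.+2%:Z by lia.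
    by rewrite /r; ring.
  by rewrite /r subr0; ring.
have l1 : (fun m => Xm m.+2 t w) @ \oo --> X t w.
  by have := cw t; rewrite -(cvg_shiftn 2); under eq_fun do rewrite addn2.
have l2 : (fun m => Xm m.+2 t w) @ \oo --> 2 * r * cos l0 * X (t - 1) w - r ^+ 2 * X (t - 2) w + U t w.
  under eq_fun do rewrite e.
  apply: cvgD; last exact: cvg_cst.
  apply: cvgB; apply: cvgM; try exact: cvg_cst.
    by have := cw (t - 1); rewrite -(cvg_shiftn 1); under eq_fun do rewrite addn1.
  exact: cw.
exact: (cvg_unique _ l1 l2).
Qed.

Let dominated2 t : exists g, [/\ L1 g & {ae P, forall w, forall m, Xm m t w ^+ 2 <= g w}].
Proof.
have [g [Ig Hg]] := Xtrunc_dominated t; exists g; split => //.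
by apply: filterS Hg => w Hg m; case: (Hg m).
Qed.

Let mul_le_half (x y A B : R) : x ^+ 2 <= A -> y ^+ 2 <= B -> `|x * y| <= A + B.
Proof.
move=> xA yB; rewrite normrM; have := sqr_ge0 (`|x| - `|y|).
rewrite sqrrB !real_normK ?num_real// -mulr_natr.
have := mulr_ge0 (normr_ge0 x) (normr_ge0 y); lra.
Qed.

Lemma Xproc_prod t t' : L1 (fun w => X t w * X t' w) /\
  (fun m => Ex P (fun w => Xm m t w * Xm m t' w)) @ \oo --> Ex P (fun w => X t w * X t' w).
Proof.
have [g [Ig Hg]] := dominated2 t; have [g' [Ig' Hg']] := dominated2 t'.
apply: (Ex_cvg P (fun m w => Xm m t w * Xm m t' w) _ (fun w => g w + g' w)).
- by move=> m; exact: measurable_funM.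
- by apply: measurable_funM; exact: measurable_Xproc.
- exact: rintegrableD.
- apply: filterS3 converges_ae Hg Hg' => w cw gw g'w; split.
    by apply: cvgM; exact: cw.
  by move=> m; apply: mul_le_half.
Qed.

Lemma innov_Xproc t k : L1 (fun w => U t w * X (t - k%:Z) w) /\
  (fun m => \sum_(j < m) b j * gam (k%:Z + j%:Z)) @ \oo --> Ex P (fun w => U t w * X (t - k%:Z) w).
Proof.
have [g' [Ig' Hg']] := dominated2 (t - k%:Z).
have [] := (Ex_cvg P (fun m w => U t w * Xm m (t - k%:Z) w) (fun w => U t w * X (t - k%:Z) w)
   (fun w => U t w ^+ 2 + g' w)).
- by move=> m; exact: measurable_funM.
- by apply: measurable_funM => //; exact: measurable_Xproc.
- by apply: rintegrableD => //; exact: innov_L2 zms _.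
- apply: filterS2 converges_ae Hg' => w cw g'w; split.
    by apply: cvgM; [exact: cvg_cst|exact: cw].
  by move=> m; apply: mul_le_half.
move=> I E; split => //.
suff -> : (fun m => \sum_(j < m) b j * gam (k%:Z + j%:Z)) =
  (fun m => Ex P (fun w => U t w * Xm m (t - k%:Z) w)) by [].
by apply/funext => m; rewrite (innov_Xtrunc P U gam zms l0 delta m t k).2.
Qed.

Lemma Xproc_L1 t : L1 (X t) /\ Ex P (X t) = 0.
Proof.
have [g [Ig Hg]] := dominated2 t.
have [] := (Ex_cvg P (fun m w => Xm m t w) (X t) (fun w => 1 + g w)) => //.
- exact: measurable_Xproc.
- by apply: rintegrableD => //; exact: rintegrable_cst.
- apply: filterS2 converges_ae Hg => w cw gw; split; first exact: cw.
  move=> m; have := gw m; have := sqr_ge0 (`|Xm m t w| - 1).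
  rewrite sqrrB real_normK ?num_real// expr1n mulr1 -mulr_natr.
  by have := normr_ge0 (Xm m t w); lra.
move=> I E; split => //; apply: (cvg_unique _ E); first exact: norm_hausdorff.
suff -> : (fun m => Ex P (fun w => Xm m t w)) = (fun=> 0) by exact: cvg_cst.
apply/funext => m; transitivity (Ex P (fun w => \sum_(j <- index_iota 0 m) b j * U (t - j%:Z) w)) => //.
rewrite Ex_sum => [|j]; last by apply: rintegrableZ => //; exact: innov_L1 zms _.
rewrite big1// => j _; rewrite ExZ ?(innov_mean _ _ _ zms) ?mulr0//.
exact: innov_L1 zms _.
Qed.

Lemma Xproc_stationary t t' h : Ex P (fun w => X (t + h) w * X (t' + h) w) = Ex P (fun w => X t w * X t' w).
Proof.
apply: (cvg_unique _ (Xproc_prod (t + h) (t' + h)).2); first exact: norm_hausdorff.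
suff -> : (fun m => Ex P (fun w => Xm m (t + h) w * Xm m (t' + h) w)) =
   (fun m => Ex P (fun w => Xm m t w * Xm m t' w)) by exact: (Xproc_prod t t').2.
apply/funext => m; rewrite !(Xtrunc_prod P U gam zms l0 delta m _ _).2.
apply: eq_bigr => i _; apply: eq_bigr => j _.
by rewrite (_ : t' + h - (t + h) = t' - t)//; ring.
Qed.

Let y h := Ex P (fun w => X 0 w * X h w).
(** The base time 2 is that of the recursion expressing [X 2] by [X 1], [X 0] and [U 2]. *)
Let g (k : nat) := Ex P (fun w => U 2 w * X (2 - k%:Z) w).

Lemma cov_Xproc h : cov P (X 0) (X h) = y h.
Proof. by rewrite /cov !(Xproc_L1 _).2 mul0r subr0. Qed.

Lemma rhoXE h : rhoX P U l0 delta h = y h / y 0.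
Proof. by rewrite /rhoX !cov_Xproc. Qed.

Let Ex_ae (f h : T -> R) : measurable_fun setT f -> measurable_fun setT h ->
  {ae P, forall w, f w = h w} -> Ex P f = Ex P h.
Proof.
move=> mf mh fh; rewrite !Ex_Rintegral; congr fine; apply: ae_eq_integral => //.
- exact/measurable_EFinP.
- exact/measurable_EFinP.
- by apply: filterS fh => w + _ => ->.
Qed.

Let Ex_rec (k : nat) : Ex P (fun w => X 2 w * X (2 - k%:Z) w) =
  2 * r * cos l0 * Ex P (fun w => X 1 w * X (2 - k%:Z) w)
  - r ^+ 2 * Ex P (fun w => X 0 w * X (2 - k%:Z) w) + g k.
Proof.
have mX := measurable_Xproc; set t := 2 - k%:Z.
have I1 := (Xproc_prod 1 t).1; have I0 := (Xproc_prod 0 t).1.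
have IU := (innov_Xproc 2 k).1.
have J1 : L1 (fun w => 2 * r * cos l0 * (X 1 w * X t w)) by exact: rintegrableZ.
have J0 : L1 (fun w => r ^+ 2 * (X 0 w * X t w)) by exact: rintegrableZ.
have J10 : L1 (fun w => 2 * r * cos l0 * (X 1 w * X t w) - r ^+ 2 * (X 0 w * X t w)).
  exact: rintegrableB.
rewrite -(ExZ P _ _ I1) -(ExZ P _ _ I0) -(ExB P _ _ J1 J0) /g -(ExD P _ _ J10 IU).
apply: Ex_ae.
- exact: measurable_funM.
- have [m10 mI] := (rintegrable_measurable P setT _ J10, rintegrable_measurable P setT _ IU).
  exact: measurable_funD.
- apply: filterS converges_ae => w cw.
  have := Xproc_rec w 2 cw; rewrite (_ : 2 - 1 = 1 :> int)// subrr => {1}->.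
  by rewrite -/t; ring.
Qed.

Let Exy t t' : Ex P (fun w => X t w * X t' w) = y (t' - t).
Proof. by rewrite /y -(Xproc_stationary 0 (t' - t) t) add0r subrK. Qed.

Let ExyC t t' : Ex P (fun w => X t w * X t' w) = y (t - t').
Proof. by rewrite -Exy; apply: eq_Ex => w; rewrite mulrC. Qed.

Lemma Xproc_yw0 : y 0 = 2 * r * cos l0 * y 1 - r ^+ 2 * y 2 + g 0.
Proof. by have := Ex_rec 0; rewrite subr0 !Exy !subrr. Qed.

Lemma Xproc_yw1 : y 1 = 2 * r * cos l0 * y 0 - r ^+ 2 * y 1 + g 1.
Proof. by have := Ex_rec 1; rewrite ExyC !Exy. Qed.

Lemma Xproc_yw2 : y 2 = 2 * r * cos l0 * y 1 - r ^+ 2 * y 0 + g 2.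
Proof. by have := Ex_rec 2; rewrite !ExyC. Qed.

Lemma innov_Xproc_le k : `|g k| <= s^-1 * Gam.
Proof.
have [_ H] := innov_Xproc 2 k.
have c1 : (fun m => `|\sum_(j < m) b j * gam (k%:Z + j%:Z)|) @ \oo --> `|g k| by exact: cvg_norm.
have c2 : (fun _ : nat => s^-1 * Gam) @ \oo --> s^-1 * Gam by exact: cvg_cst.
apply: (ler_cvg_to c1 c2); apply: nearW => m.
exact: innov_Xtrunc_le.
Qed.

(** By [bcoefB], truncating [g 0] two terms later than [g 2] turns [g 0 - r^2 g 2] into a Poisson
    sum exactly; the truncation error then tends to 0. *)
Lemma innov_Xproc_ge (c0 C : R) : (forall J, c0 - C * (1 - r) - C * (r ^+ J.+1 / (1 - r) ^+ 2) <=
  gam 0 + 2 * \sum_(j < J) r ^+ j.+1 * cos (j.+1%:R * l0) * gam j.+1%:Z) ->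
  c0 - C * (1 - r) <= g 0 - r ^+ 2 * g 2.
Proof.
move=> H.
have sl : sin l0 != 0 by rewrite gt_eqF.
have e m : \sum_(j < m.+2) b j * gam (0%:Z + j%:Z) - r ^+ 2 * \sum_(j < m) b j * gam (2%:Z + j%:Z) =
  gam 0 + 2 * \sum_(j < m.+1) r ^+ j.+1 * cos (j.+1%:R * l0) * gam j.+1%:Z.
  rewrite big_ord_recl big_ord_recl [in RHS]big_ord_recl /= /b bcoef0 bcoef1 !add0r mul1r expr1 mul1r.
  rewrite !mulrDr -!addrA; congr (_ + _); congr (_ + _); first by rewrite /r /bump /=; ring.
  rewrite !mulr_sumr -sumrB; apply: eq_bigr => j _.
  have -> : bump 0 (bump 0 j) = j.+2 by [].
  have -> : bump 0 j = j.+1 by [].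
  have := bcoefB l0 delta j sl; rewrite -/r => bB.
  rewrite add0r -PoszD add2n.
  transitivity ((bcoef l0 delta j.+2 - r ^+ 2 * bcoef l0 delta j) * gam j.+2%:Z); first by ring.
  by rewrite bB; ring.
have c1 : (fun m => gam 0 + 2 * \sum_(j < m.+1) r ^+ j.+1 * cos (j.+1%:R * l0) * gam j.+1%:Z) @ \oo --> g 0 - r ^+ 2 * g 2.
  under eq_fun do rewrite -e.
  apply: cvgB.
    have := (innov_Xproc 2 0).2; rewrite -(cvg_shiftn 2); under eq_fun do rewrite addn2.
    exact.
  by apply: cvgM; [exact: cvg_cst|exact: (innov_Xproc 2 2).2].
have c2 : (fun m => c0 - C * (1 - r) - C * (r ^+ m.+2 / (1 - r) ^+ 2)) @ \oo --> c0 - C * (1 - r) - C * (0 / (1 - r) ^+ 2).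
  apply: cvgB; first exact: cvg_cst.
  apply: cvgM; first exact: cvg_cst.
  apply: cvgM; last exact: cvg_cst.
  have /cvg_expr : `|r| < 1 by have := r01 => /andP[? ?]; rewrite gtr0_norm.
  by rewrite -(cvg_shiftn 2); under eq_fun do rewrite addn2.
rewrite mul0r mulr0 subr0 in c2.
by apply: (ler_cvg_to c2 c1); apply: nearW => m; exact: H.
Qed.

Lemma Xproc_tail t (a : R) : 0 < a ->
  (P [set w | (a < `|X t w|)%R] <= (s^-1 * delta^-1 * (s^-1 * Gam) / a ^+ 2)%:E)%E.
Proof.
move=> a0; apply: (fatou_chebyshev P (fun m => Xm m t)) => //.
- exact: measurable_Xproc.
- move=> m; have := (Xtrunc_prod P U gam zms l0 delta m t t).1.
  by apply: eq_integrable => // w _ /=; rewrite expr2.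
- by move=> m; exact: (Xtrunc_sqr_le P U gam zms l0 delta Gam s0 d01 Gam_ge).
Qed.

Let lagsum_cvg w n k : converges w ->
  (fun m => lagsum (fun t => U t w) (fun t => Xm m t w) n k) @ \oo --> lagsum (fun t => U t w) (fun t => X t w) n k.
Proof.
move=> cw; rewrite /lagsum; elim: n => [|n IH].
  by under eq_fun do rewrite big_ord0; rewrite big_ord0; exact: cvg_cst.
under eq_fun do rewrite big_ord_recr; rewrite big_ord_recr; apply: cvgD => //.
by apply: cvgM; [exact: cvg_cst|exact: cw].
Qed.

Lemma lagsum_tail n k (a : R) : (0 < n)%N -> 0 < a ->
  (P [set w | (a < `|n%:R^-1 * lagsum (fun t => U t w) (fun t => X t w) n k - g k|)%R] <=
   (n%:R^-1 * (s^-1 * s^-1 * Kap + 2 * (s^-1 * delta^-1 * (s^-1 * (Gam * Gam)))) / a ^+ 2)%:E)%E.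
Proof.
move=> n0 a0.
have lagE (x : int -> T -> R) w : lagsum (fun t => U t w) (fun t => x t w) n k =
  \sum_(i < n) U i.+1%:Z w * x (i.+1%:Z - k%:Z) w by [].
have ml (x : int -> T -> R) : (forall t, measurable_fun setT (x t)) ->
  measurable_fun setT (fun w => lagsum (fun t => U t w) (fun t => x t w) n k).
  by move=> mx; apply: measurable_sum => i; exact: measurable_funM.
apply: (fatou_chebyshev P (fun m w => n%:R^-1 * lagsum (fun t => U t w) (fun t => Xm m t w) n k
     - \sum_(j < m) b j * gam (k%:Z + j%:Z))) => //.
- by move=> m; apply: measurable_funB => //; apply: measurable_funM => //; exact: ml.
- by apply: measurable_funB => //; apply: measurable_funM => //; apply: ml; exact: measurable_Xproc.
- apply: filterS converges_ae => w cw; apply: cvgB; last exact: (innov_Xproc 2 k).2.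
  apply: cvgM; first exact: cvg_cst.
  by apply: lagsum_cvg.
- by move=> m; exact: (lagsum_variance P U gam zms fos l0 delta Gam Kap s0 d01 Gam_ge Kap_ge m n k n0).1.
- by move=> m; exact: (lagsum_variance P U gam zms fos l0 delta Gam Kap s0 d01 Gam_ge Kap_ge m n k n0).2.
Qed.

Lemma innov_sum_tail (sg : R) n (a : R) : sg = 1 \/ sg = -1 -> 0 < a ->
  (P [set w | (a < `|\sum_(i < n) sg ^+ i * U i.+1%:Z w|)%R] <= (n%:R * Gam / a ^+ 2)%:E)%E.
Proof.
move=> sg1 a0; have [I E] := innov_sum_sqr P U gam zms Gam Gam_ge sg n sg1.
have mV : measurable_fun setT (fun w => \sum_(i < n) sg ^+ i * U i.+1%:Z w).
  by apply: measurable_sum => i; exact: measurable_funM.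
apply: (fatou_chebyshev P (fun _ w => \sum_(i < n) sg ^+ i * U i.+1%:Z w)) => //.
by apply: nearW => w; exact: cvg_cst.
Qed.

End LimitProcess.

(** * Rates of the estimators *)

Section MeasurableEstimators.
Context {R : realType}.

Lemma measurable_inv : measurable_fun setT (fun x : R => x^-1).
Proof.
rewrite (_ : setT = [set x : R | x != 0] `|` [set 0]); last first.
  by apply/seteqP; split => // x _ /=; case: (eqVneq x 0) => [->|]; [right|left].
have o0 : open [set x : R | x != 0].
  rewrite (_ : [set x : R | x != 0] = ~` [set 0]); first by rewrite openC; exact: closed_eq.
  by apply/seteqP; split => x /= /eqP.
apply/measurable_funU => //; first exact: open_measurable.
split; last exact: measurable_fun_set1.
apply: open_continuous_measurable_fun => // x; rewrite inE /= => x0.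
exact: inv_continuous.
Qed.

(* Outside [-1, 1], where no angle has the given cosine, [acos] takes a constant
   junk value. *)
Lemma measurable_acos : measurable_fun setT (@acos R).
Proof.
pose A : set R := [set x | -1 < x < 1]; pose B : set R := [set x | x < -1]; pose C : set R := [set x | 1 < x].
have oB : open B by exact: open_lt.
have oC : open C by exact: open_gt.
have oA : open A.
  rewrite (_ : A = [set x | x < 1] `&` [set x | -1 < x]); first by apply: openI; [exact: open_lt|exact: open_gt].
  by apply/seteqP; split => x /=; [move=> /andP[? ?]; split|move=> [? ?]; apply/andP].
have out x : 1 < `|x| -> acos x = point :> R.
  move=> x1; rewrite unlock /acos; case: xgetP => // y _ [_ cy].
  by have := cos_max y; rewrite cy leNgt x1.
rewrite (_ : setT = A `|` [set 1] `|` [set -1] `|` B `|` C); last first.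
  apply/seteqP; split => // x _; rewrite /A /B /C /=.
  case: (ltgtP x 1) => [x1|x1|->]; last by do 3 left; right.
    case: (ltgtP x (-1)) => [xm|xm|->]; last by do 2 left; right.
      by left; right.
    by do 4 left.
  by right.
have [mA mB mC] := And3 (open_measurable oA) (open_measurable oB) (open_measurable oC).
apply/measurable_funU => //; first by do !apply: measurableU.
split; last first.
  apply: (@eq_measurable_fun _ _ _ _ C (cst point)) => [x|]; last exact: measurable_cst.
  by rewrite inE /C /= => x1; rewrite out// (lt_le_trans x1)// ler_norm.
apply/measurable_funU => //; first by do !apply: measurableU.
split; last first.
  apply: (@eq_measurable_fun _ _ _ _ B (cst point)) => [x|]; last exact: measurable_cst.
  by rewrite inE /B /= => x1; rewrite out// -normrN (lt_le_trans _ (ler_norm _))// ltrNr.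
apply/measurable_funU => //; first by do !apply: measurableU.
split; last exact: measurable_fun_set1.
apply/measurable_funU => //; split; last exact: measurable_fun_set1.
apply: open_continuous_measurable_fun => // x; rewrite inE /A /= => x1.
exact: continuous_acos.
Qed.

Context {d : measure_display} {T : measurableType d}.
Implicit Types f g : T -> R.

Lemma measurable_div f g : measurable_fun setT f -> measurable_fun setT g ->
  measurable_fun setT (fun w => f w / g w).
Proof.
move=> mf mg; apply: measurable_funM => //.
exact: (measurableT_comp measurable_inv mg).
Qed.

Lemma measurable_ghat (X : int -> T -> R) n h : (forall t, measurable_fun setT (X t)) ->
  measurable_fun setT (fun w => ghat (X ^~ w) n h).
Proof.
move=> mX.
have mp l : measurable_fun setT (fun w => pgram (X ^~ w) n l).
  apply: measurable_funM => //; apply: measurable_funD; apply: measurable_funX;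
  by apply: measurable_sum => t; apply: measurable_funM.
apply: measurable_funM => //; apply: measurable_sum => k.
by apply: measurable_funD; apply: measurable_funM.
Qed.

Lemma measurable_a1f f g : measurable_fun setT f -> measurable_fun setT g ->
  measurable_fun setT (fun w => a1f (f w) (g w)).
Proof.
move=> mf mg; apply: measurable_div.
  by apply: measurable_funM => //; exact: measurable_funB.
by apply: measurable_funB => //; exact: measurable_funX.
Qed.

Lemma measurable_a2f f g : measurable_fun setT f -> measurable_fun setT g ->
  measurable_fun setT (fun w => a2f (f w) (g w)).
Proof.
by move=> mf mg; apply: measurable_div; apply: measurable_funB => //; exact: measurable_funX.
Qed.

Lemma measurable_lamf f g : measurable_fun setT f -> measurable_fun setT g ->
  measurable_fun setT (fun w => lamf (f w) (g w)).
Proof.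
move=> mf mg; apply: (measurableT_comp measurable_acos).
apply: measurable_div; last exact: measurable_funM.
by apply: measurable_funM => //; exact: measurable_funB.
Qed.

End MeasurableEstimators.

Section PowerRates.
Context {R : realType}.

Lemma powR_unbounded (p B : R) : 0 < p -> exists N : nat, forall n, (N <= n)%N -> B <= n%:R `^ p.
Proof.
move=> p0; pose B' := Num.max B 1; have B0 : 0 <= B' by rewrite le_max ler01 orbT.
exists (Num.trunc (B' `^ p^-1)).+1 => n Nn.
apply: le_trans (_ : B' <= _); first by rewrite le_max lexx.
rewrite -[leLHS](_ : (B' `^ p^-1) `^ p = B'); last first.
  by rewrite -powRrM mulVf ?gt_eqF// powRr1.
apply: ge0_ler_powR; rewrite ?nnegrE ?powR_ge0 ?(ltW p0)//.
apply: le_trans (_ : (Num.trunc (B' `^ p^-1)).+1%:R <= _); last by rewrite ler_nat.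
by apply/ltW/truncnS_gt.
Qed.

Lemma powR_vanishing (p e : R) : 0 < p -> 0 < e -> exists N : nat, forall n, (N <= n)%N ->
  n%:R `^ (- p) <= e.
Proof.
move=> p0 e0; have [N HN] := powR_unbounded p e^-1 p0; exists N => n /HN h.
by rewrite powRN -[e]invrK lef_pV2 ?posrE ?invr_gt0// (lt_le_trans _ h)// invr_gt0.
Qed.

End PowerRates.

(** * Statements valid outside an event of small probability *)

Section HoldsOutside.
Context {d : measure_display} {T : measurableType d} {R : realType}.
Variable P : probability T R.

(* The exceptional set is kept explicit, so that [Q] itself need not be measurable. *)
Definition holds_outside (e : R) (Q : T -> Prop) :=
  exists A, [/\ measurable A, (P A <= e%:E)%E & forall w, ~ A w -> Q w].

Lemma holds_outsideS (e e' : R) (Q Q' : T -> Prop) : e <= e' -> (forall w, Q w -> Q' w) ->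
  holds_outside e Q -> holds_outside e' Q'.
Proof.
move=> ee QQ [A [mA PA AQ]]; exists A; split => //; last by move=> w /AQ /QQ.
by apply: le_trans PA _; rewrite lee_fin.
Qed.

Lemma holds_outsideI (e e' : R) (Q Q' : T -> Prop) : holds_outside e Q -> holds_outside e' Q' ->
  holds_outside (e + e') (fun w => Q w /\ Q' w).
Proof.
move=> [A [mA PA AQ]] [B [mB PB BQ]]; exists (A `|` B); split; first exact: measurableU.
  apply: le_trans (measureU2 P mA mB) _.
  by rewrite EFinD; apply: leeD.
by move=> w AB; split; [apply: AQ => ?; apply: AB; left|apply: BQ => ?; apply: AB; right].
Qed.

Lemma holds_outside_ae (Q : T -> Prop) : {ae P, forall w, Q w} -> holds_outside 0 Q.
Proof.
move=> [A [mA PA AQ]]; exists A; split; rewrite ?PA//.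
by move=> w nA; apply: contrapT => nQ; apply: nA; apply: AQ.
Qed.

Lemma holds_outside_norm_le (f : T -> R) (a e : R) : measurable_fun setT f ->
  (P [set w | (a < `|f w|)%R] <= e%:E)%E -> holds_outside e (fun w => `|f w| <= a).
Proof.
move=> mf Pf; exists [set w | (a < `|f w|)%R]; split => //; last first.
  by move=> w /= /negP; rewrite -leNgt.
rewrite -[X in measurable X]setTI; apply: measurable_fun_ltr => //.
exact: measurableT_comp.
Qed.

Lemma bigO_prob_outside (Y : nat -> T -> R) (q : nat -> R) :
  (forall n, measurable_fun setT (Y n)) ->
  (forall eps, 0 < eps -> exists M, 0 < M /\ \forall n \near \oo,
     holds_outside eps (fun w => `|Y n w| <= M * q n)) -> bigO_prob P Y q.
Proof.
move=> mY H eps /H [M [M0 [N _ HN]]]; exists M; split => //; exists N => n /HN [A [mA PA AQ]].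
apply: le_trans PA; apply: le_measure; rewrite ?inE//.
  rewrite -[X in measurable X]setTI; apply: measurable_fun_ltr => //.
  exact: measurableT_comp.
move=> w /= lt; apply: contrapT => /AQ; rewrite leNgt.
by rewrite lt.
Qed.

Lemma holds_outside_ge (eps : R) (B : set T) : measurable B -> holds_outside eps B ->
  (P B >= (1 - eps)%:E)%E.
Proof.
move=> mB [A [mA PA AQ]]; apply: (@le_trans _ _ (P (~` A))).
  by rewrite probability_setC// EFinB; apply: leeB.
by apply: le_measure; rewrite ?inE//; exact: measurableC.
Qed.

End HoldsOutside.

Section EstimatorRates.
Context {d : measure_display} {T : measurableType d} {R : realType}.
Variables (P : probability T R) (c s : R) (q p1 p2 : nat -> R) (h1 h2 : nat -> T -> R).
Hypotheses (s0 : 0 < s) (cs : c ^+ 2 + s ^+ 2 = 1).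
Hypothesis q_small : forall e, 0 < e -> \forall n \near \oo, q n <= e.
Hypothesis p_limit : forall e, 0 < e -> \forall n \near \oo,
  `|p1 n - c| <= e /\ `|p2 n - (2 * c ^+ 2 - 1)| <= e.
Hypotheses (mh1 : forall n, measurable_fun setT (h1 n)) (mh2 : forall n, measurable_fun setT (h2 n)).
Hypothesis h_rate : forall eps, 0 < eps -> exists M, 0 < M /\ \forall n \near \oo,
  holds_outside P eps (fun w => `|h1 n w - p1 n| <= M * q n /\ `|h2 n w - p2 n| <= M * q n).

Let c2le : `|2 * c ^+ 2 - 1| <= 1.
Proof. by rewrite ler_norml; have := sqr_ge0 s; have := sqr_ge0 c; have := cs; lra. Qed.

Lemma a12f_rate eps : 0 < eps -> exists M, 0 < M /\ \forall n \near \oo,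
  holds_outside P eps (fun w => `|a1f (h1 n w) (h2 n w) - a1f (p1 n) (p2 n)| <= M * q n /\
                                `|a2f (h1 n w) (h2 n w) - a2f (p1 n) (p2 n)| <= M * q n).
Proof.
move=> e0; have [L [L0 HL]] := a12f_error _ _ s0 cs.
have [M [M0 HM]] := h_rate _ e0; exists (L * M); split; first exact: mulr_gt0.
(* Half of the radius [s^2 / 8] of [a12f_error]: one half for the bias of [p1], the other for the
   sampling error. *)
have s16 : 0 < s ^+ 2 / 16 by rewrite divr_gt0// exprn_gt0.
have s1 : s ^+ 2 <= 1 by have := sqr_ge0 c; have := cs; lra.
apply: filterS3 (q_small _ (divr_gt0 s16 M0)) (p_limit _ s16) HM => n.
rewrite ler_pdivlMr// mulrC => Mq [pc1 pc2]; apply: holds_outsideS => // w [d1 d2]; rewrite -!mulrA; apply: HL => //.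
- have := ler_normD (h1 n w - p1 n) (p1 n - c); rewrite addrA subrK => h; lra.
- by apply: le_trans pc1 _; lra.
- have := ler_normD (h2 n w - p2 n) (p2 n - (2 * c ^+ 2 - 1)); rewrite addrA subrK => h.
  have := ler_normD (h2 n w - (2 * c ^+ 2 - 1)) (2 * c ^+ 2 - 1); rewrite subrK.
  by have := c2le; lra.
- have := ler_normD (p2 n - (2 * c ^+ 2 - 1)) (2 * c ^+ 2 - 1); rewrite subrK.
  by have := c2le; lra.
Qed.

Lemma a12f_convergence e : 0 < e -> \forall n \near \oo,
  `|a1f (p1 n) (p2 n) - 2 * c| <= e /\ `|a2f (p1 n) (p2 n) + 1| <= e.
Proof.
move=> e0; have [L [L0 HL]] := a12f_error _ _ s0 cs; have [l1 l2] := a12f_limit _ _ s0 cs.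
have s8 : 0 < s ^+ 2 / 8 by rewrite divr_gt0// exprn_gt0.
have s1 : s ^+ 2 <= 1 by have := sqr_ge0 c; have := cs; lra.
have eL : 0 < e / L by exact: divr_gt0.
have [/p_limit Ha /p_limit Hb] := conj s8 eL.
apply: filterS2 Ha Hb => n [pa1 pa2] [pb1 pb2].
have -> : e = L * (e / L) by field; rewrite gt_eqF.
have := HL (p1 n) (p2 n) c (2 * c ^+ 2 - 1) (e / L); rewrite l1 l2 opprK; apply => //.
- by rewrite subrr normr0 ltW.
- have := ler_normD (p2 n - (2 * c ^+ 2 - 1)) (2 * c ^+ 2 - 1); rewrite subrK.
  by have := c2le; lra.
- by apply: le_trans c2le _; lra.
Qed.

Lemma lamf_rate eps : 0 < eps -> exists M, 0 < M /\ \forall n \near \oo,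
  holds_outside P eps (fun w => a2f (h1 n w) (h2 n w) < 0 /\
    `|lamf (a1f (h1 n w) (h2 n w)) (a2f (h1 n w) (h2 n w)) - lamf (a1f (p1 n) (p2 n)) (a2f (p1 n) (p2 n))| <= M * q n).
Proof.
move=> e0; have [eta [L [eta0 L0 HL]]] := lamf_error _ _ s0 cs.
have [M [M0 HM]] := a12f_rate _ e0; exists (L * M); split; first exact: mulr_gt0.
have eta2 : 0 < eta / 2 by exact: divr_gt0.
apply: filterS3 (q_small _ (divr_gt0 eta2 M0)) (a12f_convergence _ eta2) HM => n.
rewrite ler_pdivlMr// mulrC => Mq [pc1 pc2]; apply: holds_outsideS => // w [d1 d2]; rewrite -!mulrA.
have [||||//|//|? _ ?] := HL (a1f (h1 n w) (h2 n w)) (a2f (h1 n w) (h2 n w)) (a1f (p1 n) (p2 n)) (a2f (p1 n) (p2 n)) (M * q n); last by split.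
- have := ler_normD (a1f (h1 n w) (h2 n w) - a1f (p1 n) (p2 n)) (a1f (p1 n) (p2 n) - 2 * c).
  by rewrite addrA subrK => h; lra.
- have := ler_normD (a2f (h1 n w) (h2 n w) - a2f (p1 n) (p2 n)) (a2f (p1 n) (p2 n) + 1).
  by rewrite addrA subrK => h; lra.
- by apply: le_trans pc1 _; lra.
- by apply: le_trans pc2 _; lra.
Qed.

Lemma estimator_rates :
  [/\ bigO_prob P (fun n w => a1f (h1 n w) (h2 n w) - a1f (p1 n) (p2 n)) q,
      bigO_prob P (fun n w => a2f (h1 n w) (h2 n w) - a2f (p1 n) (p2 n)) q &
      forall eps : R, 0 < eps -> exists M : R, 0 < M /\ exists N : nat,
        forall n, (N <= n)%N ->
        (P [set w | (a2f (h1 n w) (h2 n w) < 0 /\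
          `|lamf (a1f (h1 n w) (h2 n w)) (a2f (h1 n w) (h2 n w))
            - lamf (a1f (p1 n) (p2 n)) (a2f (p1 n) (p2 n))| <= M * q n)%R]
           >= (1 - eps)%:E)%E].
Proof.
have m1 n : measurable_fun setT (fun w => a1f (h1 n w) (h2 n w)) by exact: measurable_a1f.
have m2 n : measurable_fun setT (fun w => a2f (h1 n w) (h2 n w)) by exact: measurable_a2f.
split.
- apply: bigO_prob_outside => [n|eps /a12f_rate[M [M0 HM]]]; first exact: measurable_funB.
  exists M; split => //; apply: filterS HM => n; apply: holds_outsideS => // w [].
  by [].
- apply: bigO_prob_outside => [n|eps /a12f_rate[M [M0 HM]]]; first exact: measurable_funB.
  exists M; split => //; apply: filterS HM => n; apply: holds_outsideS => // w [].
  by [].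
- move=> eps /lamf_rate[M [M0 [N _ HN]]]; exists M; split => //; exists N => n /HN.
  apply: holds_outside_ge.
  rewrite -[X in measurable X]setTI.
  rewrite (_ : setT `&` _ = (setT `&` [set w | a2f (h1 n w) (h2 n w) < 0]) `&`
    (setT `&` [set w | `|lamf (a1f (h1 n w) (h2 n w)) (a2f (h1 n w) (h2 n w))
            - lamf (a1f (p1 n) (p2 n)) (a2f (p1 n) (p2 n))| <= M * q n])); last by rewrite !setTI.
  apply: measurableI; first exact: measurable_fun_ltr.
  apply: measurable_fun_ler => //; apply: measurableT_comp => //.
  by apply: measurable_funB => //; exact: measurable_lamf.
Qed.

End EstimatorRates.

(** The bound [E] at the typical sizes [K = M / sqrt delta] and [L = M sqrt n]. As
    [sqrt delta <= 1 <= sqrt n], [L + 8 K] is at most [9 M sqrt n / sqrt delta], and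
    [648 = 8 * 81]. *)
Lemma edge_error_le {R : realType} (s M delta : R) (n : nat) : 0 < s -> 0 <= M -> 0 < delta < 1 ->
  (0 < n)%N ->
  24 * (M / Num.sqrt delta) ^+ 2 / n%:R
  + 8 * ((M * Num.sqrt n%:R + 8 * (M / Num.sqrt delta)) / s ^+ 2) ^+ 2 * n%:R^-1 ^+ 2
  <= (24 + 648 / s ^+ 4) * M ^+ 2 * (n%:R * delta)^-1.
Proof.
move=> s0 M0 /andP[d0 d1] n0.
have n0' : 0 < n%:R :> R by rewrite ltr0n.
set sd := Num.sqrt delta; set sn := Num.sqrt n%:R.
have sd0 : 0 < sd by rewrite sqrtr_gt0.
have sn0 : 0 < sn by rewrite sqrtr_gt0.
have sd2 : sd ^+ 2 = delta by rewrite sqr_sqrtr// ltW.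
have sn2 : sn ^+ 2 = n%:R by rewrite sqr_sqrtr// ltW.
have sd1 : sd <= 1 by rewrite -sqrtr1 ler_wsqrtr// ltW.
have sn1 : 1 <= sn by rewrite -sqrtr1 ler_wsqrtr// ler1n.
have h : M * sn + 8 * (M / sd) <= 9 * M * sn / sd.
  rewrite ler_pdivlMr// mulrDl.
  have -> : 8 * (M / sd) * sd = 8 * M * 1 by field; rewrite gt_eqF.
  have -> : 9 * M * sn = M * sn * 1 + 8 * M * sn by ring.
  by apply: lerD; apply: ler_wpM2l => //; rewrite mulr_ge0// ltW.
have h0 : 0 <= M * sn + 8 * (M / sd).
  by rewrite addr_ge0// mulr_ge0 ?mulr_ge0 ?invr_ge0// ltW.
have -> : (24 + 648 / s ^+ 4) * M ^+ 2 * (n%:R * delta)^-1 =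
  24 * (M / sd) ^+ 2 / n%:R + 8 * (9 * M * sn / sd / s ^+ 2) ^+ 2 * n%:R^-1 ^+ 2.
  by rewrite -sn2 -sd2; field; rewrite !gt_eqF.
rewrite lerD2l ler_wpM2r ?sqr_ge0// ler_wpM2l// ler_sqr ?nnegrE.
- by rewrite ler_wpM2r// invr_ge0 sqr_ge0.
- by rewrite mulr_ge0// invr_ge0 sqr_ge0.
- by apply: le_trans (_ : (M * sn + 8 * (M / sd)) / s ^+ 2 <= _); rewrite ?mulr_ge0 ?invr_ge0 ?sqr_ge0// ler_wpM2r// invr_ge0 sqr_ge0.
Qed.

(* With [x = (n delta)^(-1/2)], the term [M x] is the fluctuation of the innovation
   terms of the sample Yule-Walker equations and [A M^2 x^2] their edge terms. *)
Definition error_bound {R : realType} (l M delta : R) (n : nat) : R := let x := (Num.sqrt (n%:R * delta))^-1 in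
  (M + (24 + 648 / sin l ^+ 4) * M ^+ 2 * x) * x.

Lemma error_bound_ge {R : realType} (l M delta : R) (n : nat) :
  0 < sin l -> 0 <= M -> 0 < n%:R * delta ->
  M * (Num.sqrt (n%:R * delta))^-1 <= error_bound l M delta n /\
  (24 + 648 / sin l ^+ 4) * M ^+ 2 * (n%:R * delta)^-1 <= error_bound l M delta n.
Proof.
move=> s0 M0 nd0; rewrite /error_bound; set x := (Num.sqrt _)^-1; set A := 24 + _.
have x0 : 0 <= x by rewrite invr_ge0 sqrtr_ge0.
have A0 : 0 <= A.
  by apply: addr_ge0; [|apply: divr_ge0; [|apply/exprn_ge0/ltW]]; rewrite ?ler0n.
have -> : (n%:R * delta)^-1 = x ^+ 2 by rewrite /x exprVn sqr_sqrtr// ltW.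
have B0 : 0 <= A * M ^+ 2 * x * x.
  apply: mulr_ge0 => //; apply: mulr_ge0 => //; apply: mulr_ge0 => //; exact: sqr_ge0.
rewrite mulrDl; split; first by rewrite lerDl.
by rewrite (_ : A * M ^+ 2 * x ^+ 2 = A * M ^+ 2 * x * x) ?lerDr; [exact: mulr_ge0|ring].
Qed.

(** * Probability bounds at a fixed sample size *)

Section SampleAutocorrelationError.
Context {d : measure_display} {T : measurableType d} {R : realType}.
Variables (P : probability T R) (U : int -> T -> R) (gam : int -> R).
Hypotheses (zms : zero_mean_weakly_stationary P U gam) (fos : fourth_order_stationary P U).
Variables (l0 Gam Kap : R).
Hypothesis s0 : 0 < sin l0.
Hypothesis Gam_ge : forall m (f : nat -> int), {in gtn m &, injective f} ->
  \sum_(i < m) `|gam (f i)| <= Gam.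
Hypothesis Kap_ge : forall m n p (f g : nat -> int) (e : nat -> nat -> int),
  injective f -> injective g -> (forall b, injective (e b)) ->
  \sum_(a < m) \sum_(b < n) \sum_(c < p) `|cum4 P (U 0) (U (f a)) (U (g b)) (U (e b c))| <= Kap.

Let s := sin l0.
Let Gam0 : 0 <= Gam.
Proof. by apply: le_trans (Gam_ge 0 id _); rewrite ?big_ord0// => ? ? ? ?. Qed.
Let Kap0 : 0 <= Kap.
Proof.
apply: le_trans (Kap_ge 0 0 0 Posz Posz (fun=> Posz) _ _ _); rewrite ?big_ord0//.
- by move=> ? ? [].
- by move=> ? ? [].
- by move=> _ ? ? [].
Qed.

(** Union bound over six edge values of the process (times -1, 0, 1, 2, n - 1, n), three lag sums
    and two sums of innovations, plain and alternating. *)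
Definition tail_const (l Ga Ka : R) := let si := (sin l)^-1 in
  6 * (si * (si * Ga)) + 3 * (si * si * Ka + 2 * (si * (si * (Ga * Ga)))) + 2 * Ga.

Section FixedSample.
Variables (delta M : R) (n : nat).
Hypotheses (d01 : 0 < delta < 1) (M0 : 0 < M) (n2 : (2 < n)%N).

Let X := Xproc U l0 delta.
Let g (k : nat) := Ex P (fun w => U 2 w * X (2 - k%:Z) w).
Let D (h : nat) w := ghat (X ^~ w) n h%:Z.
Let r := 1 - delta.
Let G (k : nat) w := n%:R^-1 * lagsum (U ^~ w) (X ^~ w) n k.

Let n0 : 0 < n%:R :> R. Proof. by rewrite ltr0n; case: n n2. Qed.
Let d0 : 0 < delta. Proof. by case/andP: d01. Qed.
Let si0 : 0 <= s^-1. Proof. by rewrite invr_ge0 ltW. Qed.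
Let mU t : measurable_fun setT (U t). Proof. exact: innov_measurable zms t. Qed.
Let mX t : measurable_fun setT (X t). Proof. exact: measurable_Xproc zms _ _ _. Qed.

(** Thresholds here and below are scaled by the order of the standard deviation, so that the
    exceptional probability depends on neither [delta] nor [n]. *)
Let X_outside t : holds_outside P (s^-1 * (s^-1 * Gam) / M ^+ 2) (fun w => `|X t w| <= M / Num.sqrt delta).
Proof.
apply: holds_outside_norm_le => //.
have a0 : 0 < M / Num.sqrt delta by rewrite divr_gt0// sqrtr_gt0.
apply: le_trans (Xproc_tail P U gam zms l0 delta Gam s0 d01 Gam_ge t _ a0) _.
rewrite lee_fin exprMn exprVn sqr_sqrtr ?(ltW d0)// le_eqVlt; apply/orP; left; apply/eqP.
by rewrite -/s; field; rewrite (gt_eqF d0) (gt_eqF M0) (gt_eqF s0).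
Qed.

Let sum_outside (sg : R) : sg = 1 \/ sg = -1 ->
  holds_outside P (Gam / M ^+ 2) (fun w => `|\sum_(i < n) sg ^+ i * U i.+1%:Z w| <= M * Num.sqrt n%:R).
Proof.
move=> sg1; apply: holds_outside_norm_le; first by apply: measurable_sum => i; exact: measurable_funM.
have a0 : 0 < M * Num.sqrt n%:R by rewrite mulr_gt0// sqrtr_gt0.
apply: le_trans (innov_sum_tail P U gam zms Gam Gam_ge sg n _ sg1 a0) _.
rewrite lee_fin exprMn sqr_sqrtr ?(ltW n0)// le_eqVlt; apply/orP; left; apply/eqP.
by field; rewrite (gt_eqF n0) (gt_eqF M0).
Qed.

Let x := (Num.sqrt (n%:R * delta))^-1.
Let nd0 : 0 < n%:R * delta. Proof. exact: mulr_gt0. Qed.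
Let x0 : 0 < x. Proof. by rewrite invr_gt0 sqrtr_gt0. Qed.

Let lag_outside k : holds_outside P
  ((s^-1 * s^-1 * Kap + 2 * (s^-1 * (s^-1 * (Gam * Gam)))) / M ^+ 2) (fun w => `|G k w - g k| <= M * x).
Proof.
apply: holds_outside_norm_le.
  apply: measurable_funB => //; apply: measurable_funM => //.
  by apply: measurable_sum => i; exact: measurable_funM.
have a0 : 0 < M * x by exact: mulr_gt0.
have n0' : (0 < n)%N by case: n n2.
apply: le_trans (lagsum_tail P U gam zms fos l0 delta Gam Kap s0 d01 Gam_ge Kap_ge n k _ n0' a0) _.
rewrite lee_fin exprMn exprVn sqr_sqrtr ?(ltW nd0)// -/s.
have -> : n%:R^-1 * (s^-1 / s * Kap + 2 * (s^-1 / delta * (s^-1 * (Gam * Gam)))) / (M ^+ 2 / (n%:R * delta)) =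
  (delta * (s^-1 / s * Kap) + 2 * (s^-1 * (s^-1 * (Gam * Gam)))) / M ^+ 2.
  by field; rewrite (gt_eqF d0) (gt_eqF M0) (gt_eqF s0) (gt_eqF n0).
rewrite ler_wpM2r ?invr_ge0 ?sqr_ge0// lerD2r ler_piMl ?mulr_ge0//.
by case/andP: d01 => _ /ltW.
Qed.

Let z := error_bound l0 M delta n.

Let edgez : (24 + 648 / s ^+ 4) * M ^+ 2 * (n%:R * delta)^-1 <= z.
Proof. exact: (error_bound_ge l0 M delta n s0 (ltW M0) nd0).2. Qed.

Let lagz : M * x <= z.
Proof. exact: (error_bound_ge l0 M delta n s0 (ltW M0) nd0).1. Qed.

Lemma yw_error_outside : holds_outside P (tail_const l0 Gam Kap / M ^+ 2) (fun w =>
  [/\ `|D 0 w - (2 * r * cos l0 * D 1 w - r ^+ 2 * D 2 w + G 0 w)| <= z,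
      `|D 1 w - (2 * r * cos l0 * D 0 w - r ^+ 2 * D 1 w + G 1 w)| <= z,
      `|D 2 w - (2 * r * cos l0 * D 1 w - r ^+ 2 * D 0 w + G 2 w)| <= z &
      [/\ `|G 0 w - g 0| <= z, `|G 1 w - g 1| <= z & `|G 2 w - g 2| <= z]]).
Proof.
have C := holds_outside_ae _ _ (converges_ae P U gam zms l0 delta s0 d01).
have sp : holds_outside P (Gam / M ^+ 2) (fun w => `|\sum_(i < n) 1 ^+ i * U i.+1%:Z w| <= M * Num.sqrt n%:R).
  by apply: sum_outside; left.
have sm : holds_outside P (Gam / M ^+ 2) (fun w => `|\sum_(i < n) (-1) ^+ i * U i.+1%:Z w| <= M * Num.sqrt n%:R).
  by apply: sum_outside; right.
have XX := holds_outsideI _ _ _ _ _ (holds_outsideI _ _ _ _ _ (X_outside 0) (X_outside (-1)))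
  (holds_outsideI _ _ _ _ _ (holds_outsideI _ _ _ _ _ (X_outside 1) (X_outside 2))
    (holds_outsideI _ _ _ _ _ (X_outside n%:Z) (X_outside (n%:Z - 1)))).
have LL := holds_outsideI _ _ _ _ _ (lag_outside 0) (holds_outsideI _ _ _ _ _ (lag_outside 1) (lag_outside 2)).
apply: holds_outsideS (holds_outsideI _ _ _ _ _ C (holds_outsideI _ _ _ _ _
  (holds_outsideI _ _ _ _ _ sp sm) (holds_outsideI _ _ _ _ _ XX LL))).
  by rewrite /tail_const -/s le_eqVlt; apply/orP; left; apply/eqP; ring.
move=> w [cw [[Sp Sm] [[[X0 Xm1] [[X1 X2] [Xn Xn1]]] [L0 [L1 L2]]]]].
have Sp' : `|\sum_(i < n) U i.+1%:Z w| <= M * Num.sqrt n%:R.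
  by apply: le_trans Sp; under [in leRHS]eq_bigr do rewrite expr1n mul1r.
have rec t : X t w = 2 * r * cos l0 * X (t - 1) w - r ^+ 2 * X (t - 2) w + U t w.
  exact: Xproc_rec.
have r01 : 0 < r < 1 by move: d01; rewrite /r => /andP[? ?]; apply/andP; split; lra.
have cs : cos l0 ^+ 2 + sin l0 ^+ 2 = 1 by exact: cos2Dsin2.
have n0' : (0 < n)%N by case: n n2.
have E := le_trans (edge_error_le s M delta n s0 (ltW M0) d01 n0') edgez.
split; [| | |by split; apply: le_trans lagz].
- apply: le_trans E.
  exact: (sample_yw0 (X ^~ w) (U ^~ w) r (cos l0) s (M / Num.sqrt delta) (M * Num.sqrt n%:R) n).
- apply: le_trans E.
  exact: (sample_yw1 (X ^~ w) (U ^~ w) r (cos l0) s (M / Num.sqrt delta) (M * Num.sqrt n%:R) n).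
- apply: le_trans E.
  exact: (sample_yw2 (X ^~ w) (U ^~ w) r (cos l0) s (M / Num.sqrt delta) (M * Num.sqrt n%:R) n).
Qed.

End FixedSample.

Variables (c0 C : R).
Hypothesis spec : forall (r : R) (J : nat), 0 < r < 1 -> 1 - r <= l0 -> 1 - r <= pi - l0 ->
  c0 - C * (1 - r) - C * (r ^+ J.+1 / (1 - r) ^+ 2) <=
  gam 0 + 2 * \sum_(j < J) r ^+ j.+1 * cos (j.+1%:R * l0) * gam j.+1%:Z.
Hypothesis c00 : 0 < c0.

(** Half of [c0] survives the spectral bound for small [delta]; 16 comes from [yw_variance_ge]. *)
Let K := c0 / 2 / 16.
Let Gs := s^-1 * Gam.

(** The first two conditions keep the spectral window around [l0] inside [[0, pi]], the third leaves
    [c0 / 2] in the spectral bound, and the last makes the [g1] term harmless in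
    [yw_variance_ge]. *)
Definition small_delta (delta : R) := [/\ delta <= l0, delta <= pi - l0,
  C * delta <= c0 / 2 & 8 * delta * ((sin l0)^-1 * Gam) <= c0 / 2].

Section FixedDelta.
Variable delta : R.
Hypotheses (d01 : 0 < delta < 1) (ds : small_delta delta).

Let r := 1 - delta.
Let X := Xproc U l0 delta.
Let y h := Ex P (fun w => X 0 w * X h w).
Let g (k : nat) := Ex P (fun w => U 2 w * X (2 - k%:Z) w).
Let r01 : 0 < r < 1. Proof. by move: d01; rewrite /r => /andP[? ?]; apply/andP; split; lra. Qed.
Let cs : cos l0 ^+ 2 + s ^+ 2 = 1. Proof. exact: cos2Dsin2. Qed.
Let rd : 1 - r = delta. Proof. by rewrite /r opprB addrC subrK. Qed.
Let gG j : `|g j| <= Gs. Proof. exact: (innov_Xproc_le P U gam). Qed.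
Let Y0 := Xproc_yw0 P U gam zms l0 delta s0 d01.
Let Y1 := Xproc_yw1 P U gam zms l0 delta s0 d01.
Let Y2 := Xproc_yw2 P U gam zms l0 delta s0 d01.
Let K0 : 0 < K. Proof. by rewrite !divr_gt0. Qed.

Let Xproc_variance_ge : K / (1 - r) <= y 0.
Proof.
have [h1 h2 h3 h4] := ds.
apply: (yw_variance_ge r (cos l0) s (g 0) (g 1) (g 2) (y 0) (y 1) (y 2) r01 s0 cs Y0 Y1 Y2 Gs (c0 / 2) (gG 1)).
- exact: divr_gt0.
- have := innov_Xproc_ge P U gam zms l0 delta s0 d01 c0 C => H; apply: le_trans (H _).
    by rewrite rd; lra.
  by move=> J; apply: spec; rewrite ?rd.
- by rewrite rd.
Qed.

Lemma rhoX1_limit : `|rhoX P U l0 delta 1 - cos l0| <= (1 + Gs / K) * delta.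
Proof.
rewrite (rhoXE P U gam)//; have := autocorr1_limit r (cos l0) s (g 1) (y 0) (y 1) r01 cs Y1 Gs K (gG 1) K0.
by have := Xproc_variance_ge; rewrite rd => V; exact.
Qed.

Lemma rhoX2_limit : `|rhoX P U l0 delta 2 - (2 * cos l0 ^+ 2 - 1)| <= (6 + 3 * Gs / K) * delta.
Proof.
rewrite (rhoXE P U gam)//.
have := autocorr2_limit r (cos l0) s (g 1) (g 2) (y 0) (y 1) (y 2) r01 cs Y1 Y2 Gs K (gG 1) (gG 2) K0.
by have := Xproc_variance_ge; rewrite rd => V; exact.
Qed.

Lemma rhohat_error_outside M n : 0 < M -> (2 < n)%N ->
  24 * error_bound l0 M delta n <= s ^+ 2 * K ->
  let e := 12 * (1 + Gs * 6 / (s ^+ 2 * K)) / K * (delta * error_bound l0 M delta n) in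
  holds_outside P (tail_const l0 Gam Kap / M ^+ 2) (fun w =>
    `|rhohat U l0 delta n 1 w - rhoX P U l0 delta 1| <= e /\
    `|rhohat U l0 delta n 2 w - rhoX P U l0 delta 2| <= e).
Proof.
move=> M0 n2 zk e; apply: holds_outsideS (lexx _) _ (yw_error_outside delta M n d01 M0 n2).
move=> w [E0 E1 E2 [F0 F1 F2]]; rewrite !(rhoXE P U gam zms l0 delta s0 d01) /e.
have := (autocorr_error r (cos l0) s (g 0) (g 1) (g 2) (y 0) (y 1) (y 2) r01 s0 cs Y0 Y1 Y2 Gs K _
   (gG 1) (gG 2) K0 Xproc_variance_ge _ _ _ _ _ _ E0 E1 E2 F0 F1 F2 zk).
by rewrite rd.
Qed.

End FixedDelta.
End SampleAutocorrelationError.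

(** The left side is [sqrt (delta / n)]; the comparison is made between squares. *)
Lemma root_rate_le {R : realType} (alpha c2 delta : R) (n : nat) : (0 < n)%N -> 0 <= c2 -> 0 < delta ->
  delta <= c2 * n%:R `^ (- alpha) ->
  delta * (Num.sqrt (n%:R * delta))^-1 <= Num.sqrt c2 * n%:R `^ (- ((1 + alpha) / 2)).
Proof.
move=> n0 c20 d0 dc.
have n0' : 0 < n%:R :> R by rewrite ltr0n.
have nd0 : 0 < n%:R * delta by exact: mulr_gt0.
rewrite -ler_sqr ?nnegrE; last 2 first.
- by rewrite mulr_ge0 ?ltW// invr_gt0 sqrtr_gt0.
- by rewrite mulr_ge0 ?sqrtr_ge0 ?powR_ge0.
rewrite !exprMn exprVn !sqr_sqrtr ?(ltW nd0)//.
have -> : (n%:R `^ (- ((1 + alpha) / 2))) ^+ 2 = n%:R^-1 * n%:R `^ (- alpha) :> R.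
  rewrite expr2 -powRD ?(gt_eqF n0') ?implybT//.
  have -> : - ((1 + alpha) / 2) - (1 + alpha) / 2 = - 1 + - alpha by field.
  by rewrite powRD ?(gt_eqF n0') ?implybT// powR_inv1 ?ltW.
have -> : delta ^+ 2 / (n%:R * delta) = n%:R^-1 * delta by field; rewrite (gt_eqF n0') (gt_eqF d0).
have -> : c2 * (n%:R^-1 * n%:R `^ (- alpha)) = n%:R^-1 * (c2 * n%:R `^ (- alpha)) by ring.
by rewrite ler_wpM2l// invr_ge0 ltW.
Qed.

Lemma inv_sqrt_small {R : realType} (alpha c1 e : R) (delta : nat -> R) : alpha < 1 -> 0 < c1 ->
  (forall n, 0 < delta n) -> 0 < e ->
  (\forall n \near \oo, c1 * n%:R `^ (- alpha) <= delta n) ->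
  \forall n \near \oo, (Num.sqrt (n%:R * delta n))^-1 <= e.
Proof.
move=> a1 c10 d0 e0; have p0 : 0 < 1 - alpha by rewrite subr_gt0.
have [N HN] := powR_unbounded (1 - alpha) (e^-1 ^+ 2 / c1) p0.
have H : \forall n \near \oo, e^-1 ^+ 2 / c1 <= n%:R `^ (1 - alpha) by exists N.
move=> Hd; apply: filterS3 H (nbhs_infty_gt 0) Hd => n H n0 dn.
have n0' : 0 < n%:R :> R by rewrite ltr0n.
have nd0 : 0 < n%:R * delta n by exact: mulr_gt0.
rewrite -[e]invrK lef_pV2 ?posrE ?invr_gt0 ?sqrtr_gt0//.
rewrite -ler_sqr ?nnegrE ?sqrtr_ge0 ?invr_ge0 ?(ltW e0)// sqr_sqrtr ?(ltW nd0)//.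
move: H; rewrite ler_pdivrMr// => /le_trans; apply.
rewrite powRD ?(gt_eqF n0') ?implybT// powRr1 ?(ltW n0')//.
by rewrite -mulrA ler_wpM2l ?(ltW n0')// mulrC.
Qed.

Theorem theorem1 (d : measure_display) (T : measurableType d) (R : realType)
  (P : probability T R) (l0 : R) (U : int -> T -> R) (gamU : int -> R)
  (fU : R -> R) (alpha : R) (delta : nat -> R) :
  0 < l0 < pi ->
  zero_mean_weakly_stationary P U gamU ->
  fourth_order_stationary P U ->
  is_spectral_density gamU fU ->
  {within `[0, pi], continuous fU} ->
  (exists c : R, 0 < c /\ forall l, 0 <= l <= pi -> c <= fU l) ->
  (exists B : R, forall N, sumZ N (fun h => `|h%:~R| * `|gamU h|) <= B) ->
  (exists B : R, forall N,
      sumZ N (fun h1 => sumZ N (fun h2 => sumZ N (fun h3 =>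
        (1 + `|h1%:~R| + `|h2%:~R| + `|h3%:~R|)
        * `|cum4 P (U 0) (U h1) (U h2) (U h3)|))) <= B) ->
  0 < alpha < 3^-1 ->
  (forall n, 0 < delta n < 1) ->
  (exists c1 c2 : R, 0 < c1 /\ 0 < c2 /\ exists N0 : nat, forall n, (N0 <= n)%N ->
      c1 * n%:R `^ (- alpha) <= delta n <= c2 * n%:R `^ (- alpha)) ->
  let rate := fun n : nat => n%:R `^ (- ((1 + alpha) / 2)) in
  let a1 := fun n : nat => a1f (rhoX P U l0 (delta n) 1) (rhoX P U l0 (delta n) 2) in
  let a2 := fun n : nat => a2f (rhoX P U l0 (delta n) 1) (rhoX P U l0 (delta n) 2) in
  let a1h := fun (n : nat) w =>
    a1f (rhohat U l0 (delta n) n 1 w) (rhohat U l0 (delta n) n 2 w) in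
  let a2h := fun (n : nat) w =>
    a2f (rhohat U l0 (delta n) n 1 w) (rhohat U l0 (delta n) n 2 w) in
  [/\ bigO_prob P (fun n w => a1h n w - a1 n) rate,
      bigO_prob P (fun n w => a2h n w - a2 n) rate &
      forall eps : R, 0 < eps -> exists M : R, 0 < M /\ exists N : nat,
        forall n, (N <= n)%N ->
        (P [set w | (a2h n w < 0 /\
                    `|lamf (a1h n w) (a2h n w) - lamf (a1 n) (a2 n)| <= M * rate n)%R]
           >= (1 - eps)%:E)%E].

Proof.
move=> l0pi zms fos fsd _ [c0 [c00 fc0]] [B2 HB2] [B3 HB3] /andP[al0 al3] d01 [c1 [c2 [c10 [c20 [N0 HN0]]]]].
move=> rate a1 a2 a1h a2h.
have s0 : 0 < sin l0 by exact: sin_gt0_pi.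
have cs : cos l0 ^+ 2 + sin l0 ^+ 2 = 1 by exact: cos2Dsin2.
have [C [C0 HC]] := spectral_sum_ge gamU fU l0 c0 l0pi fsd c00 fc0.
set Gam := `|gamU 0| + B2.
have Gam_ge : forall m (f : nat -> int), {in gtn m &, injective f} -> \sum_(i < m) `|gamU (f i)| <= Gam.
  exact: absolutely_summable.
have Kap_ge := triple_summable (fun h1 h2 h3 => cum4 P (U 0) (U h1) (U h2) (U h3)) B3 HB3.
have d0 n : 0 < delta n by case/andP: (d01 n).
have Nlow : \forall n \near \oo, c1 * n%:R `^ (- alpha) <= delta n.
  by exists N0 => // n /HN0 /andP[].
have Nup : \forall n \near \oo, delta n <= c2 * n%:R `^ (- alpha).
  by exists N0 => // n /HN0 /andP[].
have small e : 0 < e -> \forall n \near \oo, delta n <= e.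
  move=> e0; have [N HN] := powR_vanishing alpha (e / c2) al0 (divr_gt0 e0 c20).
  have H : \forall n \near \oo, n%:R `^ (- alpha) <= e / c2 by exists N.
  apply: filterS2 H Nup => n; rewrite ler_pdivlMr// mulrC => h /le_trans; exact.
have a1' : alpha < 1 by apply: lt_trans al3 _; rewrite invf_lt1// ltr1n.
have xsmall e : 0 < e -> \forall n \near \oo, (Num.sqrt (n%:R * delta n))^-1 <= e.
  by move=> e0; apply: (inv_sqrt_small alpha c1 e delta).
set K := c0 / 2 / 16; set Gs := (sin l0)^-1 * Gam.
have K0 : 0 < K by rewrite !divr_gt0.
have Gam0 : 0 <= Gam by apply: le_trans (Gam_ge 0%N id _); rewrite ?big_ord0// => ? ? ? ?.
have Gs0 : 0 <= Gs by rewrite mulr_ge0// invr_ge0 ltW.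
have nsmall : \forall n \near \oo, small_delta l0 Gam c0 C (delta n).
  have [l00 lpi] := andP l0pi.
  have p1 : 0 < pi - l0 by rewrite subr_gt0.
  (* Adding 1 to [C] and to [8 * Gs] keeps the denominators of the thresholds positive, since both
     constants are only known to be nonnegative. *)
  have C1 : 0 < C + 1 by rewrite ltr_wpDl.
  have G1 : 0 < 8 * Gs + 1 by rewrite ltr_wpDl// mulr_ge0.
  have c02 : 0 < c0 / 2 by exact: divr_gt0.
  have H1 := small _ (divr_gt0 c02 C1); have H2 := small _ (divr_gt0 c02 G1).
  apply: filterS2 (filterI (small _ l00) (small _ p1)) (filterI H1 H2) => n [h1 h2] [].
  rewrite !ler_pdivlMr// => h3 h4; have dn := d0 n; split => //.
    by move: h3; rewrite mulrDr mulr1 mulrC; lra.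
  by rewrite -/Gs; move: h4; rewrite mulrDr mulr1; lra.
have plim e : 0 < e -> \forall n \near \oo, `|rhoX P U l0 (delta n) 1 - cos l0| <= e /\
    `|rhoX P U l0 (delta n) 2 - (2 * cos l0 ^+ 2 - 1)| <= e.
  (* The constant of the second autocorrelation also dominates that of the first. *)
  move=> e0; have q0 : 0 < 6 + 3 * Gs / K by rewrite ltr_wpDr// divr_ge0 ?(ltW K0)// mulr_ge0.
  apply: filterS2 nsmall (small _ (divr_gt0 e0 q0)) => n ns; rewrite ler_pdivlMr// mulrC => h.
  have h1 := rhoX1_limit P U gamU zms l0 Gam s0 Gam_ge c0 C HC c00 (delta n) (d01 n) ns.
  have h2 := rhoX2_limit P U gamU zms l0 Gam s0 Gam_ge c0 C HC c00 (delta n) (d01 n) ns.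
  split; last exact: le_trans h2 h.
  apply: le_trans h1 (le_trans _ h); rewrite ler_wpM2r ?(ltW (d0 n))//.
  have : 0 <= Gs / K by rewrite divr_ge0// ltW.
  by rewrite -/K -/Gs; set v := Gs / K; rewrite -[3 * Gs / K]mulrA -/v; lra.
have mX n t : measurable_fun setT (Xproc U l0 (delta n) t) by exact: measurable_Xproc zms _ _ _.
have mh n (h : int) : measurable_fun setT (rhohat U l0 (delta n) n h).
  apply: measurable_div; exact: measurable_ghat.
apply: (estimator_rates P (cos l0) (sin l0) rate (fun n => rhoX P U l0 (delta n) 1)
  (fun n => rhoX P U l0 (delta n) 2) (fun n => rhohat U l0 (delta n) n 1)
  (fun n => rhohat U l0 (delta n) n 2)) => //.
  move=> e e0; have p0 : 0 < (1 + alpha) / 2 by rewrite divr_gt0// addr_gt0.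
  by have [N HN] := powR_vanishing _ e p0 e0; exists N.
move=> eps eps0; set Ct := tail_const l0 Gam B3.
(* Makes the total tail [Ct / M^2] at most [eps]; the summand 1 ensures that [M] is positive. *)
pose M := Num.sqrt (`|Ct| / eps) + 1.
have M0 : 0 < M by rewrite ltr_wpDl// sqrtr_ge0.
have CM : Ct / M ^+ 2 <= eps.
  rewrite ler_pdivrMr ?exprn_gt0//; apply: le_trans (ler_norm _) _.
  rewrite mulrC -ler_pdivrMr// -[leLHS]sqr_sqrtr ?divr_ge0 ?(ltW eps0)//.
  by rewrite ler_sqr ?nnegrE ?sqrtr_ge0 ?(ltW M0)// lerDl.
(* Once [x <= 1], the quadratic edge term of [error_bound] is absorbed into the linear one, giving
   [Q * x]. *)
pose A := 24 + 648 / sin l0 ^+ 4 : R; pose Q := M + A * M ^+ 2.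
have A0 : 0 <= A.
  by apply: addr_ge0; [|apply: divr_ge0; [|apply/exprn_ge0/ltW]]; rewrite ?ler0n.
have Q0 : 0 < Q by rewrite ltr_wpDr// mulr_ge0// sqr_ge0.
set q := 12 * (1 + Gs * 6 / (sin l0 ^+ 2 * K)) / K.
have q0 : 0 < q.
  rewrite divr_gt0// mulr_gt0// ltr_wpDr//.
  by apply: divr_ge0; apply: mulr_ge0; rewrite ?sqr_ge0 ?(ltW K0)// ?ler0n.
exists (q * (Q * Num.sqrt c2)); split; first by do 2 apply: mulr_gt0 => //; rewrite sqrtr_gt0.
(* Below this threshold for [x], the error is small enough for [rhohat_error_outside]. *)
have zK : 0 < sin l0 ^+ 2 * K / (24 * Q).
  by rewrite divr_gt0 ?mulr_gt0 ?exprn_gt0.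
apply: filterS3 (filterI (xsmall _ ltr01) (xsmall _ zK)) nsmall (filterI (nbhs_infty_gt 2) Nup).
move=> n [x1 x2] ns [n2 dn].
have n0 : (0 < n)%N by exact: ltn_trans n2.
set x := (Num.sqrt (n%:R * delta n))^-1 in x1 x2 *.
have x0 : 0 <= x by rewrite invr_ge0 sqrtr_ge0.
have zQ : error_bound l0 M (delta n) n <= Q * x.
  rewrite /error_bound -/x ler_wpM2r// lerD2l -/A -[leRHS]mulr1 ler_wpM2l//.
  by rewrite mulr_ge0// sqr_ge0.
have zK' : 24 * error_bound l0 M (delta n) n <= sin l0 ^+ 2 * K.
  apply: le_trans (_ : 24 * (Q * x) <= _); first by rewrite ler_wpM2l.
  by move: x2; rewrite ler_pdivlMr ?mulr_gt0// mulrC -mulrA.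
have := rhohat_error_outside P U gamU zms fos l0 Gam B3 s0 Gam_ge Kap_ge c0 C HC c00
  (delta n) (d01 n) ns M n M0 n2 zK'.
rewrite -/K -/Gs -/q -/Ct => /=; apply: holds_outsideS => // w.
have eM : q * (delta n * error_bound l0 M (delta n) n) <= q * (Q * Num.sqrt c2) * rate n.
  rewrite -mulrA ler_wpM2l ?(ltW q0)//.
  apply: le_trans (ler_wpM2l (ltW (d0 n)) zQ) _.
  rewrite mulrCA -mulrA ler_wpM2l ?(ltW Q0)//.
  exact: (root_rate_le alpha c2 (delta n) n n0 (ltW c20)).
by case=> e1 e2; split; [exact: le_trans e1 eM|exact: le_trans e2 eM].
Qed.
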